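(* Let $\mathbb B$ be the unit ball in $\mathbb R^d$ and, for $m\in\mathbb N$, denote by $\lambda_1^{(m)}(\mathbb B)$ the first eigenvalue of the problem $(-\Delta)^m u=\lambda u$ in $\mathbb B$, $u=\frac{\partial u}{\partial\nu}=\dots=\frac{\partial^{m-1}u}{\partial\nu^{m-1}}=0$ on $\partial\mathbb B$. Then $$2^{2m}\frac{\Gamma(m+1)\Gamma(m+d/2)}{\Gamma(d/2)}\le\lambda_1^{(m)}(\mathbb B)\le 2^{2m}\frac{\Gamma^2(m+1)\Gamma(2m+d/2+1)}{(m+d/2)\Gamma(d/2)\Gamma(2m+1)}.$$ Moreover, as $m\to\infty$, $$2^{2m}\frac{\Gamma(m+1)\Gamma(m+d/2)}{\Gamma(d/2)}\approx\frac{2\pi}{\Gamma(d/2)}\left(\frac{2m}{e}\right)^{2m}m^{\frac d2}$$ and $$2^{2m}\frac{\Gamma^2(m+1)\Gamma(2m+d/2+1)}{(m+d/2)\Gamma(d/2)\Gamma(2m+1)}\approx2^{\frac d2}\frac{2\pi}{\Gamma(d/2)}\left(\frac{2m}{e}\right)^{2m}m^{\frac d2}.$$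
   Context: Here $d\ge1$, $\Gamma$ is the Euler Gamma function, and $\approx$ means that the quotient of the two sides tends to $1$ as $m\to\infty$ (with $d$ fixed). The eigenvalue problem is understood in the weak sense in $H^m_0(\mathbb B)$; with $\nabla^m u=\Delta^j u$ if $m=2j$ and $\nabla^m u=\nabla\Delta^j u$ if $m=2j+1$, one has $\lambda_1^{(m)}(\mathbb B)=\min_{0\ne u\in H^m_0(\mathbb B)}\int_{\mathbb B}|\nabla^m u|^2\big/\int_{\mathbb B}u^2$. *)

(* Defs.v *)
From HB Require Import structures.
From mathcomp Require Import all_boot all_order all_algebra.
From mathcomp Require Import all_classical all_reals all_analysis.

Set Implicit Arguments.
Unset Strict Implicit.
Unset Printing Implicit Defensive.

Import Order.TTheory GRing.Theory Num.Theory.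
Import numFieldNormedType.Exports.

Local Open Scope classical_set_scope.
Local Open Scope ring_scope.

(* R^d is 'rV[R]_d with the product sigma-algebra generated by the coordinates,
   which coincides with the Borel sigma-algebra. *)
Section rV_measurable.
Context (R : realType) (d : nat).

Definition rV_coord (i : 'I_d) (x : 'rV[R]_d) : R := x ord0 i.

Let rV_set0 : g_sigma_preimage rV_coord set0.
Proof. exact: sigma_algebra0. Qed.

Let rV_setC A : g_sigma_preimage rV_coord A -> g_sigma_preimage rV_coord (~` A).
Proof. exact: sigma_algebraC. Qed.

Let rV_bigcup (F : (set 'rV[R]_d)^nat) :
  (forall i, g_sigma_preimage rV_coord (F i)) ->
  g_sigma_preimage rV_coord (\bigcup_i F i).
Proof. exact: sigma_algebra_bigcup. Qed.

HB.instance Definition _ := @isMeasurable.Build default_measure_display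
  'rV[R]_d (g_sigma_preimage rV_coord) rV_set0 rV_setC rV_bigcup.

Lemma measurable_rV_coord (i : 'I_d) :
  measurable_fun [set: 'rV[R]_d] (rV_coord i).
Proof.
move=> _ Y mY; rewrite setTI; apply: sub_sigma_algebra => /=.
rewrite -bigcup_seq/=; exists i => /=; first by rewrite mem_index_enum.
by exists Y => //; rewrite setTI.
Qed.

Lemma measurable_fun_rVP d1 (T : measurableType d1) (f : T -> 'rV[R]_d) :
  (forall i, measurable_fun [set: T] (rV_coord i \o f)) ->
  measurable_fun [set: T] f.
Proof.
move=> mf; have H : g_sigma_preimage (fun i => rV_coord i \o f) `<=` measurable.
  apply: smallest_sub; first exact: sigma_algebra_measurable.
  move=> A; rewrite -bigcup_seq/= => -[i _ [B mB <-]].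
  exact: mf.
move=> _ A mA; rewrite g_sigma_preimage_comp in H.
by apply: H; exists A.
Qed.

End rV_measurable.

Definition rV_cons (R : realType) (d : nat) (p : R * 'rV[R]_d) : 'rV[R]_d.+1 :=
  row_mx p.1%:M p.2.

Lemma rV_cons_ord0 (R : realType) (d : nat) (p : R * 'rV[R]_d) :
  rV_cons p ord0 ord0 = p.1.
Proof.
rewrite (_ : (ord0 : 'I_d.+1) = @lshift 1 d ord0); last exact/val_inj.
by apply: etrans (row_mxEl _ _ _ _) _; rewrite mxE.
Qed.

Lemma rV_cons_lift (R : realType) (d : nat) (p : R * 'rV[R]_d) (j : 'I_d) :
  rV_cons p ord0 (lift ord0 j) = p.2 ord0 j.
Proof.
rewrite (_ : lift ord0 j = @rshift 1 d j); last exact/val_inj.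
exact: row_mxEr.
Qed.

Section lebesgue_rV_step.
Context (R : realType) (d : nat).
Variable mu : {sigma_finite_measure set 'rV[R]_d -> \bar R}.

Lemma measurable_rV_cons :
  measurable_fun [set: (measurableTypeR R * 'rV[R]_d)%type] (@rV_cons R d).
Proof.
apply: measurable_fun_rVP => i; have [j ->|->] := unliftP ord0 i.
  rewrite (_ : _ \o _ = @rV_coord R d j \o snd).
    exact: measurableT_comp (@measurable_rV_coord R d j) measurable_snd.
  by apply/funext => p; exact: rV_cons_lift.
rewrite (_ : _ \o _ = fst)//; apply/funext => p; exact: rV_cons_ord0.
Qed.

Definition lebesgue_rVS : set 'rV[R]_d.+1 -> \bar R :=
  pushforward (@lebesgue_measure R \x mu)%E (@rV_cons R d).

Let lebesgue_rVS0 : lebesgue_rVS set0 = 0%E.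
Proof. by rewrite /lebesgue_rVS /pushforward preimage_set0 measure0. Qed.

Let lebesgue_rVS_ge0 A : (0 <= lebesgue_rVS A)%E.
Proof. exact: (@measure_ge0 _ _ _ (@lebesgue_measure R \x mu)%E). Qed.

Let lebesgue_rVS_sigma_additive : semi_sigma_additive lebesgue_rVS.
Proof.
move=> F mF tF mUF; rewrite /lebesgue_rVS /pushforward preimage_bigcup.
apply: (@measure_semi_sigma_additive _ _ _ (@lebesgue_measure R \x mu)%E).
- by move=> n; rewrite -[X in measurable X]setTI; exact: measurable_rV_cons.
- apply/trivIsetP => /= i j _ _ ij; rewrite -preimage_setI.
  by move/trivIsetP : tF => /(_ _ _ _ _ ij) ->//; rewrite preimage_set0.
- rewrite -preimage_bigcup -[X in measurable X]setTI.
  exact: measurable_rV_cons.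
Qed.

HB.instance Definition _ := isMeasure.Build _ _ _ lebesgue_rVS
  lebesgue_rVS0 lebesgue_rVS_ge0 lebesgue_rVS_sigma_additive.

Let rV_uncons (x : 'rV[R]_d.+1) : R * 'rV[R]_d :=
  (x ord0 ord0, \row_j x ord0 (lift ord0 j)).

Let measurable_rV_uncons :
  measurable_fun [set: 'rV[R]_d.+1]
    (rV_uncons : _ -> (measurableTypeR R * 'rV[R]_d)%type).
Proof.
apply/measurable_fun_pairP; split; first exact: (@measurable_rV_coord R d.+1 ord0).
apply: measurable_fun_rVP => j.
rewrite (_ : _ \o _ = @rV_coord R d.+1 (lift ord0 j)).
  exact: measurable_rV_coord.
by apply/funext => x; rewrite /rV_coord /= mxE.
Qed.

Let lebesgue_rVS_sigma_finite : sigma_finite setT lebesgue_rVS.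
Proof.
have /sigma_finiteP[F [TF ndF Foo]] := sigma_finiteT (@lebesgue_measure R).
have /sigma_finiteP[G [TG ndG Goo]] := sigma_finiteT mu.
exists (fun n => rV_uncons @^-1` (F n `*` G n)).
  rewrite -preimage_bigcup (_ : \bigcup_i _ = setT) ?preimage_setT//.
  apply/seteqP; split => // -[x y] _.
  have [n _ Fnx] : (\bigcup_i F i) x by rewrite -TF.
  have [k _ Gky] : (\bigcup_i G i) y by rewrite -TG.
  exists (maxn n k) => //; split => /=.
  - by move: x Fnx; exact/subsetPset/ndF/leq_maxl.
  - by move: y Gky; exact/subsetPset/ndG/leq_maxr.
move=> n; have [mF Fnoo] := Foo n; have [mG Gnoo] := Goo n; split.
  rewrite -[X in measurable X]setTI; apply: measurable_rV_uncons => //.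
  exact: measurableX.
rewrite /lebesgue_rVS /pushforward -comp_preimage.
rewrite (_ : rV_uncons \o _ = id) ?preimage_id.
  by rewrite product_measure1E// lte_mul_pinfty// ge0_fin_numE.
apply/funext => -[x y]; congr pair; first exact: rV_cons_ord0.
by apply/rowP => j; rewrite mxE; exact: rV_cons_lift.
Qed.

HB.instance Definition _ := Measure_isSigmaFinite.Build _ _ _ lebesgue_rVS
  lebesgue_rVS_sigma_finite.

End lebesgue_rV_step.

(* d-dimensional Lebesgue measure on Borel sets, as the iterated product
   lebesgue_measure \x ... \x lebesgue_measure; see lebesgue_rV_box. *)
Fixpoint lebesgue_rV (R : realType) (d : nat) :
    {sigma_finite_measure set 'rV[R]_d -> \bar R} :=
  match d with
  | 0 => [the {sigma_finite_measure set 'rV[R]_0 -> \bar R} of \d_(0 : 'rV[R]_0)]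
  | d.+1 => [the {sigma_finite_measure set 'rV[R]_d.+1 -> \bar R} of
              lebesgue_rVS (lebesgue_rV R d)]
  end.

Lemma lebesgue_rV_box (R : realType) (d : nat) (A : 'I_d -> set R) :
  (forall i, measurable (A i)) ->
  lebesgue_rV R d [set x | forall i, A i (x ord0 i)] =
  (\prod_(i < d) @lebesgue_measure R (A i))%E.
Proof.
elim: d A => [A _|d IH A mA].
  rewrite big_ord0 /= diracE (_ : _ \in _ = true)//.
  by apply/mem_set => -[].
rewrite big_ord_recl -IH//=.
rewrite /lebesgue_rVS /pushforward.
set B : set 'rV[R]_d := [set x | forall i, A (lift ord0 i) (x ord0 i)].
rewrite (_ : _ @^-1` _ = A ord0 `*` B).
  rewrite product_measure1E//; first exact: mA.
  have -> : B = \bigcap_(i in [set: 'I_d]) (@rV_coord R d i @^-1` A (lift ord0 i)).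
    by apply/seteqP; split=> x /= xB i; [move=> _|]; exact: xB.
  apply: fin_bigcap_measurable => // i _.
  by rewrite -[X in measurable X]setTI; exact: measurable_rV_coord.
apply/seteqP; split => -[x y] /=.
- move=> xy; split; first by have := xy ord0; rewrite rV_cons_ord0.
  by move=> i; have := xy (lift ord0 i); rewrite rV_cons_lift.
- move=> [xA yB] i; have [j ->|->] := unliftP ord0 i.
    by rewrite rV_cons_lift; exact: yB.
  by rewrite rV_cons_ord0.
Qed.

Section sobolev.
Context (R : realType) (d : nat).
Implicit Types (Omega : set 'rV[R]_d) (u v g phi : 'rV[R]_d -> R).

Local Notation mu := (lebesgue_rV R d).

Definition partial (i : 'I_d) (f : 'rV[R]_d -> R) : 'rV[R]_d -> R :=
  fun x => 'D_(delta_mx ord0 i) f x.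

(* Multi-indices are encoded as lists of directions: the list [:: i1; ...; ik]
   stands for d_i1 ... d_ik, of order k. *)
Definition partials (s : seq 'I_d) (f : 'rV[R]_d -> R) : 'rV[R]_d -> R :=
  foldr partial f s.

Definition smooth (f : 'rV[R]_d -> R) : Prop :=
  forall s : seq 'I_d, continuous (partials s f) /\
    forall (i : 'I_d) (x : 'rV[R]_d),
      derivable (partials s f) x (delta_mx ord0 i).

(* C_c^oo(Omega) *)
Definition test_function Omega phi : Prop :=
  [/\ smooth phi, compact (closure [set x | phi x != 0])
    & closure [set x | phi x != 0] `<=` Omega].

Definition L2 Omega u : Prop :=
  measurable_fun Omega u /\
  (\int[mu]_(x in Omega) ((u x) ^+ 2)%:E < +oo)%E.

Definition is_weak_partials Omega (s : seq 'I_d) u g : Prop :=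
  forall phi, test_function Omega phi ->
    \int[mu]_(x in Omega) (u x * partials s phi x) =
    (-1) ^+ size s * \int[mu]_(x in Omega) (g x * phi x).

(* A representative of the weak derivative in L^2(Omega), unique up to a null
   set; the zero function when there is none. *)
Definition weak_partials Omega (s : seq 'I_d) u : 'rV[R]_d -> R :=
  xget (fun=> 0) [set g | L2 Omega g /\ is_weak_partials Omega s u g].

Definition Hm Omega (m : nat) u : Prop :=
  L2 Omega u /\
  forall s : seq 'I_d, (size s <= m)%N ->
    exists g, L2 Omega g /\ is_weak_partials Omega s u g.

(* Summing over lists of directions counts a mixed derivative once per ordering,
   which gives a norm equivalent to the one indexed by multi-indices. *)
Definition Hm_norm Omega (m : nat) u : R :=
  Num.sqrt (\sum_(k < m.+1) \sum_(s : k.-tuple 'I_d)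
    \int[mu]_(x in Omega) (weak_partials Omega s u x) ^+ 2).

(* H^m_0(Omega): the closure of C_c^oo(Omega) in H^m(Omega). *)
Definition Hm0 Omega (m : nat) u : Prop :=
  Hm Omega m u /\
  forall eps : R, 0 < eps ->
    exists phi, test_function Omega phi /\
      Hm_norm Omega m (fun x => u x - phi x) < eps.

Definition weak_laplacian Omega u : 'rV[R]_d -> R :=
  fun x => \sum_(i < d) weak_partials Omega [:: i; i] u x.

(* The integral over Omega of nabla^m u . nabla^m v, where nabla^m is Delta^j for
   m = 2j and grad Delta^j for m = 2j+1. *)
Definition polyharmonic_form Omega (m : nat) u v : R :=
  let Du := iter m./2 (weak_laplacian Omega) u in
  let Dv := iter m./2 (weak_laplacian Omega) v in
  if odd m then
    \int[mu]_(x in Omega) \sum_(i < d)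
      (weak_partials Omega [:: i] Du x * weak_partials Omega [:: i] Dv x)
  else \int[mu]_(x in Omega) (Du x * Dv x).

(* Weak form in H^m_0(Omega) of (-Delta)^m u = lam u with Dirichlet conditions
   u = d_nu u = ... = d_nu^(m-1) u = 0 on the boundary. *)
Definition is_eigenvalue Omega (m : nat) (lam : R) : Prop :=
  exists u, [/\ Hm0 Omega m u,
    ~ {ae mu, forall x, Omega x -> u x = 0} &
    forall v, Hm0 Omega m v ->
      polyharmonic_form Omega m u v =
      lam * \int[mu]_(x in Omega) (u x * v x)].

Definition is_first_eigenvalue Omega (m : nat) (lam : R) : Prop :=
  is_eigenvalue Omega m lam /\
  forall lam', is_eigenvalue Omega m lam' -> lam <= lam'.

(* The default value 0 is taken only when there is no smallest eigenvalue; a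
   positive lower bound on first_eigenvalue therefore entails that one exists. *)
Definition first_eigenvalue Omega (m : nat) : R :=
  xget 0 [set lam | is_first_eigenvalue Omega m lam].

(* The Euclidean ball; the library norm on 'rV is the max norm. *)
Definition unit_ball : set 'rV[R]_d :=
  [set x | \sum_(i < d) (x ord0 i) ^+ 2 < 1].

End sobolev.

Definition Gamma (R : realType) (x : R) : R :=
  \int[@lebesgue_measure R]_(t in `]0, +oo[) (t `^ (x - 1) * expR (- t)).

Arguments unit_ball R d : clear implicits.

(* Main.v *)
(** Write rho = 1 - |x|^2. On polynomials, K p = (-Delta)^m (rho^m p) does not raise
    the degree, K 1 is the constant lower(m), and K is symmetric for the inner product
    <p, q> = int_B rho^m p q. If K p = mu p and t is the part of p of top degree N, then
    Delta^m (|x|^{2m} t) = mu t; pairing with t in the Fischer inner product bounds mu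
    below by lower(m), and by a quantity tending to infinity with N. Hence
    int w (-Delta)^m w >= lower(m) int rho^m p^2 >= lower(m) int w^2 for w = rho^m p.
    These w lie in H^m_0(B) and suffice to determine the first eigenvalue: an optimising
    sequence of polynomials converges in H^m_0(B) to an eigenfunction, and every other
    eigenvalue is at least as large because polynomials are dense in L^2(B).
    The upper bound is the Rayleigh quotient of rho^m, whose two integrals are
    computed by recursion. The asymptotics follow from Stirling's formula at integers
    and half-integers, the constant coming from Gamma(1/2)^2 = pi. *)

From HB Require Import structures.
Require Import Defs.
From mathcomp Require Import all_boot all_order all_algebra.
From mathcomp Require Import all_classical all_reals all_analysis.
From mathcomp Require Import measurable_realfun ring lra zify.
From mathcomp Require mpoly.
Import -(notations) mpoly.

Set Implicit Arguments.
Unset Strict Implicit.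
Unset Printing Implicit Defensive.

Import Order.TTheory GRing.Theory Num.Theory.
Import numFieldNormedType.Exports.

Local Open Scope classical_set_scope.
Local Open Scope ring_scope.

(** * Polynomials and the polyharmonic operator *)

(** The eigenvalue is approached through the inverse operator. Since [kop] is onto, every polynomial
    f has a polynomial p with (-Delta)^m w = f for w = rho^m p, and [gsup] is the norm of f -> w in
    L^2(B). Maximising <w, f> with f normalised, instead of minimising a Rayleigh quotient with w
    normalised, is what makes the limit accessible: w - gsup f tends to 0 in L^2, the bound on f
    turns L^2-convergence of w into convergence in energy, and the weak equation for w simply reads
    form(w, v) = <f, v>. Vanishing on the sphere is expressed by divisibility by powers of rho, and
    integration by parts comes from the one-dimensional fundamental theorem of calculus on chords. A
    weak derivative is known only up to null sets and through a chosen representative, so weak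
    objects are handled by their defining relation and compared almost everywhere. All Gamma values
    that occur have half-integer arguments, so the recursion in steps of 1 from Gamma(1/2) and
    Gamma(1) determines them. *)

Section polynomial_algebra.
Context (R : realType) (d : nat).
Local Notation MP := (mpoly d R).
Local Notation mnm := (multinom d).
Implicit Types (p q t f : MP) (k : mnm).

Definition var (i : 'I_d) : MP := mpolyX R (mnm1 i).
Definition lap p : MP := \sum_i mderiv i (mderiv i p).
Definition nsq : MP := \sum_i var i ^+ 2.
Definition rho : MP := 1 - nsq.
Definition euler p : MP := \sum_i var i * mderiv i p.

Lemma mderiv_var i j : mderiv i (var j) = (i == j)%:R.
Proof.
rewrite /var mderivX mnm1E eq_sym; case: eqP => [->|_]; last by rewrite scale0r.
by rewrite scale1r  -[X in mnm_sub X _]add0m addmK mpolyX0.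
Qed.

Lemma mderiv_nsq i : mderiv i nsq = 2 *: var i.
Proof.
rewrite /nsq raddf_sum /= (bigD1 i)//= big1 ?addr0 => [|j ji].
  by rewrite expr2 mderivM mderiv_var eqxx mul1r mulr1 -[2]/(1 + 1) scalerDl scale1r.
by rewrite expr2 mderivM mderiv_var eq_sym (negPf ji) mul0r mulr0 addr0.
Qed.

Lemma mderiv_rho i : mderiv i rho = - (2 *: var i).
Proof. by rewrite /rho raddfB /= mderiv_nsq -mpolyC1 mderivC sub0r. Qed.

Lemma lap_is_linear : linear lap.
Proof.
move=> c p q; rewrite /lap scaler_sumr -big_split; apply: eq_bigr => i _ /=.
by rewrite !linearP.
Qed.

HB.instance Definition _ := GRing.isLinear.Build R MP MP _ lap lap_is_linear.

Lemma lap_nsqM p : lap (nsq * p) = nsq * lap p + 4 *: euler p + (2 * d%:R) *: p.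
Proof.
rewrite /lap (eq_bigr (fun i => nsq * mderiv i (mderiv i p) +
   4 *: (var i * mderiv i p) + 2 *: p)).
  rewrite !big_split /= mulr_sumr scaler_sumr; congr (_ + _).
  by rewrite sumr_const card_ord -scaler_nat scalerA mulrC.
move=> i _; rewrite mderivM mderiv_nsq raddfD /= !mderivM mderiv_nsq.
rewrite linearZ /= mderiv_var eqxx -!mul_mpolyC.
by rewrite mulr1n !(rmorph_nat (@mpolyC d R)); ring.
Qed.

(** One predicate covers homogeneity ([pred1 N]) and degree bounds, so a single set of closure
    lemmas serves both. The zero polynomial satisfies every instance, in particular it is
    homogeneous of every degree and of degree below 0. *)
Definition degs (P : pred nat) p := forall k, k \in msupp p -> P (mdeg k).

Lemma degsP (P : pred nat) p :
  degs P p <-> forall k, ~~ P (mdeg k) -> mcoeff k p = 0.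
Proof.
split=> H k; first by move=> Pk; apply/eqP; rewrite mcoeff_eq0; apply: contra Pk => /H.
by rewrite mcoeff_msupp; apply: contraNT => /H ->.
Qed.

Lemma degs0 P : degs P 0.
Proof. by move=> k; rewrite msupp0. Qed.

Lemma degsZ P c p : degs P p -> degs P (c *: p).
Proof. by move=> /degsP H; apply/degsP => k /H Pk; rewrite mcoeffZ Pk mulr0. Qed.

Lemma degsD P p q : degs P p -> degs P q -> degs P (p + q).
Proof.
by move=> /degsP H /degsP I; apply/degsP => k Pk; rewrite mcoeffD H// I// addr0.
Qed.

Lemma degsN P p : degs P p -> degs P (- p).
Proof. by rewrite -scaleN1r; exact: degsZ. Qed.

Lemma degs_sum P (I : finType) (F : I -> MP) :
  (forall i, degs P (F i)) -> degs P (\sum_i F i).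
Proof.
by move=> H; elim/big_ind : _ => // [|p q]; [exact: degs0|exact: degsD].
Qed.

Lemma degsS (P Q : pred nat) p : (forall a, P a -> Q a) -> degs P p -> degs Q p.
Proof. by move=> PQ H k /H /PQ. Qed.

Lemma degsM (P Q S : pred nat) p q : (forall a b, P a -> Q b -> S (a + b)%N) ->
  degs P p -> degs Q q -> degs S (p * q).
Proof.
move=> PQS Pp Qq k /msuppM_le/allpairsP[[k1 k2] /= [/Pp P1 /Qq Q2 ->]].
by rewrite mdegD; exact: PQS.
Qed.

Lemma degs_deriv (P Q : pred nat) i p : (forall a, P a.+1 -> Q a) ->
  degs P p -> degs Q (mderiv i p).
Proof.
move=> PQ /degsP H; apply/degsP => k Qk; rewrite mcoeff_mderiv H ?mul0rn//.
by apply: contra Qk; rewrite mdegD mdeg1 addn1; exact: PQ.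
Qed.

Lemma degs_lap (P Q : pred nat) p : (forall a, P a.+2 -> Q a) ->
  degs P p -> degs Q (lap p).
Proof.
move=> PQ H; apply: degs_sum => i.
by apply: (@degs_deriv (fun a => P a.+1)) => //; exact: (@degs_deriv P).
Qed.

Lemma degs_var i : degs (pred1 1%N) (var i).
Proof. by move=> k; rewrite msuppX inE => /eqP ->; rewrite mdeg1. Qed.

Lemma degs1 : degs (pred1 0%N) (1 : MP).
Proof. by move=> k; rewrite msupp1 inE => /eqP ->; rewrite mdeg0. Qed.

Lemma degs_nsq : degs (pred1 2%N) nsq.
Proof.
apply: degs_sum => i; rewrite expr2.
apply: degsM (@degs_var i) (@degs_var i) => a b /= /eqP -> /eqP ->//.
Qed.

Lemma degs_nsqX j : degs (pred1 (2 * j)%N) (nsq ^+ j).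
Proof.
elim: j => [|j IH]; first exact: degs1.
by rewrite exprS; apply: degsM degs_nsq IH => a b /= /eqP -> /eqP ->; rewrite mulnS.
Qed.

Lemma degs_homM n (P Q : pred nat) p q : (forall a, P a -> Q (n + a)%N) ->
  degs (pred1 n) p -> degs P q -> degs Q (p * q).
Proof. by move=> PQ; apply: degsM => a b /= /eqP -> /PQ. Qed.

(** Compared coefficient by coefficient: x_i d_i multiplies the coefficient of x^k by k_i, and the
    k_i add up to N on the support of t. *)
Lemma euler_hom (N : nat) t : degs (pred1 N) t -> euler t = N%:R *: t.
Proof.
move=> ht; apply/mpolyP => k; rewrite mcoeffZ /euler raddf_sum /=.
have E i : mcoeff k (var i * mderiv i t) = (k i)%:R * mcoeff k t.
  (* Subtraction of multi-indices is truncated, so k_i = 0 is treated apart: no monomial of a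
     multiple of x_i has exponent 0 in x_i. *)
  case: (posnP (k i)) => ki.
    rewrite ki mul0r mulrC; apply/eqP; rewrite mcoeff_eq0.
    apply/negP => /msuppM_le/allpairsP[[k1 k2] /= [_]].
    rewrite msuppX inE => /eqP -> kE.
    by move: ki; rewrite kE mnmDE mnm1E eqxx addn1.
  have {1}-> : k = mnm_add (mnm1 i) (mnm_sub k (mnm1 i)).
    apply/mnmP => j; rewrite mnmDE mnmBE mnm1E.
    by case: eqP => [<-|]//=; rewrite ?subn0// add1n subn1 prednK.
  rewrite mulrC mcoeffMX mcoeff_mderiv mnmBE mnm1E eqxx subn1 prednK//.
  rewrite -[LHS]mulr_natl; congr *%R; congr (fun k => mcoeff k t); apply/mnmP => j.
  rewrite mnmDE mnmBE mnm1E.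
  by case: eqP => [<-|]//=; rewrite ?subn0 ?addn0// addn1 subn1 prednK.
under eq_bigr do rewrite E.
rewrite -mulr_suml -natr_sum -mdegE.
have [/ht/eqP ->//|] := boolP (k \in msupp t).
by rewrite -mcoeff_eq0 => /eqP ->; rewrite !mulr0.
Qed.

(** For t harmonic and homogeneous of degree N, Delta sends |x|^(2j+2) t to [gam N j] times |x|^(2j)
    t. For N = 0 the product over j < m is Delta^m |x|^(2m), the lower bound of the theorem. *)
Definition gam (N j : nat) : R := 2 * j.+1%:R * (2 * N%:R + 2 * j%:R + d%:R).

Lemma lap_nsqX (j N : nat) t : degs (pred1 N) t ->
  lap (nsq ^+ j.+1 * t) = nsq ^+ j.+1 * lap t + gam N j *: (nsq ^+ j * t).
Proof.
move=> ht; elim: j => [|j IH].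
  rewrite expr1 expr0 mul1r lap_nsqM (euler_hom ht) scalerA -addrA -scalerDl.
  by congr (_ + _ *: _); rewrite /gam; ring.
rewrite [in LHS]exprS -mulrA lap_nsqM IH.
have hj : degs (pred1 (N + 2 * j.+1)%N) (nsq ^+ j.+1 * t).
  by apply: (degsM _ (@degs_nsqX _) ht) => a b /= /eqP -> /eqP ->; rewrite addnC.
rewrite (euler_hom hj) scalerA mulrDr mulrA -exprS -scalerAr mulrA -exprS -!addrA.
congr (_ + _); rewrite -!scalerDl; congr (_ *: _).
(* The Euler term and the constant term of [lap_nsqM] contribute 4 (N + 2j + 2) + 2d, which is the
   increment of [gam N] from j to j + 1. *)
by rewrite /gam natrD natrM -!natr1; ring.
Qed.

Definition mfac k : nat := (\prod_i (k i)`!)%N.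

Lemma mfacU k i : mfac (mnm_add k (mnm1 i)) = ((k i).+1 * mfac k)%N.
Proof.
rewrite /mfac (bigD1 i)//= [in RHS](bigD1 i)//= mnmDE mnm1E eqxx addn1 factS -mulnA.
congr (_ * (_ * _))%N; apply: eq_bigr => j ji.
by rewrite mnmDE mnm1E eq_sym (negPf ji) addn0.
Qed.

(* The Fischer inner product, for which multiplication by [var i] is adjoint to
   [mderiv i]; the sum is cut off at degree [b] to keep it finite. *)
Definition fis b p q : R :=
  \sum_(k : bmultinom d b) (mfac k)%:R * mcoeff k p * mcoeff k q.

Lemma fisC b p q : fis b p q = fis b q p.
Proof. by apply: eq_bigr => k _; rewrite mulrAC. Qed.

Lemma fisDr b p q q' : fis b p (q + q') = fis b p q + fis b p q'.
Proof. by rewrite -big_split; apply: eq_bigr => k _; rewrite mcoeffD mulrDr. Qed.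

Lemma fisZr b p c q : fis b p (c *: q) = c * fis b p q.
Proof. by rewrite mulr_sumr; apply: eq_bigr => k _; rewrite mcoeffZ; ring. Qed.

Lemma fis_sumr b p (I : Type) (r : seq I) (F : I -> MP) :
  fis b p (\sum_(i <- r) F i) = \sum_(i <- r) fis b p (F i).
Proof.
elim: r => [|i r IH]; last by rewrite !big_cons fisDr IH.
by rewrite !big_nil; apply: big1 => k _; rewrite mcoeff0 mulr0.
Qed.

Lemma fis_ge0 b p : 0 <= fis b p p.
Proof.
by apply: sumr_ge0 => k _; rewrite -mulrA mulr_ge0// -expr2 sqr_ge0.
Qed.

Lemma fis_gt0 b p : degs (fun a => a < b)%N p -> p != 0 -> 0 < fis b p p.
Proof.
move=> hp; rewrite -msupp_eq0.
case E : (msupp p) => [//|k r] _.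
have kp : k \in msupp p by rewrite E mem_head.
rewrite /fis (bigD1 (BMultinom (hp k kp)))//=.
apply: ltr_wpDr.
  by apply: sumr_ge0 => k' _; rewrite -mulrA mulr_ge0// -expr2 sqr_ge0.
rewrite -mulrA mulr_gt0 ?ltr0n//; last first.
  by rewrite -expr2 exprn_even_gt0//= -mcoeff_msupp.
by apply: prodn_gt0 => i; exact: fact_gt0.
Qed.

Lemma fis_mono b k q : (mdeg k < b)%N ->
  fis b (mpolyX R k) q = (mfac k)%:R * mcoeff k q.
Proof.
move=> kb; rewrite /fis (bigD1 (BMultinom kb))//= big1 ?addr0.
  by rewrite mcoeffX eqxx mulr1.
by move=> k' kk'; rewrite mcoeffX eq_sym [_ == _ :> mnm](_ : _ = false) ?mulr0 ?mul0r//; exact: negPf.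
Qed.

(** The factorial weights make this work: passing from k to k + e_i multiplies the weight by k_i +
    1, the factor that d_i brings out. The degree bound keeps [var i * p] below the cut-off. *)
Lemma fis_var b i p q : degs (fun a => a.+1 < b)%N p ->
  fis b (var i * p) q = fis b p (mderiv i q).
Proof.
move=> hp; rewrite {1 2}[p]mpolyE mulr_sumr fisC fis_sumr [RHS]fisC fis_sumr.
rewrite !big_seq; apply: eq_bigr => k /hp kb.
rewrite -scalerAr !fisZr; congr (_ * _).
rewrite fisC [RHS]fisC -mpolyXD addmC !fis_mono ?(ltnW kb)//.
  by rewrite mcoeff_mderiv mfacU natrM -mulr_natl; ring.
by rewrite mdegD mdeg1 addn1.
Qed.

Lemma fis_nsq b p q : degs (fun a => a.+2 < b)%N p ->
  fis b (nsq * p) q = fis b p (lap q).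
Proof.
move=> hp; rewrite /nsq mulr_suml fisC fis_sumr /lap fis_sumr.
apply: eq_bigr => i _; rewrite fisC expr2 -mulrA fis_var.
  by rewrite fis_var//; apply: degsS hp => a /ltnW.
by apply: (@degs_homM 1 (fun a => a.+2 < b)%N) (@degs_var i) hp => a; rewrite add1n.
Qed.

Lemma fis_nsqX b j p q : degs (fun a => a + 2 * j < b)%N p ->
  fis b (nsq ^+ j * p) q = fis b p (iter j lap q).
Proof.
elim: j q => [|j IH] q hp; first by rewrite expr0 mul1r.
rewrite exprS -mulrA fis_nsq; last first.
  apply: (@degs_homM (2 * j) (fun a => a + 2 * j.+1 < b)%N) (@degs_nsqX j) hp => a.
  by move=> H; lia.
rewrite IH -?iterSr//; apply: degsS hp => a; apply: leq_ltn_trans.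
by rewrite leq_add2l leq_mul2l leqnSn orbT.
Qed.

Lemma gam_ge0 N j : 0 <= gam N j.
Proof. by rewrite /gam mulr_ge0 ?addr_ge0 ?mulr_ge0. Qed.

(** By adjointness the right side is the squared Fischer norm of |x|^(2m) t. Removing one factor
    |x|^2 at a time yields a factor [gam N j] plus a cross term containing Delta t, so everything
    rests on the sign of the cross terms. *)
Lemma fischer_bound (N m : nat) t b : degs (pred1 N) t -> (N + 2 * m + 3 < b)%N ->
  (\prod_(j < m) gam N j) * fis b t t <= fis b t (iter m lap (nsq ^+ m * t)).
Proof.
move=> ht hb.
have htle (j : nat) q : degs (fun a => a <= N)%N q ->
    degs (fun a => a <= N + 2 * j)%N (nsq ^+ j * q).
  by move=> hq; apply: (degs_homM _ (@degs_nsqX j) hq) => a aN; rewrite addnC leq_add2r.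
have ht' : degs (fun a => a <= N)%N t by apply: degsS ht => a /= /eqP ->.
have hlt : degs (fun a => a <= N)%N (lap t).
  by apply: degs_lap ht' => a H; apply: leq_trans H; rewrite -addn2 leq_addr.
(* Moving one |x|^2 across, the cross term at level j + 1 is a squared norm plus [gam N j] times the
   cross term at level j; at level 0 it is the squared norm of Delta t. *)
have C_ge0 j : (j <= m)%N -> 0 <= fis b (nsq ^+ j * t) (nsq ^+ j.+1 * lap t).
  elim: j => [|j IH] jm.
    rewrite expr0 mul1r expr1 fisC fis_nsq ?fis_ge0//.
    by apply: degsS hlt => a aN; lia.
  rewrite [X in fis _ _ X](_ : _ = nsq * (nsq ^+ j.+1 * lap t)); last by rewrite mulrA -exprS.
  rewrite fisC fis_nsq; last by apply: degsS (htle j.+1 _ hlt) => a aN; lia.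
  rewrite (lap_nsqX _ ht) fisDr fisZr addr_ge0 ?fis_ge0// mulr_ge0 ?gam_ge0//.
  by rewrite fisC IH// ltnW.
have A j : (j <= m)%N -> (\prod_(i < j) gam N i) * fis b t t <=
    fis b (nsq ^+ j * t) (nsq ^+ j * t).
  elim: j => [|j IH] jm; first by rewrite big_ord0 expr0 !mul1r.
  rewrite big_ord_recr /= [leLHS]mulrAC mulrC.
  have -> : nsq ^+ j.+1 * t = nsq * (nsq ^+ j * t) by rewrite mulrA -exprS.
  rewrite fis_nsq; last by apply: degsS (htle j _ ht') => a aN; lia.
  rewrite mulrA -exprS (lap_nsqX _ ht) fisDr fisZr ler_wpDl//; first exact: C_ge0 (ltnW jm).
  by rewrite ler_wpM2l ?gam_ge0// IH// ltnW.
rewrite -fis_nsqX; first exact: A.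
by apply: degsS ht' => a aN; lia.
Qed.

End polynomial_algebra.

Section polyharmonic_polynomials.
Context (R : realType) (d : nat).
Local Notation MP := (mpoly d R).
Implicit Types (p q t f : MP).

Lemma iter_lap_is_linear m : linear (iter m (@lap R d)).
Proof. by move=> c p q; elim: m => //= m ->; rewrite linearP. Qed.

HB.instance Definition _ m :=
  GRing.isLinear.Build R MP MP _ (iter m (@lap R d)) (iter_lap_is_linear m).

Lemma degs_iter_lap m (P Q : pred nat) p : (forall a, P (a + 2 * m)%N -> Q a) ->
  degs P p -> degs Q (iter m (@lap R d) p).
Proof.
elim: m P Q p => [|m IH] P Q p PQ Pp.
  by apply: degsS Pp => a; have := PQ a; rewrite addn0.
rewrite iterSr; apply: (IH (fun a => P a.+2)) => [a H|].
  by apply: PQ; rewrite mulnS addnCA addnC addn2.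
exact: degs_lap Pp.
Qed.

Definition kop m p : MP := (-1) ^+ m *: iter m (@lap R d) (rho R d ^+ m * p).

Lemma kop_is_linear m : linear (kop m).
Proof.
move=> c p q; rewrite /kop mulrDr -scalerAr linearP /= scalerDr !scalerA.
by rewrite mulrC.
Qed.

HB.instance Definition _ m := GRing.isLinear.Build R MP MP _ (kop m) (kop_is_linear m).

Lemma degs_rho : degs (fun a => a <= 2)%N (rho R d).
Proof.
apply: degsD; first by apply: degsS (@degs1 R d) => a /eqP ->.
by apply: degsN; apply: degsS (@degs_nsq R d) => a /eqP ->.
Qed.

Lemma degs_rhoX m : degs (fun a => a <= 2 * m)%N (rho R d ^+ m).
Proof.
elim: m => [|m IH]; first by apply: degsS (@degs1 R d) => a /eqP ->.
by rewrite exprS; apply: (degsM _ (@degs_rho) IH) => a b /= ? ?; lia.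
Qed.

Lemma degs_kop m b p : degs (fun a => a < b)%N p -> degs (fun a => a < b)%N (kop m p).
Proof.
move=> pb; apply: degsZ.
apply: (@degs_iter_lap m (fun a => a < b + 2 * m)%N) => [a|]; first by rewrite ltn_add2r.
by apply: (degsM _ (@degs_rhoX m) pb) => a c /= ? ?; lia.
Qed.

Lemma degs_rho_top m (N : nat) p t : degs (pred1 N) t -> degs (fun a => a < N)%N (p - t) ->
  degs (fun a => a < N + 2 * m)%N (rho R d ^+ m * p - (-1) ^+ m *: (nsq R d ^+ m * t)).
Proof.
move=> ht; elim: m => [|m IH] hp.
  by rewrite !expr0 !mul1r scale1r muln0 addn0.
set u := (-1) ^+ m *: _ in IH.
have hu : degs (pred1 (N + 2 * m)%N) u.
  by apply: degsZ; apply: (degsM _ (@degs_nsqX R d m) ht) => a b /= /eqP -> /eqP ->; rewrite addnC.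
rewrite (_ : _ - _ = rho R d * (rho R d ^+ m * p - u) + u).
  apply: degsD; last by apply: degsS hu => a /= /eqP ->; lia.
  by apply: (degsM _ (@degs_rho) (IH hp)) => a b /= ? ?; lia.
rewrite mulrBr mulrA -exprS {2}/rho mulrBl mul1r !opprB addrA subrK.
by congr (_ + _); rewrite /u -scalerAr mulrA -exprS exprS mulN1r scaleNr opprK.
Qed.

(** Modulo lower degrees [rho] acts as [- nsq]; the sign (-1)^m this produces cancels the one in
    [kop]. *)
Lemma degs_kop_top m (N : nat) p t : degs (pred1 N) t -> degs (fun a => a < N)%N (p - t) ->
  degs (fun a => a < N)%N (kop m p - iter m (@lap R d) (nsq R d ^+ m * t)).
Proof.
move=> ht /(@degs_rho_top m _ _ _ ht) H.
rewrite (_ : _ - _ = (-1) ^+ m *: iter m (@lap R d)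
    (rho R d ^+ m * p - (-1) ^+ m *: (nsq R d ^+ m * t))).
  apply: degsZ; apply: degs_iter_lap H => a; rewrite ltn_add2r//.
rewrite linearB linearZ /= scalerBr scalerA -exprMn_comm; last exact: commrN1.
by rewrite mulrNN mulr1 expr1n scale1r.
Qed.

Lemma degs_lap_top m (N : nat) t : degs (pred1 N) t ->
  degs (pred1 N) (iter m (@lap R d) (nsq R d ^+ m * t)).
Proof.
move=> ht; apply: (@degs_iter_lap m (pred1 (N + 2 * m)%N)) => [a|].
  by move=> /= /eqP/addIn ->.
by apply: (degsM _ (@degs_nsqX R d m) ht) => a b /= /eqP -> /eqP ->; rewrite addnC.
Qed.

Lemma degs_lt0 p : degs (fun a => a < 0)%N p -> p = 0.
Proof. by move=> /degsP H; apply/mpolyP => k; rewrite mcoeff0 H. Qed.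

(** For p = 1 the remainder of [degs_kop_top] has degree below 0, so [kop m 1] is exactly Delta^m
    |x|^(2m), and 1 is harmonic. *)
Lemma kop1 m : kop m 1 = (\prod_(j < m) gam R d 0 j) *: 1.
Proof.
have h1 := @degs1 R d.
have /degs_lt0/eqP : degs (fun a => a < 0)%N (kop m 1 - iter m (@lap R d) (nsq R d ^+ m * 1)).
  by apply: degs_kop_top => //; rewrite subrr; exact: degs0.
rewrite subr_eq0 => /eqP ->.
have l1 : lap (1 : MP) = 0.
  by rewrite /lap big1// => i _; rewrite -mpolyC1 !mderivC.
elim: m => [|m IH]; first by rewrite big_ord0 expr0 mulr1 scale1r.
rewrite iterSr (lap_nsqX m h1) l1 mulr0 add0r linearZ /= IH scalerA big_ord_recr /=.
by rewrite mulrC.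
Qed.

Lemma homog_top p : p != 0 -> exists N t, [/\ degs (pred1 N) t, t != 0,
  degs (fun a => a < N)%N (p - t) & degs (fun a => a <= N)%N p].
Proof.
move=> p0; pose N := mdeg (mlead p).
have NE : msize p = N.+1 by rewrite -mlead_deg.
pose t : MP := \sum_(k <- msupp p | mdeg k == N) mcoeff k p *: mpolyX R k.
have tE k : mcoeff k t = if mdeg k == N then mcoeff k p else 0.
  rewrite /t raddf_sum /=; under eq_bigr do rewrite mcoeffZ mcoeffX.
  have [kp|kp] := boolP (k \in msupp p); last first.
    rewrite big_seq_cond big1 => [|i /andP[ip _]].
      by move: kp; rewrite -mcoeff_eq0 => /eqP ->; rewrite if_same.
    by case: eqP ip kp => [->->//|_ _ _]; rewrite mulr0.
  rewrite big_mkcond (bigD1_seq k)//= ?msupp_uniq// eqxx mulr1 big1 ?addr0// => i ik.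
  by rewrite (negPf ik) mulr0 if_same.
exists N, t; split.
- by apply/degsP => k kN; rewrite tE; case: eqP kN => //= ->; rewrite eqxx.
- apply/eqP => t0; have := tE (mlead p); rewrite t0 mcoeff0 eqxx => /esym/eqP.
  by rewrite mcoeff_eq0 mlead_supp.
- apply/degsP => k; rewrite -leqNgt mcoeffB tE leq_eqVlt eq_sym.
  case: eqP => [_ _|_ /=]; rewrite ?subrr// subr0 => kN.
  by apply/eqP; rewrite mcoeff_eq0 msize_mdeg_ge// NE.
- by move=> k /msize_mdeg_lt; rewrite NE.
Qed.

Lemma kop_eigenvalue m mu p : p != 0 -> kop m p = mu *: p ->
  exists2 N, degs (fun a => a <= N)%N p & \prod_(j < m) gam R d N j <= mu.
Proof.
move=> /homog_top[N [t [ht t0 hpt hp]]] kE; exists N => //.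
pose q := iter m (@lap R d) (nsq R d ^+ m * t).
(* The difference is homogeneous of degree N and at the same time of degree below N. *)
have qE : q = mu *: t.
  apply/eqP; rewrite -subr_eq0; apply/eqP.
  have h1 : degs (pred1 N) (q - mu *: t).
    by apply: degsD; [exact: degs_lap_top|apply/degsN/degsZ].
  have h2 : degs (fun a => a < N)%N (q - mu *: t).
    rewrite (_ : q - _ = - (kop m p - q) + mu *: (p - t)).
      by apply: degsD; [apply/degsN/degs_kop_top|apply: degsZ].
    by rewrite kE opprB scalerBr addrA subrK.
  apply/mpolyP => k; rewrite mcoeff0; have [kN|kN] := boolP (mdeg k == N).
    by apply: (proj1 (degsP _ _) h2); rewrite (eqP kN) ltnn.
  by apply: (proj1 (degsP _ _) h1).
have tb : degs (fun a => a < N + 2 * m + 4)%N t by apply: degsS ht => a /= /eqP ->; lia.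
have := @fischer_bound R d N m t (N + 2 * m + 4) ht.
rewrite ltn_add2l => /(_ isT); rewrite -/q qE fisZr ler_pM2r//.
exact: fis_gt0.
Qed.

Lemma gam_mono (N N' j : nat) : (N <= N')%N -> gam R d N j <= gam R d N' j.
Proof.
move=> NN; rewrite /gam ler_wpM2l ?mulr_ge0// !lerD2r ler_wpM2l// ler_nat//.
Qed.

Lemma prod_gam_mono m (N N' : nat) : (N <= N')%N ->
  \prod_(j < m) gam R d N j <= \prod_(j < m) gam R d N' j.
Proof. by move=> NN; apply: ler_prod => j _; rewrite gam_ge0 gam_mono. Qed.

(** A crude rate, sufficient to make components of high degree small at bounded energy; it is the
    source of compactness. For m = 0 the product is empty and nothing grows. *)
Lemma prod_gam_ge m (N : nat) : (0 < m)%N -> N%:R <= \prod_(j < m) gam R d N j.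
Proof.
case: N => [_|N]; first by apply: prodr_ge0 => j _; exact: gam_ge0.
have g1 (j : nat) : N.+1%:R <= gam R d N.+1 j.
  rewrite /gam -[leLHS]mul1r ler_pM//.
    by rewrite -natrM ler1n.
  by rewrite -addrA ler_wpDr ?addr_ge0 ?mulr_ge0// ler_peMl// ler1n.
case: m => // m _; rewrite big_ord_recl.
apply: le_trans (g1 0%N) _; rewrite ler_peMr ?gam_ge0//.
elim/big_ind : _ => // [x y x1 y1|i _]; first by rewrite mulr_ege1.
by apply: le_trans (g1 _); rewrite ler1n.
Qed.

Lemma prod_gam_gt0 m (N : nat) : (0 < d)%N -> 0 < \prod_(j < m) gam R d N j.
Proof.
move=> d0; apply: prodr_gt0 => j _; rewrite /gam mulr_gt0 ?mulr_gt0 ?ltr0n//.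
by rewrite ltr_wpDl ?addr_ge0 ?mulr_ge0 ?ltr0n.
Qed.

End polyharmonic_polynomials.

(** * Bilinear forms on polynomials *)

Section bilinear_forms.
Context (R : realType) (d : nat).
Local Notation MP := (mpoly d R).
Implicit Types (p q : MP).

Variable beta : MP -> MP -> R.
Hypothesis betal : forall (s : R) p p' q, beta (s *: p + p') q = s * beta p q + beta p' q.
Hypothesis betar : forall (s : R) p q q', beta p (s *: q + q') = s * beta p q + beta p q'.

Lemma beta0l q : beta 0 q = 0.
Proof. by have := betal (-1) 0 0 q; rewrite scaler0 addr0 mulN1r addNr. Qed.

Lemma beta0r p : beta p 0 = 0.
Proof. by have := betar (-1) p 0 0; rewrite scaler0 addr0 mulN1r addNr. Qed.

Lemma beta_suml (I : Type) (r : seq I) (a : I -> R) (F : I -> MP) q :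
  beta (\sum_(i <- r) a i *: F i) q = \sum_(i <- r) a i * beta (F i) q.
Proof. by elim: r => [|i r IH]; [rewrite !big_nil beta0l|rewrite !big_cons betal IH]. Qed.

Lemma beta_sumr (I : Type) (r : seq I) (a : I -> R) (F : I -> MP) p :
  beta p (\sum_(i <- r) a i *: F i) = \sum_(i <- r) a i * beta p (F i).
Proof. by elim: r => [|i r IH]; [rewrite !big_nil beta0r|rewrite !big_cons betar IH]. Qed.

Lemma beta_comb (s t : R) p q : beta (s *: p + t *: q) (s *: p + t *: q) =
  s ^+ 2 * beta p p + s * t * (beta p q + beta q p) + t ^+ 2 * beta q q.
Proof.
rewrite -[t *: q]addr0 !betal !betar !beta0l !beta0r.
by move: (beta p p) (beta p q) (beta q p) (beta q q) => *; ring.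
Qed.

Lemma betaZ (s : R) p : beta (s *: p) (s *: p) = s ^+ 2 * beta p p.
Proof. by rewrite -[s *: p]addr0 betal !betar !beta0l !beta0r !addr0 mulr0 addr0 mulrA expr2. Qed.

Hypothesis betaC : forall p q, beta p q = beta q p.
Hypothesis beta_ge0 : forall p, 0 <= beta p p.

Lemma beta_CS p q : beta p q ^+ 2 <= beta p p * beta q q.
Proof.
have H (s t : R) : 0 <= s ^+ 2 * beta p p + s * t * (2 * beta p q) + t ^+ 2 * beta q q.
  by have := beta_ge0 (s *: p + t *: q); rewrite beta_comb [beta q p]betaC mulr2n mulrDl mul1r.
have := beta_ge0 q; move: (beta p p) (beta p q) (beta q q) H => a b c H c0.
have [c00|cn] := eqVneq c 0; last first.
  have cp : 0 < c by rewrite lt_def cn.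
  have := H c (- b); rewrite (_ : _ + _ + _ = c * (a * c - b ^+ 2)); last by ring.
  by rewrite pmulr_rge0// subr_ge0.
have [->|b0] := eqVneq b 0; first by rewrite c00 mulr0 expr0n.
(* With c = 0 and b nonzero the quadratic is affine in t, and this t gives it the value -1. *)
have := H 1 (- (a + 1) / (2 * b)); rewrite c00 mulr0 addr0 expr1n !mul1r.
have -> : - (a + 1) / (2 * b) * (2 * b) = - (a + 1) by field.
by move=> ?; lra.
Qed.

Lemma beta_sub p q : beta (p - q) (p - q) <= 2 * beta p p + 2 * beta q q.
Proof.
have := beta_ge0 (1 *: p + 1 *: q).
rewrite -[p in X in _ -> X <= _]scale1r -scaleN1r !beta_comb.
by move: (beta p p) (beta p q) (beta q p) (beta q q) => *; lra.
Qed.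

End bilinear_forms.

(** * Integration over the ball *)

Section measure_rV.
Context (R : realType) (d : nat).
Local Notation mu := (lebesgue_rV R d).
Local Notation B := (unit_ball R d).
Local Notation V := 'rV[R]_d.
Implicit Types (f g : V -> R).

(** The sigma-algebra is generated by the coordinates, so an open set is written as a countable
    union of boxes with rational centres and radii 1/(k+1), each a finite intersection of coordinate
    preimages. *)
Lemma open_measurable_rV (U : set V) : open U -> measurable U.
Proof.
move=> oU.
pose box (z : 'rV[rat]_d * nat) : set V :=
  [set x | forall i, `|x ord0 i - ratr (z.1 ord0 i)| < z.2.+1%:R^-1].
have mbox z : measurable (box z).
  have -> : box z = \bigcap_(i in [set: 'I_d]) (@rV_coord R d i @^-1`
      (ball (ratr (z.1 ord0 i) : R) z.2.+1%:R^-1)).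
    apply/seteqP; split=> [x zx i _|x zx i]; first by rewrite /= /ball /= distrC; exact: zx.
    by have := zx i I; rewrite /= /ball /= distrC.
  apply: fin_bigcap_measurable => // i _.
  rewrite -[X in measurable X]setTI; apply: measurable_rV_coord => //.
  exact: measurable_ball.
rewrite (_ : U = \bigcup_(z in [set z | box z `<=` U]) box z).
  rewrite bigcup_mkcond; apply: countable_bigcupT_measurable => [|z]; first exact: countableP.
  by case: ifP.
apply/seteqP; split=> [x Ux|x [z /= zU zx]]; last exact: zU.
have /nbhs_ballP[e /= e0 xe] : nbhs x U by rewrite nbhsE /=; exists U.
have [k] : exists k, 0 + k.+1%:R^-1 < e / 2 by apply: ltr_add_invr; rewrite divr_gt0.
rewrite add0r => ke.
have qx (i : 'I_d) : {q : rat | `|x ord0 i - ratr q| < k.+1%:R^-1}.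
  apply/cid; have [|q] := @rat_in_itvoo R (x ord0 i - k.+1%:R^-1) (x ord0 i + k.+1%:R^-1).
    by rewrite ltrD2l gt0_cp ?invr_gt0.
  rewrite in_itv /= => /andP[q1 q2]; exists q.
  by rewrite distrC ltr_distl q1 q2.
exists (\row_i sval (qx i), k) => /=; last first.
  by move=> i; rewrite mxE; exact: (svalP (qx i)).
move=> y zy; apply: xe; split=> // i j; rewrite !ord1.
have := zy j; have := svalP (qx j); rewrite /= mxE /ball /= => h1 h2.
rewrite -[x 0 j](subrK (ratr (sval (qx j)))) -addrA (splitr e).
apply: le_lt_trans (ler_normD _ _) _; rewrite ltrD//; first exact: lt_trans h1 ke.
by rewrite distrC; exact: lt_trans h2 ke.
Qed.

Lemma continuous_measurable_rV f : continuous f -> measurable_fun setT f.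
Proof.
move=> /continuousP cf; apply: (measurability _ (RGenOpens.measurableE R)).
move=> _ [_ [a [b ->] <-]]; rewrite setTI; apply: open_measurable_rV.
by apply: cf; exact: interval_open.
Qed.

(** A product set around the ball: its compactness and its finite measure come from the coordinates,
    and both are passed on to the ball and to supports inside it. *)
Definition cube : set V := [set x | forall i, x ord0 i \in `[-1, 1]%R].

Lemma measurable_cube : measurable cube.
Proof.
have -> : cube = \bigcap_(i in [set: 'I_d]) (@rV_coord R d i @^-1` `[-1, 1]).
  by apply/seteqP; split=> [x zx i _|x zx i]; [exact: zx|exact: (zx i I)].
apply: fin_bigcap_measurable => // i _.
by rewrite -[X in measurable X]setTI; apply: measurable_rV_coord.
Qed.

Lemma cube_fin : (mu cube < +oo)%E.
Proof.
rewrite (_ : cube = [set x | forall i, `[-1, 1]%classic (x ord0 i)])//.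
rewrite (lebesgue_rV_box (A := fun=> `[-1, 1]%classic))//.
rewrite (eq_bigr (fun=> 2%:E)) => [|i _]; last first.
  by rewrite lebesgue_measure_itv /= lte_fin -EFinB opprK ifT// (lt_trans ltrN10 ltr01).
by rewrite prodEFin ltry.
Qed.

Definition sqn (x : V) : R := \sum_(i < d) x ord0 i ^+ 2.

Lemma ballE (x : V) : B x = (sqn x < 1).
Proof. by []. Qed.

Lemma coord_cont (i : 'I_d) : continuous (fun x : V => x ord0 i).
Proof. exact: coord_continuous. Qed.

Lemma sum_cont (I : Type) (r : seq I) (F : I -> V -> R) :
  (forall i, continuous (F i)) -> continuous (fun x => \sum_(i <- r) F i x).
Proof.
move=> cF; elim: r => [|i r IH].
  by under eq_fun do rewrite big_nil; exact: cst_continuous.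
by under eq_fun do rewrite big_cons; move=> x; exact: (cvgD (cF i x) (IH x)).
Qed.

Lemma sqn_cont : continuous sqn.
Proof.
apply: sum_cont => i x.
apply: (@continuous_comp _ _ _ (fun x : V => x ord0 i) (fun r : R => r ^+ 2)).
  exact: coord_cont.
exact: exprn_continuous.
Qed.

Lemma open_unit_ball : open B.
Proof.
rewrite (_ : B = sqn @^-1` [set r | r < 1])//.
by apply: open_comp => [x _|]; [exact: sqn_cont|exact: open_lt].
Qed.

Lemma mB : measurable B.
Proof. by apply: open_measurable_rV; exact: open_unit_ball. Qed.

Lemma ball_cube : B `<=` cube.
Proof.
move=> x /=; rewrite /unit_ball /= => x1 i.
rewrite in_itv /= -ler_norml -(@ler_pXn2r _ 2) ?nnegrE// expr1n.
rewrite real_normK ?num_real//; apply: ltW; apply: le_lt_trans x1.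
by rewrite (bigD1 i)//= lerDl sumr_ge0// => j _; exact: sqr_ge0.
Qed.

Lemma ball_fin : (mu B < +oo)%E.
Proof.
apply: le_lt_trans cube_fin; apply: le_measure ball_cube; rewrite inE; first exact: mB.
exact: measurable_cube.
Qed.

Lemma continuous_bounded_cube f : continuous f -> exists M : R, 0 <= M /\ forall x, cube x -> `|f x| <= M.
Proof.
move=> cf; have c0 : cube !=set0.
  by exists 0 => i; rewrite mxE in_itv /= lerN10 ler01.
have [||c _ h] := @EVT_max_rV R d (fun x => `|f x|) cube c0.
- rewrite (_ : cube = [set x | forall i, `[-1, 1]%classic (x ord0 i)])//.
  by apply: (@rV_compact R d (fun=> `[-1, 1]%classic)) => i; exact: segment_compact.
- apply: continuous_subspaceT => x.
  by apply: (@continuous_comp _ _ _ f (fun r : R => `|r|)); [exact: cf|exact: norm_continuous].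
by exists `|f c|; split => // x cx; apply: h; rewrite inE.
Qed.

Lemma bounded_integrable_ball f (M : R) : measurable_fun B f ->
  (forall x, B x -> `|f x| <= M) -> mu.-integrable B (EFin \o f).
Proof.
move=> mf fM; apply: measurable_bounded_integrable => //.
- exact: mB.
- exact: ball_fin.
- by exists M; split; [exact: num_real|move=> y My x Bx; exact: le_trans (fM _ Bx) (ltW My)].
Qed.

Lemma cont_integrable f : continuous f -> mu.-integrable B (EFin \o f).
Proof.
move=> cf; have [M [_ fM]] := continuous_bounded_cube cf.
apply: (@bounded_integrable_ball _ M) => [|x Bx]; last by apply: fM; exact: ball_cube.
by apply: measurable_funTS; exact: continuous_measurable_rV.
Qed.

End measure_rV.

(** * Fubini along lines and integration of a partial derivative *)

Section slices.
Context (R : realType).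
Local Notation leb := (@lebesgue_measure R).

Definition upd d (x : 'rV[R]_d) (i : 'I_d) (t : R) : 'rV[R]_d :=
  \row_j (if j == i then t else x ord0 j).

Lemma integrable_cube d (g : 'rV[R]_d -> R) (M : R) : measurable_fun setT g ->
  (forall x, `|g x| <= M) -> (forall x, ~ cube x -> g x = 0) ->
  (lebesgue_rV R d).-integrable setT (EFin \o g).
Proof.
move=> mg gM g0.
have -> : EFin \o g = (EFin \o g) \_ (@cube R d).
  apply/funext => x; rewrite patchE; case: ifPn => // /negP; rewrite inE => xc.
  by rewrite /= g0.
apply/(integrable_mkcond _ (@measurable_cube R d)).
apply: measurable_bounded_integrable.
- exact: measurable_cube.
- exact: cube_fin.
- exact: measurable_funTS.
- by exists M; split; [exact: num_real|move=> y My x _; exact: le_trans (gM x) (ltW My)].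
Qed.

Lemma integral_lebesgue_rVS d (g : 'rV[R]_d.+1 -> R) (M : R) : measurable_fun setT g ->
  (forall x, `|g x| <= M) -> (forall x, ~ cube x -> g x = 0) ->
  (leb \x lebesgue_rV R d)%E.-integrable setT (fun z => (g (rV_cons z))%:E) /\
  (\int[lebesgue_rV R d.+1]_x (g x)%:E =
   \int[leb \x lebesgue_rV R d]_z (g (rV_cons z))%:E)%E.
Proof.
move=> mg gM g0; have /integrableP[_ ig] := integrable_cube mg gM g0.
have mcons := @measurable_rV_cons R d.
have I : (leb \x lebesgue_rV R d)%E.-integrable setT (fun z => (g (rV_cons z))%:E).
  apply/integrableP; split.
    by apply/measurable_EFinP; apply: (measurableT_comp mg mcons).
  move: ig.
  rewrite [X in (X < _)%E](_ : _ = (\int[pushforward (leb \x lebesgue_rV R d)%E (@rV_cons R d)]_x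
    `|(EFin \o g) x|)%E)//.
  rewrite ge0_integral_pushforward//.
  by apply: measurableT_comp => //; exact/measurable_EFinP.
split => //.
rewrite [LHS](_ : _ = (\int[pushforward (leb \x lebesgue_rV R d)%E (@rV_cons R d)]_x
    (EFin \o g) x)%E)//.
by rewrite integral_pushforward//; exact/measurable_EFinP.
Qed.

(** Fubini in direction i, by peeling off the first coordinate. If i is not the first, the inner
    integral over the remaining coordinates vanishes by induction; if it is, the order of
    integration is exchanged and the inner integral is the slice. *)
Lemma slice0 d (i : 'I_d) (g : 'rV[R]_d -> R) (M : R) : measurable_fun setT g ->
  (forall x, `|g x| <= M) -> (forall x, ~ cube x -> g x = 0) ->
  (forall x, \int[leb]_t (g (upd x i t))%:E = 0)%E ->
  (\int[lebesgue_rV R d]_x (g x)%:E = 0)%E.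
Proof.
elim: d i g => [|d IH] i g mg gM g0 gi; first by case: i gi.
have [I ->] := integral_lebesgue_rVS mg gM g0.
have [j ij|ij] := unliftP ord0 i.
  rewrite -(integral12_prod_meas1 I) integral0_eq// => t _.
  apply: (IH j (fun y => g (rV_cons (t, y)))) => [|x|x cx|x].
  - apply: measurableT_comp mg _; apply: measurableT_comp (@measurable_rV_cons R d) _.
    exact: measurable_pair1.
  - exact: gM.
  - apply: g0 => cx'; apply: cx => k; have := cx' (lift ord0 k).
    by rewrite rV_cons_lift.
  - rewrite -[RHS](gi (rV_cons (t, x))); apply: eq_integral => r _.
    congr (g _)%:E; apply/rowP => k; rewrite [RHS]mxE ij (_ : 0 = ord0)//.
    have [l ->|->] := unliftP ord0 k; last by rewrite !rV_cons_ord0.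
    by rewrite !rV_cons_lift mxE (inj_eq lift_inj).
rewrite -(integral21_prod_meas1 I) integral0_eq// => y _.
rewrite /fubini_G -[RHS](gi (rV_cons (0, y))); apply: eq_integral => r _.
congr (g _)%:E; apply/rowP => k; rewrite [RHS]mxE ij (_ : 0 = ord0)//.
have [l ->|->] := unliftP ord0 k; last by rewrite !rV_cons_ord0.
by rewrite !rV_cons_lift.
Qed.

Context (d : nat).
Local Notation V := 'rV[R]_d.
Local Notation mu := (lebesgue_rV R d).
Local Notation B := (unit_ball R d).
Implicit Types (f g : V -> R).

Lemma updE (x : V) i t : upd x i t = upd x i 0 + t *: delta_mx ord0 i.
Proof.
apply/rowP => j; rewrite !mxE eqxx /=.
by case: eqP => _; rewrite ?mulr1 ?mulr0 ?addr0 ?add0r.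
Qed.

Lemma updD (x : V) i t s : upd x i (t + s) = s *: delta_mx ord0 i + upd x i t.
Proof. by rewrite updE [in RHS]updE scalerDl addrA addrC. Qed.

Lemma upd_cont (x : V) i : continuous (upd x i).
Proof.
rewrite (_ : upd x i = fun t => upd x i 0 + t *: delta_mx ord0 i); last first.
  by apply/funext => t; exact: updE.
move=> t; apply: cvgD; first exact: cvg_cst.
by apply: cvgZr_tmp; exact: cvg_id.
Qed.

Lemma sqn_upd (x : V) i t : sqn (upd x i t) = t ^+ 2 + sqn (upd x i 0).
Proof.
rewrite /sqn (bigD1 i)//= [in RHS](bigD1 i)//= !mxE eqxx expr0n add0r.
by congr (_ + _); apply: eq_bigr => j ji; rewrite !mxE (negPf ji).
Qed.

Lemma derive_upd f (x : V) i t : derivable f (upd x i t) (delta_mx ord0 i) ->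
  is_derive t 1 (fun t => f (upd x i t)) (partial i f (upd x i t)).
Proof.
move=> df.
have E : (fun h => h^-1 *: (f (upd x i (h *: 1 + t)) - f (upd x i t))) =
         (fun h => h^-1 *: (f (h *: delta_mx ord0 i + upd x i t) - f (upd x i t))).
  by apply/funext => h; rewrite -updD (addrC t) (_ : h *: 1 = h)//; exact: mulr1.
split; first by rewrite /derivable E.
by rewrite /partial /derive E.
Qed.

(** Each line parallel to the i-th axis meets the ball in a chord or not at all, and the integral
    over a chord is the difference of the values of f at its ends, which lie on the sphere. *)
Lemma integral_partial_ball i f :
  (forall x, derivable f x (delta_mx ord0 i)) -> continuous (partial i f) ->
  (forall x, sqn x = 1 -> f x = 0) ->
  \int[mu]_(x in B) partial i f x = 0.
Proof.
move=> df cf f0; rewrite Rintegral_mkcond /Rintegral.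
have [M [M0 fM]] := continuous_bounded_cube cf.
rewrite (@slice0 d i _ M)//.
- apply: (proj1 (@measurable_restrictT _ _ V (measurableTypeR R) B (partial i f) (@mB R d))).
  by apply: measurable_funTS; exact: continuous_measurable_rV.
- move=> x; rewrite patchE; case: ifPn => [|_]; last by rewrite normr0.
  by rewrite inE => /ball_cube/fM.
- by move=> x cx; rewrite patchE ifF//; apply/negP; rewrite inE => /ball_cube.
move=> x; set s := sqn (upd x i 0).
have [s1|s1] := leP 1 s.
  apply: integral0_eq => t _; rewrite patchE ifF//; apply/negP; rewrite inE ballE sqn_upd -/s.
  by apply/negP; rewrite -leNgt ler_wpDl// sqr_ge0.
(* Half the length of the chord through x: s is the squared distance of the line from the origin. *)
pose a := Num.sqrt (1 - s).
have a0 : 0 < a by rewrite sqrtr_gt0 subr_gt0.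
have a2 : a ^+ 2 = 1 - s by rewrite sqr_sqrtr// subr_ge0 ltW.
pose h t := f (upd x i t); pose h' t := partial i f (upd x i t).
have hh' (t : R) : is_derive t 1 h (h' t) by apply: derive_upd.
have ch' : continuous h'.
  move=> t; apply: (@continuous_comp _ _ _ (upd x i) (partial i f)); last exact: cf.
  exact: upd_cont.
have ch : continuous h.
  move=> t; apply: differentiable_continuous; apply/derivable1_diffP.
  exact: ex_derive.
pose I : set R := `]-a, a[%classic.
transitivity (\int[leb]_t (((EFin \o h') \_ I) t))%E.
  apply: eq_integral => t _; rewrite !patchE.
  have -> : (upd x i t \in B) = (t \in I); last by case: ifP.
  rewrite [RHS]inE /I /= in_itv /= -ltr_norml -(@ltr_pXn2r _ 2) ?nnegrE ?(ltW a0)// real_normK ?num_real// a2.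
  by apply/idP/asboolP => [|H]; rewrite inE ballE sqn_upd -/s -ltrBrDr.
rewrite -integral_mkcond /I -(@integral_itv_bndoo _ _ _ _ true false); last first.
  by apply/measurable_EFinP; apply: measurable_funTS; exact: continuous_measurable_fun.
rewrite (@continuous_FTC2 R h' h)//.
- rewrite /h !f0 ?subee// sqn_upd -/s ?sqrrN a2 subrK//.
- by rewrite gtrN.
- exact: continuous_subspaceT.
- split => [t _| |]; first exact: ex_derive.
    by apply: cvg_at_right_filter; exact: ch.
  by apply: cvg_at_left_filter; exact: ch.
- by move=> t _; rewrite derive1E derive_val.
Qed.

End slices.

(** * Integrals of polynomials over the ball and Green's formula *)

Section polynomial_integrals.
Context (R : realType) (d : nat).
Local Notation MP := (mpoly d R).
Local Notation V := 'rV[R]_d.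
Local Notation mu := (lebesgue_rV R d).
Local Notation B := (unit_ball R d).
Local Notation rho := (rho R d).
Local Notation lap := (@lap R d).
Implicit Types (p q f g h : MP) (x : V).

Definition ev p : V -> R := fun x => meval (fun i => x ord0 i) p.

Lemma ev_ind (P : MP -> Prop) : (forall c, P (mpolyC d c)) -> (forall i, P (var R i)) ->
  (forall p q, P p -> P q -> P (p + q)) -> (forall p q, P p -> P q -> P (p * q)) ->
  forall p, P p.
Proof.
move=> PC PX PD PM p; rewrite [p]mpolyE.
elim/big_ind : _ => // [|k _]; first by rewrite -mpolyC0; exact: PC.
rewrite -mul_mpolyC; apply/PM; first exact: PC.
rewrite mpolyXE_id; elim/big_ind : _ => [|p1 p2|i _]; [by rewrite -mpolyC1; exact: PC|by move=> ? ?; apply/PM|].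
elim: (k i) => [|n IH]; first by rewrite expr0 -mpolyC1; exact: PC.
by rewrite exprS; apply/PM/IH; exact: PX.
Qed.

Lemma evC c : ev (mpolyC d c) = cst c.
Proof. by apply/funext => x; rewrite /ev mevalC. Qed.

Lemma ev1 x : ev 1 x = 1. Proof. exact: rmorph1. Qed.

Lemma ev_var i x : ev (var R i) x = x ord0 i. Proof. exact: mevalXU. Qed.

Lemma evD p q x : ev (p + q) x = ev p x + ev q x. Proof. exact: mevalD. Qed.

Lemma evB p q x : ev (p - q) x = ev p x - ev q x. Proof. exact: mevalB. Qed.

Lemma evM p q x : ev (p * q) x = ev p x * ev q x. Proof. exact: mevalM. Qed.

Lemma evZ c p x : ev (c *: p) x = c * ev p x. Proof. exact: mevalZ. Qed.

Lemma evX p n x : ev (p ^+ n) x = ev p x ^+ n. Proof. exact: rmorphXn. Qed.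

Lemma ev_sum (I : Type) (r : seq I) (F : I -> MP) x :
  ev (\sum_(i <- r) F i) x = \sum_(i <- r) ev (F i) x.
Proof. exact: raddf_sum. Qed.

Lemma ev_rho x : ev rho x = 1 - sqn x.
Proof.
rewrite /rho evB ev1 ev_sum; congr (_ - _).
by apply: eq_bigr => i _; rewrite evX ev_var.
Qed.

Lemma ev_cont p : continuous (ev p).
Proof.
elim/ev_ind : p => [c|i|p q cp cq|p q cp cq].
- by rewrite evC; exact: cst_continuous.
- rewrite (_ : ev _ = fun x => x ord0 i); first exact: coord_cont.
  by apply/funext => x; rewrite ev_var.
- rewrite (_ : ev _ = fun x => ev p x + ev q x); last by apply/funext => x; rewrite evD.
  by move=> x; exact: (cvgD (cp x) (cq x)).
- rewrite (_ : ev _ = fun x => ev p x * ev q x); last by apply/funext => x; rewrite evM.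
  by move=> x; exact: (cvgM (cp x) (cq x)).
Qed.

Lemma ev_derive p i x : is_derive x (delta_mx ord0 i) (ev p) (ev (mderiv i p) x).
Proof.
elim/ev_ind : p x => [c|j|p q dp dq|p q dp dq] x.
- rewrite mderivC evC (_ : ev 0 x = 0); first exact: is_derive_cst.
  by rewrite /ev meval0.
- rewrite (_ : ev (var R j) = fun x : V => x ord0 j); last by apply/funext => y; rewrite ev_var.
  rewrite mderiv_var.
  have E : (fun h : R => h^-1 *: ((h *: (delta_mx ord0 i : V) + x) ord0 j - x ord0 j)) @ 0^'
      --> ((i == j)%:R : R).
    apply: cvg_near_cst; near=> h.
    rewrite !mxE addrK eqxx /= [_ *: _]mulrA mulVf ?mul1r; last by near: h; exact: nbhs_dnbhs_neq.
    by rewrite eq_sym.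
  split; first by apply/cvg_ex; eexists; exact: E.
  rewrite -mpolyC_nat evC; apply: cvg_lim; [exact: Rhausdorff|exact: E].
- rewrite (_ : ev (p + q) = ev p + ev q); last by apply/funext => y; rewrite evD.
  by rewrite raddfD /= evD; exact: is_deriveD.
- rewrite (_ : ev (p * q) = ev p * ev q); last by apply/funext => y; rewrite evM.
  rewrite mderivM evD !evM; apply: is_derive_eq.
  by rewrite addrC; congr (_ + _); exact: mulrC.
Unshelve. all: by end_near. Qed.

Lemma partial_ev i p : partial i (ev p) = ev (mderiv i p).
Proof. by apply/funext => x; rewrite /partial; have [_] := ev_derive p i x. Qed.

Definition pderivs (s : seq 'I_d) p : MP := foldr (@mderiv d R) p s.

Lemma partials_ev s p : partials s (ev p) = ev (pderivs s p).
Proof. by elim: s => //= i s ->; rewrite partial_ev. Qed.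

Lemma smooth_ev p : smooth (ev p).
Proof.
move=> s; rewrite partials_ev; split; first exact: ev_cont.
by move=> i x; have [] := ev_derive (pderivs s p) i x.
Qed.

Definition bint (f : V -> R) : R := \int[mu]_(x in B) f x.

Definition pint p := bint (ev p).

Lemma ev_int p : mu.-integrable B (EFin \o ev p).
Proof. exact/cont_integrable/ev_cont. Qed.

Lemma pint_is_linear : scalable_for *%R pint * additive pint.
Proof.
split=> [c p|p q].
  rewrite /pint /bint -RintegralZl; [|exact: mB|exact: ev_int].
  by apply: eq_Rintegral => x _; rewrite evZ.
rewrite /pint /bint -RintegralB; [|exact: mB|exact: ev_int|exact: ev_int].
by apply: eq_Rintegral => x _; rewrite evB.
Qed.

HB.instance Definition _ := GRing.isZmodMorphism.Build MP R pint (snd pint_is_linear).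

HB.instance Definition _ :=
  GRing.isScalable.Build R MP R *%R pint (fst pint_is_linear).

Lemma pintZ c p : pint (c *: p) = c * pint p.
Proof. exact: linearZ. Qed.

Lemma pintD p q : pint (p + q) = pint p + pint q.
Proof. exact: raddfD. Qed.

Lemma pintB p q : pint (p - q) = pint p - pint q.
Proof. exact: raddfB. Qed.

Lemma pint_le p q : (forall x, B x -> ev p x <= ev q x) -> pint p <= pint q.
Proof. by move=> pq; apply: le_Rintegral => //; [exact: mB|exact: ev_int|exact: ev_int]. Qed.

Lemma pint_ge0 p : (forall x, B x -> 0 <= ev p x) -> 0 <= pint p.
Proof. by move=> p0; apply: Rintegral_ge0. Qed.

Lemma rho_ge0 x : B x -> 0 <= ev rho x.
Proof. by rewrite ballE ev_rho => /ltW; rewrite subr_ge0. Qed.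

Lemma rho_le1 x : ev rho x <= 1.
Proof. by rewrite ev_rho gerBl sumr_ge0// => i _; exact: sqr_ge0. Qed.

Lemma pint_rhoX_sqr_ge0 k p : 0 <= pint (rho ^+ k * p ^+ 2).
Proof.
apply: pint_ge0 => x Bx; rewrite evM !evX mulr_ge0 ?sqr_ge0//.
by rewrite exprn_ge0// rho_ge0.
Qed.

Lemma pint_deriv_rho i q : pint (mderiv i (rho * q)) = 0.
Proof.
rewrite /pint -partial_ev; apply: integral_partial_ball => [x||x x1].
- by have [] := ev_derive (rho * q) i x.
- by rewrite partial_ev; exact: ev_cont.
- by rewrite evM ev_rho x1 subrr mul0r.
Qed.

Lemma mderiv_rhoX i k : mderiv i (rho ^+ k.+1) = rho ^+ k * - ((k.+1)%:R * 2 *: var R i).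
Proof.
elim: k => [|k IH]; first by rewrite expr1 expr0 mderiv_rho !mul1r.
rewrite exprS mderivM IH mderiv_rho -!mul_mpolyC !rmorphM /= !rmorph_nat.
by rewrite -[k.+2%:R]natr1 exprS; ring.
Qed.

(** The algebraic form of vanishing to order k on the sphere: each derivative costs one factor
    [rho], and one remaining factor allows an integration by parts. *)
Definition rdiv k f := exists q, f = rho ^+ k * q.

Lemma rdiv_le k k' f : (k <= k')%N -> rdiv k' f -> rdiv k f.
Proof.
move=> kk [q ->]; exists (rho ^+ (k' - k) * q).
by rewrite mulrA -exprD subnKC.
Qed.

Lemma rdiv_deriv k i f : rdiv k.+1 f -> rdiv k (mderiv i f).
Proof.
move=> [q ->]; exists (- ((k.+1)%:R * 2 *: var R i) * q + rho * mderiv i q).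
by rewrite mderivM mderiv_rhoX exprSr; ring.
Qed.

Lemma rdiv_pderivs k s f : (size s <= k)%N -> rdiv k f -> rdiv (k - size s) (pderivs s f).
Proof.
move=> + kf; elim: s => [|i s IH] /= sk; first by rewrite subn0.
by apply: rdiv_deriv; rewrite subnSK//; exact: IH (ltnW sk).
Qed.

Lemma pint_ibp i f g : rdiv 1 f -> pint (mderiv i f * g) = - pint (f * mderiv i g).
Proof.
move=> [q fE]; apply/eqP; rewrite -addr_eq0 -raddfD /= -mderivM fE expr1 -mulrA.
by rewrite pint_deriv_rho.
Qed.

(** If f vanishes to order k on the sphere, iterating [tform_step] turns this into the sum, over all
    lists of k directions, of the integrals of d_s f d_s g. Symmetry and positivity are read off
    from there. *)
Definition tform k f g := (-1) ^+ k * pint (f * iter k lap g).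

Lemma mderiv_lap i k p : mderiv i (iter k lap p) = iter k lap (mderiv i p).
Proof.
elim: k p => //= k IH p; rewrite -IH /lap raddf_sum /=.
apply: eq_bigr => j _; rewrite mderiv_comm; congr (mderiv _ _); exact: mderiv_comm.
Qed.

Lemma tform_step k f g : rdiv 1 f ->
  tform k.+1 f g = \sum_i tform k (mderiv i f) (mderiv i g).
Proof.
move=> f1; rewrite /tform -mulr_sumr exprS mulN1r mulNr -mulrN; congr (_ * _).
rewrite iterS {1}/lap mulr_sumr raddf_sum /= -sumrN; apply: eq_bigr => i _.
by rewrite -mderiv_lap pint_ibp.
Qed.

Lemma tform_sym k f g : rdiv k f -> rdiv k g -> tform k f g = tform k g f.
Proof.
elim: k f g => [|k IH] f g fk gk; first by rewrite /tform /= [f * g]mulrC.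
rewrite (tform_step _ _ (rdiv_le (ltn0Sn k) fk)) (tform_step _ _ (rdiv_le (ltn0Sn k) gk)).
by apply: eq_bigr => i _; apply: IH; exact: rdiv_deriv.
Qed.

Lemma pderivs_deriv s i f : pderivs s (mderiv i f) = mderiv i (pderivs s f).
Proof. by elim: s => //= j s ->; rewrite mderiv_comm. Qed.

(** The energy is a sum of squared norms over lists of directions; all but one of them are
    discarded. *)
Lemma tform_bound s f : rdiv (size s) f -> pint (pderivs s f ^+ 2) <= tform (size s) f f.
Proof.
elim: s f => [|i s IH] f fk /=; first by rewrite /tform expr0 mul1r.
rewrite tform_step; last exact: rdiv_le fk.
rewrite (bigD1 i)//= -pderivs_deriv; apply: ler_wpDr; last by apply: IH; exact: rdiv_deriv.
apply: sumr_ge0 => j _; apply: le_trans (IH _ (rdiv_deriv _ fk)).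
by apply: pint_ge0 => x _; rewrite evX sqr_ge0.
Qed.

(** The integral of d_i (x_i f^2) vanishes, so int f^2 = -2 int x_i f d_i f. As |x_i| <= 1 on the
    ball, Young's inequality with weights 1/2 and 2 absorbs half of the left side, whence the
    constant 4. *)
Lemma pint_poincare i f : rdiv 1 f -> pint (f ^+ 2) <= 4 * pint (mderiv i f ^+ 2).
Proof.
move=> f1; set g := mderiv i f.
have f1' : rdiv 1 (var R i * f) by case: f1 => q ->; exists (var R i * q); ring.
have := pint_ibp i f f1'.
rewrite mderivM mderiv_var eqxx mul1r -/g mulrDl raddfD /=.
have -> : var R i * g * f = var R i * f * g by ring.
move=> E; have {E} : pint (f ^+ 2) = - (2 * pint (var R i * f * g)).
  by rewrite expr2; lra.
have : - (2 * pint (var R i * f * g)) <= pint (2^-1 *: f ^+ 2 + 2 *: g ^+ 2).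
  rewrite -mulNr -pintZ; apply: pint_le => x Bx.
  rewrite evD !evZ !evX !evM ev_var.
  have : x ord0 i ^+ 2 <= 1.
    by apply: ltW; apply: le_lt_trans Bx; rewrite (bigD1 i)//= lerDl sumr_ge0// => j _; exact: sqr_ge0.
  move: (x ord0 i) (ev f x) (ev g x) => a u v a1.
  have : 0 <= (2^-1 * u + a * v) ^+ 2 by exact: sqr_ge0.
  have : 0 <= (1 - a ^+ 2) * v ^+ 2 by rewrite mulr_ge0 ?sqr_ge0// subr_ge0.
  by nra.
by rewrite raddfD /= !pintZ; lra.
Qed.

(** The divergence of the field x rho^(k+1) integrates to 0; it is expanded with |x|^2 = 1 - rho. *)
Lemma pint_rho_rec k :
  (d%:R + 2 * k.+1%:R) * pint (rho ^+ k.+1) = 2 * k.+1%:R * pint (rho ^+ k).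
Proof.
have E : \sum_i mderiv i (rho * (var R i * rho ^+ k)) =
    (d%:R + 2 * k.+1%:R) *: rho ^+ k.+1 - (2 * k.+1%:R) *: rho ^+ k.
  have D i : mderiv i (rho * (var R i * rho ^+ k)) =
      rho ^+ k.+1 - (2 * k.+1%:R) *: (var R i ^+ 2 * rho ^+ k).
    have -> : rho * (var R i * rho ^+ k) = var R i * rho ^+ k.+1 by rewrite exprS; ring.
    rewrite mderivM mderiv_var eqxx mul1r mderiv_rhoX -!mul_mpolyC !rmorphM /= !rmorph_nat; ring.
  rewrite (eq_bigr _ (fun i _ => D i)) big_split /= sumr_const card_ord sumrN.
  rewrite -scaler_sumr -mulr_suml (_ : \sum_i _ = 1 - rho); last by rewrite /rho opprB addrC subrK.
  rewrite mulrBl mul1r -exprS scalerDl scaler_nat scalerBr opprB [in RHS]addrAC -!addrA.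
  by congr (_ + _); rewrite addrC.
have : pint (\sum_i mderiv i (rho * (var R i * rho ^+ k))) = 0.
  by rewrite raddf_sum /= big1// => i _; rewrite pint_deriv_rho.
by rewrite E raddfB /= !pintZ => /eqP; rewrite subr_eq0 => /eqP.
Qed.

Lemma pint1_gt0 : 0 < pint 1.
Proof.
have -> : pint 1 = fine (mu B).
  transitivity (\int[mu]_(x in B) cst 1 x); first by apply: eq_Rintegral => x _; rewrite ev1.
  by rewrite Rintegral_cst ?mul1r//; exact: mB.
rewrite fine_gt0// ball_fin andbT.
(* The cube of half-side e lies in the ball: the sum of the squares is at most d e^2 <= d e < 1. *)
pose e : R := d.+1%:R^-1; have e0 : 0 < e by rewrite invr_gt0 ltr0n.
pose A (i : 'I_d) : set R := `]-e, e[%classic.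
apply: (@lt_le_trans _ _ (mu [set x : V | forall i, A i (x ord0 i)])).
  rewrite (lebesgue_rV_box (A := A)); last by move=> i; exact: measurable_itv.
  rewrite (eq_bigr (fun=> (2 * e)%:E)) => [|i _].
    by rewrite prodEFin lte_fin prodr_gt0// => i _; rewrite mulr_gt0.
  by rewrite lebesgue_measure_itv /= lte_fin ifT ?gtrN// -EFinB opprK mulr_natl.
apply: le_measure; rewrite ?inE; last 2 first.
- exact: mB.
- move=> x xA; rewrite ballE /sqn.
  apply: (@le_lt_trans _ _ (\sum_(i < d) e)); last first.
    by rewrite sumr_const card_ord -mulr_natl ltr_pdivrMr ?ltr0n// mul1r ltr_nat.
  apply: ler_sum => i _; have := xA i; rewrite /A /= in_itv /= -ltr_norml => /ltW xe.
  rewrite -real_normK ?num_real// expr2 -[leRHS]mulr1 ler_pM//.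
  by apply: le_trans xe _; rewrite invf_le1 ?ler1n ?ltr0n.
have -> : [set x : V | forall i, A i (x ord0 i)] =
    \bigcap_(i in [set: 'I_d]) (@rV_coord R d i @^-1` A i).
  by apply/seteqP; split=> [x zx i _|x zx i]; [exact: zx|exact: (zx i I)].
apply: fin_bigcap_measurable => // i _.
by rewrite -[X in measurable X]setTI; apply: measurable_rV_coord => //; exact: measurable_itv.
Qed.

Lemma pint_rhoX_gt0 k : 0 < pint (rho ^+ k).
Proof.
elim: k => [|k IH]; first by rewrite expr0 pint1_gt0.
have := pint_rho_rec k; have : 0 < (d%:R + 2 * k.+1%:R : R).
  by rewrite ltr_wpDl// mulr_gt0// ltr0n.
move=> c0 E; rewrite -(pmulr_rgt0 _ c0) E mulr_gt0// mulr_gt0// ltr0n.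
Qed.

Lemma pint_CS k p q : pint (rho ^+ k * p * q) ^+ 2 <=
  pint (rho ^+ k * p ^+ 2) * pint (rho ^+ k * q ^+ 2).
Proof.
have := @beta_CS R d (fun p q => pint (rho ^+ k * p * q)).
rewrite [p ^+ 2]expr2 [q ^+ 2]expr2 ![rho ^+ k * (_ * _)]mulrA; apply.
- by move=> s p1 p2 p3; rewrite mulrDr mulrDl -scalerAr -scalerAl pintD pintZ.
- by move=> s p1 p2 p3; rewrite mulrDr -scalerAr pintD pintZ.
- by move=> p1 p2; rewrite mulrAC.
- by move=> p1; rewrite -mulrA -expr2 pint_rhoX_sqr_ge0.
Qed.

(** Induction on the degree. By Cauchy-Schwarz p is orthogonal to every polynomial for the weight
    rho^k; integrating by parts, d_i p has norm 0 for the weight rho^(k+1), hence is 0 by induction,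
    and p is a constant. *)
Lemma pint_pos_def k p : pint (rho ^+ k * p ^+ 2) = 0 -> p = 0.
Proof.
have [n pn] : exists n, degs (fun a => a < n)%N p.
  by exists (msize p) => m; exact: msize_mdeg_lt.
elim: n k p pn => [|n IH] k p pn p0; first exact: degs_lt0.
have E q : pint (rho ^+ k * p * q) = 0.
  have := pint_CS k p q; rewrite p0 mul0r => H.
  by apply/eqP; rewrite -sqrf_eq0 eq_le H sqr_ge0.
have dp i : mderiv i p = 0.
  apply: (IH k.+1); first by apply: degs_deriv pn.
  have r1 : rdiv 1 (rho ^+ k.+1 * mderiv i p) by exists (rho ^+ k * mderiv i p); rewrite mulrA exprS.
  have := pint_ibp i p r1.
  have [q ->] : rdiv k (mderiv i (rho ^+ k.+1 * mderiv i p)).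
    by apply: rdiv_deriv; exists (mderiv i p).
  have -> : rho ^+ k * q * p = rho ^+ k * p * q by ring.
  by rewrite E expr2 mulrA => /esym/eqP; rewrite oppr_eq0 => /eqP.
have pc : p = mpolyC d (mcoeff (@mnm0 d) p).
  apply/mpolyP => m; rewrite mcoeffC; have [->|m0] := eqVneq m (@mnm0 d); first by rewrite mulr1.
  rewrite mulr0; have [i mi] : exists i, (0 < m i)%N.
    apply/existsP; apply: contraNT m0; rewrite negb_exists => /forallP mi.
    by apply/eqP/mnmP => i; rewrite mnm0E; apply/eqP; rewrite -leqn0 leqNgt; exact: mi.
  have := congr1 (mcoeff (mnm_sub m (mnm1 i))) (dp i).
  rewrite mcoeff0 mcoeff_mderiv submK; last first.
    by apply/mnm_lepP => j; rewrite mnm1E; case: eqP => [<-|].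
  by move=> /eqP; rewrite mulrn_eq0 => /orP[//|/eqP].
move: p0; rewrite pc -rmorphXn /= mulrC mul_mpolyC pintZ => /eqP.
by rewrite mulf_eq0 sqrf_eq0 (gt_eqF (pint_rhoX_gt0 k)) orbF => /eqP ->; rewrite mpolyC0.
Qed.

End polynomial_integrals.

(** * The variational problem on polynomials *)

Section finite_dimensional.
Context (R : realType) (d : nat) (b : nat).
Local Notation MP := (mpoly d R).
Local Notation n := #|{: bmultinom d b}|.
Implicit Types (p q : MP) (c : 'rV[R]_n).

Definition mon (i : 'I_n) : MP := mpolyX R (bmnm (enum_val i)).
Definition pol c : MP := \sum_i c ord0 i *: mon i.

Lemma degs_mon i : degs (fun a => a < b)%N (mon i).
Proof. by move=> k; rewrite msuppX inE => /eqP ->; exact: bmdeg. Qed.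

Lemma degs_pol c : degs (fun a => a < b)%N (pol c).
Proof. by apply: degs_sum => i; apply/degsZ/degs_mon. Qed.

Lemma mcoeff_pol c i : mcoeff (bmnm (enum_val i)) (pol c) = c ord0 i.
Proof.
rewrite /pol raddf_sum /= (bigD1 i)//= mcoeffZ mcoeffX eqxx mulr1 big1 ?addr0// => j ji.
rewrite mcoeffZ mcoeffX (_ : (_ == _) = false) ?mulr0//.
by apply/negbTE; apply: contra ji => /eqP/val_inj/enum_val_inj ->.
Qed.

Lemma pol_inj c : pol c = 0 -> c = 0.
Proof. by move=> c0; apply/rowP => i; rewrite -mcoeff_pol c0 mcoeff0 mxE. Qed.

Lemma polP p : degs (fun a => a < b)%N p -> exists c, p = pol c.
Proof.
move=> /degsP pb; exists (\row_i mcoeff (bmnm (enum_val i)) p).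
apply/mpolyP => k; have [kb|kb] := boolP (mdeg k < b)%N; last first.
  by rewrite pb// (proj1 (degsP _ _) (@degs_pol _)).
have -> : k = bmnm (enum_val (enum_rank (BMultinom kb))) by rewrite enum_rankK.
by rewrite mcoeff_pol mxE.
Qed.

(** Riesz representation in bounded degree, by inverting the Gram matrix of the monomials. It serves
    twice: to solve [kop p = f] and to construct orthogonal projections. *)
Lemma finite_representation (beta : MP -> MP -> R) (ell : MP -> R) :
  (forall (s : R) p p' q, beta (s *: p + p') q = s * beta p q + beta p' q) ->
  (forall (s : R) p q q', beta p (s *: q + q') = s * beta p q + beta p q') ->
  (forall p, degs (fun a => a < b)%N p -> beta p p = 0 -> p = 0) ->
  (forall (s : R) p q, ell (s *: p + q) = s * ell p + ell q) ->
  exists2 p, degs (fun a => a < b)%N p &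
    forall q, degs (fun a => a < b)%N q -> beta p q = ell q.
Proof.
move=> bl br bpos ellL; pose G : 'M[R]_n := \matrix_(i, j) beta (mon i) (mon j).
have GE c j : (c *m G) ord0 j = beta (pol c) (mon j).
  by rewrite mxE (beta_suml bl); apply: eq_bigr => i _; rewrite mxE.
have Gu : G \in unitmx.
  (* A row in the kernel of the Gram matrix is the coefficient vector of a polynomial orthogonal to
     all monomials, hence to itself. *)
  rewrite -row_free_unit -kermx_eq0; apply/eqP/row_matrixP => i; rewrite row0.
  apply: pol_inj; apply: bpos; first exact: degs_pol.
  rewrite [X in beta _ X]/pol (beta_sumr br) big1// => j _.
  by rewrite -GE -row_mul mulmx_ker row0 [X in _ * X]mxE mulr0.
pose c := (\row_j ell (mon j)) *m invmx G.
exists (pol c); first exact: degs_pol.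
move=> q /polP[c' ->]; rewrite [X in beta _ X]/pol (beta_sumr br) /pol.
have ell0 : ell 0 = 0 by have := ellL (-1) 0 0; rewrite scaler0 addr0 mulN1r addNr.
have -> : ell (\sum_i c' ord0 i *: mon i) = \sum_i c' ord0 i * ell (mon i).
  by elim: (index_enum _) => [|i r IH]; [rewrite !big_nil|rewrite !big_cons ellL IH].
apply: eq_bigr => j _; congr (_ * _).
by rewrite -GE /c mulmxKV// mxE.
Qed.

End finite_dimensional.

(** * Spectral lower bounds for the polynomial operator *)

Section tail_estimate.
Context (R : realType) (d m : nat).
Hypothesis d0 : (0 < d)%N.
Local Notation MP := (mpoly d R).
Local Notation rho := (rho R d).
Local Notation kop := (@kop R d m).
Implicit Types (p q f : MP).

Definition wip p q : R := pint (rho ^+ m * p * q).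
(** The energy form: with w = rho^m p and z = rho^m q it is the integral of w (-Delta)^m z, the
    weight of [wip] supplying the factor rho^m of w. *)
Definition aform p q : R := wip p (kop q).

Lemma wipC p q : wip p q = wip q p.
Proof. by rewrite /wip mulrAC. Qed.

Lemma wip_l c p p' q : wip (c *: p + p') q = c * wip p q + wip p' q.
Proof. by rewrite /wip mulrDr mulrDl -scalerAr -scalerAl pintD pintZ. Qed.

Lemma wip_r c p q q' : wip p (c *: q + q') = c * wip p q + wip p q'.
Proof. by rewrite wipC wip_l wipC [wip _ q']wipC. Qed.

Lemma wip_ge0 p : 0 <= wip p p.
Proof. by rewrite /wip -mulrA -expr2 pint_rhoX_sqr_ge0. Qed.

Lemma wip_pos_def p : wip p p = 0 -> p = 0.
Proof. by rewrite /wip -mulrA -expr2; exact: pint_pos_def. Qed.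

Lemma wip_gt0 p : p != 0 -> 0 < wip p p.
Proof.
by move=> p0; rewrite lt_def wip_ge0 andbT; apply: contra p0 => /eqP/wip_pos_def ->.
Qed.

Lemma aform_tform p q : aform p q = tform m (rho ^+ m * p) (rho ^+ m * q).
Proof. by rewrite /aform /wip /tform /kop -scalerAr pintZ. Qed.

Lemma aformC p q : aform p q = aform q p.
Proof. by rewrite !aform_tform tform_sym//; [exists p|exists q]. Qed.

Lemma aform_l c p p' q : aform (c *: p + p') q = c * aform p q + aform p' q.
Proof. exact: wip_l. Qed.

Lemma aform_r c p q q' : aform p (c *: q + q') = c * aform p q + aform p q'.
Proof. by rewrite /aform linearP wip_r. Qed.

Lemma kop_sym p q : wip (kop p) q = wip p (kop q).
Proof. by rewrite wipC -/(aform q p) aformC. Qed.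

Lemma aform_ge0 p : 0 <= aform p p.
Proof.
rewrite aform_tform; have rp : rdiv m (rho ^+ m * p) by exists p.
have := @tform_bound R d (nseq m (Ordinal d0)) (rho ^+ m * p).
rewrite size_nseq => /(_ rp); apply: le_trans.
by apply: pint_ge0 => x _; rewrite evX sqr_ge0.
Qed.

Section orthogonal.
Variables (a b : nat).

(** The bound [b] makes the space finite-dimensional, so that minimisers exist, while the constant
    in [orth_bound] depends on [a] alone. *)
Definition orth p := degs (fun k => k < b)%N p /\
  forall q, degs (fun k => k < a)%N q -> wip p q = 0.

(** Symmetry moves [kop] onto the test polynomial, whose degree it does not raise. *)
Lemma orth_kop p : orth p -> orth (kop p).
Proof.
move=> [pb pa]; split; first exact: degs_kop.
by move=> q qa; rewrite kop_sym pa//; exact: degs_kop.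
Qed.

Lemma orthL c p q : orth p -> orth q -> orth (c *: p + q).
Proof.
move=> [pb pa] [qb qa]; split; first by apply: degsD => //; exact: degsZ.
by move=> r ra; rewrite wip_l pa// qa// mulr0 addr0.
Qed.

Local Notation n := #|{: bmultinom d b}|.

Lemma pol_linear c (x y : 'rV[R]_n) : pol (c *: x + y) = c *: pol x + pol y.
Proof.
rewrite /pol scaler_sumr -big_split; apply: eq_bigr => i _ /=.
by rewrite !mxE scalerDl scalerA.
Qed.

Lemma pol0 : pol (0 : 'rV[R]_n) = 0.
Proof. by rewrite /pol big1// => i _; rewrite mxE scale0r. Qed.

Lemma bilin_cont (beta : MP -> MP -> R) :
  (forall c p p' q, beta (c *: p + p') q = c * beta p q + beta p' q) ->
  (forall c p q q', beta p (c *: q + q') = c * beta p q + beta p q') ->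
  continuous (fun c : 'rV[R]_n => beta (pol c) (pol c)).
Proof.
move=> bl br; rewrite (_ : (fun c => _) = (fun c : 'rV[R]_n =>
    \sum_i \sum_j (c ord0 i * (c ord0 j * beta (mon R i) (mon R j))))); last first.
  apply/funext => c; rewrite {1}/pol (beta_suml bl); apply: eq_bigr => i _.
  by rewrite /pol (beta_sumr br) mulr_sumr.
apply: sum_cont => i; apply: sum_cont => j x.
exact: (cvgM (@coord_cont R _ i x) (cvgM (@coord_cont R _ j x) (cvg_cst _))).
Qed.

Lemma lin_cont (ell : MP -> R) : (forall c p q, ell (c *: p + q) = c * ell p + ell q) ->
  continuous (fun c : 'rV[R]_n => ell (pol c)).
Proof.
move=> eL; have e0 : ell 0 = 0 by have := eL (-1) 0 0; rewrite scaler0 addr0 mulN1r addNr.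
rewrite (_ : (fun c => _) = (fun c : 'rV[R]_n => \sum_i (c ord0 i * ell (mon R i)))); last first.
  apply/funext => c; rewrite /pol.
  by elim: (index_enum _) => [|i r IH]; [rewrite !big_nil|rewrite !big_cons eL IH].
apply: sum_cont => i x; exact: (cvgM (@coord_cont R _ i x) (cvg_cst _)).
Qed.

(** The Rayleigh quotient is homogeneous of degree 0, so it is minimised on the Euclidean sphere of
    coefficient vectors, cut by the closed conditions of orthogonality; that set is compact. *)
Lemma orth_minimizer : (exists2 p, orth p & p != 0) ->
  exists p0 la, [/\ orth p0, p0 != 0, aform p0 p0 = la * wip p0 p0 &
    forall p, orth p -> la * wip p p <= aform p p].
Proof.
case=> p1 op1 p10.
pose S : set 'rV[R]_n := [set c | sqn c = 1] `&`
  \bigcap_(q in [set q | degs (fun k => k < a)%N q]) [set c | wip (pol c) q = 0].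
have S_orth c : S c -> orth (pol c).
  by move=> [_ Sc]; split; [exact: degs_pol|exact: Sc].
have S_neq0 c : S c -> pol c != 0.
  move=> [c1 _]; apply/eqP => /pol_inj c0; move: c1; rewrite c0 /sqn /= big1 => [/eqP|i _].
    by rewrite eq_sym oner_eq0.
  by rewrite mxE expr0n.
have normalize p : orth p -> p != 0 -> exists2 t, t != 0 & exists2 c, S c & t *: p = pol c.
  move=> op p0; have [c pE] := polP op.1.
  have c0 : sqn c != 0.
    apply: contra p0 => /eqP c0; rewrite pE (_ : c = 0) ?pol0//.
    apply/rowP => i; rewrite mxE; apply/eqP; rewrite -sqrf_eq0; apply/eqP.
    exact: (@psumr_eq0P R _ xpredT (fun i => c ord0 i ^+ 2) (fun i _ => sqr_ge0 _) c0).
  have cp : 0 < sqn c by rewrite lt_def c0 sumr_ge0// => i _; exact: sqr_ge0.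
  pose t := (Num.sqrt (sqn c))^-1.
  have t0 : t != 0 by rewrite invr_eq0 sqrtr_eq0 -ltNge.
  have tcE : t *: p = pol (t *: c) by rewrite -[t *: c]addr0 pol_linear pol0 addr0 pE.
  exists t => //; exists (t *: c) => //; split.
    rewrite /= /sqn; under eq_bigr do rewrite mxE exprMn.
    by rewrite -mulr_sumr /t exprVn sqr_sqrtr ?ltW// mulVf.
  move=> q qa /=; rewrite -tcE -[t *: p]addr0 wip_l op.2// mulr0 add0r.
  by rewrite /wip mulr0 mul0r raddf0.
have [t0 _ [c1 Sc1 _]] := normalize _ op1 p10.
have cS : compact S.
  apply: bounded_closed_compact.
    exists 1; split; first exact: num_real.
    move=> M M1 c [c1' _]; apply: le_trans (ltW M1).
    rewrite /Num.norm /= mx_normrE; apply: bigmax_le => // -[i j] _; rewrite !ord1 /=.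
    rewrite -(@ler_pXn2r _ 2) ?nnegrE// expr1n real_normK ?num_real//.
    by rewrite -c1' /sqn (bigD1 j)//= lerDl sumr_ge0// => k _; exact: sqr_ge0.
  apply: closedI.
    rewrite (_ : [set c | _] = @sqn R n @^-1` [set 1]); last by [].
    by apply: closed_comp => [c _|]; [exact: sqn_cont|exact: closed_eq].
  apply: closed_bigI => q _.
  rewrite (_ : [set c | _] = (fun c : 'rV[R]_n => wip (pol c) q) @^-1` [set 0]); last by [].
  apply: closed_comp => [c _|]; last exact: closed_eq.
  by apply: (@lin_cont (wip^~ q)) => s p p'; exact: wip_l.
pose F (c : 'rV[R]_n) := aform (pol c) (pol c) / wip (pol c) (pol c).
have [||c0] := @EVT_min_rV R n F S _ cS.
- by exists c1.
- apply: continuous_in_subspaceT => c; rewrite inE => Sc.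
  have w0 : wip (pol c) (pol c) != 0 by rewrite gt_eqF// wip_gt0// S_neq0.
  have ca := bilin_cont aform_l aform_r; have cw := bilin_cont wip_l wip_r.
  have := cvgM (ca c) (cvgV w0 (cw c)); exact.
move=> /set_mem Sc0 Fmin; exists (pol c0), (F c0); split.
- exact: S_orth.
- exact: S_neq0.
- by rewrite /F divfK// gt_eqF// wip_gt0// S_neq0.
move=> p op; have [->|p0] := eqVneq p 0.
  by rewrite /aform /wip linear0 !mulr0 raddf0 mulr0.
have [t tn0 [c Sc tE]] := normalize _ op p0.
have w0 : 0 < wip p p by rewrite wip_gt0.
have := Fmin c (mem_set Sc); rewrite {2}/F -tE.
rewrite (betaZ aform_l aform_r) (betaZ wip_l wip_r) -mulf_div divff ?mul1r.
  by rewrite ler_pdivlMr.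
by rewrite sqrf_eq0.
Qed.

(** A minimiser of the Rayleigh quotient on this invariant space is an eigenvector of [kop];
    [kop_eigenvalue] then bounds its eigenvalue through its degree, which cannot be below [a]. *)
Lemma orth_bound p : orth p -> (\prod_(j < m) gam R d a j) * wip p p <= aform p p.
Proof.
move=> op; have [->|pn0] := eqVneq p 0.
  by rewrite /aform /wip linear0 !mulr0 raddf0 mulr0.
case: orth_minimizer; first by exists p.
move=> p0 [la] [P0 p00 E H].
apply: le_trans (H _ op); rewrite ler_wpM2r ?wip_ge0//.
(* First variation: g is nonnegative and vanishes at p0, so g(t p0 + q) is affine in t; a nonzero
   slope would produce the value -1. *)
have gE q : orth q -> aform p0 q = la * wip p0 q.
  move=> oq; pose g u v := aform u v - la * wip u v.
  have gpos t : 0 <= g (t *: p0 + q) (t *: p0 + q) by rewrite /g subr_ge0; exact: H (orthL _ P0 oq).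
  have gl (s : R) u v w : g (s *: u + v) w = s * g u w + g v w.
    rewrite /g aform_l wip_l; move: (aform u w) (wip u w) (aform v w) (wip v w) => *; ring.
  have gr (s : R) u v w : g u (s *: v + w) = s * g u v + g u w.
    rewrite /g aform_r wip_r; move: (aform u w) (wip u w) (aform u v) (wip u v) => *; ring.
  have gexp t : g (t *: p0 + q) (t *: p0 + q) = 2 * t * g p0 q + g q q.
    rewrite -[q in LHS]scale1r (beta_comb gl gr) (_ : g p0 p0 = 0); last by rewrite /g E subrr.
    rewrite (_ : g q p0 = g p0 q); last by rewrite /g aformC wipC.
    by move: (g p0 q) (g q q) => *; ring.
  have gqq : 0 <= g q q by rewrite subr_ge0 H.
  apply/eqP; rewrite -subr_eq0 -/(g p0 q); apply/negP => /negP g0.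
  have := gpos (- (g q q + 1) / (2 * g p0 q)); rewrite gexp.
  move: (g p0 q) (g q q) g0 => u v u0.
  have -> : 2 * (- (v + 1) / (2 * u)) * u = - (v + 1) by field.
  by move=> ?; lra.
(* The residual lies in the invariant space, where [gE] makes it orthogonal to everything, itself
   included. *)
have oz : orth (- la *: p0 + kop p0) by exact: (orthL _ P0 (orth_kop P0)).
have : wip (- la *: p0 + kop p0) (- la *: p0 + kop p0) = 0.
  by rewrite wip_l kop_sym -/(aform _ _) gE// mulNr addNr.
move/wip_pos_def => /eqP; rewrite scaleNr addrC subr_eq0 => /eqP kE.
have [N pN] := kop_eigenvalue p00 kE.
apply: le_trans; apply: prod_gam_mono.
(* If N < a, then p0 has degree below a and is orthogonal to itself. *)
rewrite leqNgt; apply/negP => Na; move/eqP: p00; apply.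
apply: wip_pos_def; apply: P0.2; apply: degsS pN => k kN.
exact: leq_ltn_trans kN Na.
Qed.

End orthogonal.

Lemma aform_lower p : (\prod_(j < m) gam R d 0 j) * wip p p <= aform p p.
Proof.
apply: (@orth_bound 0 (msize p)); split; first by move=> k; exact: msize_mdeg_lt.
by move=> q /degs_lt0 ->; rewrite /wip mulr0 raddf0.
Qed.

(** The Dirichlet problem with polynomial data has a polynomial solution. The weak equation is
    solved in degrees below that of f plus one; [kop p - f] stays in this range, so it is orthogonal
    to itself. *)
Lemma kop_surj f : exists p, kop p = f.
Proof.
pose b := msize f; have fb : degs (fun a => a < b)%N f by move=> k; exact: msize_mdeg_lt.
have [p pb ap|c p q|p pb pE] := @finite_representation R d b aform (wip f) aform_l aform_r.
- apply: wip_pos_def; apply/eqP; rewrite eq_le wip_ge0 andbT.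
  by rewrite -(pmulr_rle0 _ (prod_gam_gt0 R m 0 d0)) -ap aform_lower.
- exact: wip_r.
exists p; apply/eqP; rewrite -subr_eq0; apply/eqP; apply: wip_pos_def.
set z := kop p - f; have zb : degs (fun a => a < b)%N z.
  by apply: degsD; [exact: degs_kop|exact: degsN].
have -> : wip z z = wip (kop p) z - wip f z.
  by rewrite {1}/z -scaleN1r addrC wip_l mulN1r addrC.
by rewrite kop_sym -/(aform p z) pE// subrr.
Qed.

Lemma proj_exists a p : exists2 p0, degs (fun k => k < a)%N p0 &
  forall q, degs (fun k => k < a)%N q -> wip p0 q = wip p q.
Proof.
apply: (finite_representation wip_l wip_r) => [q _|c q q']; first exact: wip_pos_def.
exact: wip_r.
Qed.

End tail_estimate.

(** * The extremal constant and its maximising sequences *)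

Section maximizing_sequence.
Context (R : realType) (d m : nat).
Hypothesis d0 : (0 < d)%N.
Local Notation MP := (mpoly d R).
Local Notation rho := (rho R d).
Local Notation kop := (@kop R d m).
Local Notation wip := (@wip R d m).
Local Notation aform := (@aform R d m).
Implicit Types (p q f : MP).

Definition ksq p : R := pint (kop p ^+ 2).
Definition wsq p : R := pint ((rho ^+ m * p) ^+ 2).
Definition cst_lower : R := \prod_(j < m) gam R d 0 j.

Lemma cst_lower_gt0 : 0 < cst_lower.
Proof. exact: prod_gam_gt0. Qed.

Lemma ksq_ge0 p : 0 <= ksq p.
Proof. by apply: pint_ge0 => x _; rewrite evX sqr_ge0. Qed.

Lemma wsq_ge0 p : 0 <= wsq p.
Proof. by apply: pint_ge0 => x _; rewrite evX sqr_ge0. Qed.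

Lemma wsq_le_wip p : wsq p <= wip p p.
Proof.
apply: pint_le => x Bx; rewrite !(evX, evM) exprMn -mulrA -expr2 ler_wpM2r ?sqr_ge0//.
have r0 := rho_ge0 Bx; rewrite expr2 ler_piMr ?exprn_ge0//.
by rewrite exprn_ile1// rho_le1.
Qed.

Lemma pint_CS0 p q : pint (p * q) ^+ 2 <= pint (p ^+ 2) * pint (q ^+ 2).
Proof. by have := pint_CS 0 p q; rewrite !expr0 !mul1r. Qed.

Lemma aformE p q : aform p q = pint ((rho ^+ m * p) * kop q).
Proof. by []. Qed.

Lemma aform_CS p q : aform p q ^+ 2 <= aform p p * aform q q.
Proof.
by apply: (beta_CS (@aform_l R d m) (@aform_r R d m)); [exact: aformC|exact: aform_ge0].
Qed.

(** Cauchy-Schwarz bounds the square of the energy by [wsq p * ksq p], and [cst_lower * wsq p] is at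
    most the energy; one factor cancels. *)
Lemma aform_le_ksq p : aform p p <= ksq p / cst_lower.
Proof.
have c0 := cst_lower_gt0; have a0 := aform_ge0 m d0 p.
have h1 : aform p p ^+ 2 <= wsq p * ksq p by rewrite aformE; exact: pint_CS0.
have h2 : cst_lower * wsq p <= aform p p.
  by apply: le_trans (aform_lower m p); apply: ler_wpM2l; [exact: ltW|exact: wsq_le_wip].
have k0 := ksq_ge0 p; have w0 := wsq_ge0 p.
rewrite ler_pdivlMr//.
move: (aform p p) (ksq p) (wsq p) a0 k0 w0 h1 h2 => a k w a0 k0 w0 h1 h2.
have [->|an] := eqVneq a 0; first by rewrite mul0r.
have ap : 0 < a by rewrite lt_def an.
rewrite -(ler_pM2l ap) mulrA -expr2.
apply: (@le_trans _ _ (w * k * cst_lower)); first by rewrite ler_wpM2r// ltW.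
by rewrite mulrAC mulrC [w * _]mulrC mulrC ler_wpM2r.
Qed.

Lemma kop_inj p : kop p = 0 -> p = 0.
Proof.
move=> kp; apply: (@wip_pos_def R d m); apply/eqP; rewrite eq_le wip_ge0 andbT.
rewrite -(pmulr_rle0 _ cst_lower_gt0); apply: le_trans (aform_lower m p) _.
by rewrite aformE kp mulr0 raddf0.
Qed.

Lemma ksq_gt0 p : p != 0 -> 0 < ksq p.
Proof.
move=> p0; rewrite lt_def ksq_ge0 andbT; apply: contra p0 => /eqP k0.
apply/eqP/kop_inj/(@pint_pos_def R d 0); rewrite expr0 mul1r; exact: k0.
Qed.

Lemma ksqZ c p : ksq (c *: p) = c ^+ 2 * ksq p.
Proof. by rewrite /ksq linearZ /= exprZn pintZ. Qed.

Lemma aformZ c p : aform (c *: p) (c *: p) = c ^+ 2 * aform p p.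
Proof.
exact: (betaZ (@aform_l R d m) (@aform_r R d m)).
Qed.

Lemma normalize_ksq p : p != 0 -> exists2 c, c != 0 & ksq (c *: p) = 1.
Proof.
move=> /ksq_gt0 k0; exists (Num.sqrt (ksq p))^-1; first by rewrite invr_eq0 sqrtr_eq0 -ltNge.
by rewrite ksqZ exprVn sqr_sqrtr ?ltW// mulVf// gt_eqF.
Qed.

(* The supremum of this set is the inverse of the first eigenvalue: for w = rho^m p
   the quotient aform p p / ksq p compares <w, (-Delta)^m w> with |(-Delta)^m w|^2. *)
Definition gset : set R := [set r | exists2 p, ksq p = 1 & r = aform p p].
Definition gsup : R := sup gset.

Lemma one_neq0 : (1 : MP) != 0.
Proof. exact: oner_neq0. Qed.

Lemma gset_has_sup : has_sup gset.
Proof.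
split.
  have [c _ k1] := normalize_ksq one_neq0.
  by exists (aform (c *: 1) (c *: 1)); exists (c *: 1).
by exists cst_lower^-1 => r [p k1 ->]; have := aform_le_ksq p; rewrite k1 mul1r.
Qed.

Lemma gsup_ub p : aform p p <= gsup * ksq p.
Proof.
have [->|p0] := eqVneq p 0.
  by rewrite aformE /ksq linear0 mulr0 expr0n raddf0 mulr0.
have [c c0 k1] := normalize_ksq p0.
have := ub_le_sup (proj2 gset_has_sup); rewrite -/gsup => /(_ (aform (c *: p) (c *: p))).
rewrite aformZ => H; have {H} H : c ^+ 2 * aform p p <= gsup by apply: H; exists (c *: p); rewrite ?aformZ.
have c2 : 0 < c ^+ 2 by rewrite exprn_even_gt0.
rewrite -(ler_pM2l c2); apply: le_trans H _.
by rewrite mulrCA -ksqZ k1 mulr1.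
Qed.

Lemma gsup_le : gsup <= cst_lower^-1.
Proof.
apply: ge_sup; first exact: (proj1 gset_has_sup).
by move=> r [p k1 ->]; have := aform_le_ksq p; rewrite k1 mul1r.
Qed.

Lemma aform_gt0 p : p != 0 -> 0 < aform p p.
Proof.
move=> p0; apply: lt_le_trans (aform_lower m p).
by rewrite mulr_gt0 ?cst_lower_gt0// wip_gt0.
Qed.

Lemma gsup_gt0 : 0 < gsup.
Proof.
by rewrite -(pmulr_lgt0 _ (ksq_gt0 one_neq0)) (lt_le_trans (aform_gt0 one_neq0))// gsup_ub.
Qed.

(** Duality: if p' solves [kop p' = rho^m p], then [wsq p] is both [aform p p'] and [ksq p'].
    Cauchy-Schwarz for the energy and the definition of [gsup] applied to p' leave the claim after
    cancelling [wsq p]. *)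
Lemma wsq_le_aform p : wsq p <= gsup * aform p p.
Proof.
have [p' p'E] := kop_surj m d0 (rho ^+ m * p).
have wE : wsq p = aform p p' by rewrite aformE p'E /wsq expr2.
have kE : ksq p' = wsq p by rewrite /ksq p'E.
have w0 := wsq_ge0 p; have [->|wn] := eqVneq (wsq p) 0.
  by apply: mulr_ge0; [exact/ltW/gsup_gt0|exact: aform_ge0].
have wp : 0 < wsq p by rewrite lt_def wn.
rewrite -(ler_pM2l wp) -expr2 {1}wE; apply: le_trans (aform_CS p p') _.
rewrite mulrC [leRHS]mulrA ler_wpM2r ?aform_ge0//.
by rewrite mulrC -kE gsup_ub.
Qed.

Lemma wsq_le_ksq p : wsq p <= gsup ^+ 2 * ksq p.
Proof.
apply: le_trans (wsq_le_aform p) _.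
by rewrite expr2 -mulrA ler_wpM2l ?gsup_ub// ltW// gsup_gt0.
Qed.

(** Expanding the square and using [wsq_le_ksq], the defect is controlled by how far p is from
    maximising. Near-maximisers are thus near-eigenfunctions in L^2. *)
Lemma wsq_sub_ksq p :
  pint ((rho ^+ m * p - gsup *: kop p) ^+ 2) <= 2 * gsup * (gsup * ksq p - aform p p).
Proof.
have -> : pint ((rho ^+ m * p - gsup *: kop p) ^+ 2) =
    wsq p - 2 * gsup * aform p p + gsup ^+ 2 * ksq p.
  rewrite aformE /wsq /ksq -!pintZ -pintB -pintD; congr pint.
  rewrite sqrrB exprZn; congr (_ - _ + _).
  by rewrite -scalerAr -mulr_natl -!mul_mpolyC rmorphM /= rmorph_nat; ring.
have := wsq_le_ksq p; move: (wsq p) (ksq p) (aform p p) gsup => w k a g H.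
by rewrite (_ : 2 * g * (g * k - a) = g ^+ 2 * k - 2 * g * a + g ^+ 2 * k); [lra|ring].
Qed.

Lemma gsup_approx (n : nat) : {p | ksq p = 1 & gsup - n.+1%:R^-1 < aform p p}.
Proof.
have n0 : 0 < (n.+1%:R^-1 : R) by rewrite invr_gt0 ltr0n.
apply/cid2; have [r [p k1 rE] h] := sup_adherent n0 gset_has_sup.
by exists p => //; rewrite -rE.
Qed.

Lemma aform_subadd p q : aform (p - q) (p - q) <= 2 * aform p p + 2 * aform q q.
Proof.
by apply: (beta_sub (@aform_l R d m) (@aform_r R d m)); exact: aform_ge0.
Qed.

(** As [kop] preserves degrees below a, the projection p0 and the tail p - p0 are orthogonal for the
    energy too, so [orth_bound] on the tail costs at most the energy of p. *)
Lemma wip_split a p : exists p0, [/\ degs (fun k => k < a)%N p0,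
  (forall q, degs (fun k => k < a)%N q -> wip p0 q = wip p q) &
  (\prod_(j < m) gam R d a j) * (wip p p - wip p0 p0) <= aform p p].
Proof.
have [p0 p0a p0E] := proj_exists m a p; exists p0; split => //.
have [b pb] : exists b, degs (fun k => k < b)%N (p - p0).
  by exists (msize (p - p0)) => k; exact: msize_mdeg_lt.
have sub q : wip (p - p0) q = wip p q - wip p0 q.
  by rewrite -scaleN1r addrC wip_l mulN1r addrC.
have o : orth m a b (p - p0).
  by split => // q qa; rewrite sub// p0E// subrr.
have pp0 : p = 1 *: p0 + (p - p0) by rewrite scale1r addrC subrK.
have -> : wip p p - wip p0 p0 = wip (p - p0) (p - p0).
  rewrite sub [wip p (p - p0)]wipC [wip p0 (p - p0)]wipC !sub [wip p0 p]wipC -(p0E p0)//.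
  by rewrite subrr subr0.
apply: le_trans (orth_bound o) _; rewrite [in leRHS]pp0 aform_l !aform_r.
rewrite [aform p0 (p - p0)]aformC.
have -> : aform (p - p0) p0 = 0 by apply: o.2; exact: degs_kop.
by rewrite !mul1r !addr0 add0r lerDr aform_ge0.
Qed.

Lemma wip_CS p q : wip p q ^+ 2 <= wip p p * wip q q.
Proof.
have := pint_CS m p q.
by rewrite !expr2 !mulrA.
Qed.

(** Makes smallness of the projection a matter of finitely many linear functionals of p: the v_i are
    the monomials, and the u_i represent the coefficient functionals. *)
Lemma wip_proj_sum a : exists (n : nat) (u v : 'I_n -> MP), forall p p0,
  degs (fun k => k < a)%N p0 ->
  (forall q, degs (fun k => k < a)%N q -> wip p0 q = wip p q) ->
  wip p0 p0 = \sum_i wip p (u i) * wip p (v i).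
Proof.
pose n := #|{: bmultinom d a}|.
have rep (i : 'I_n) : {r | degs (fun k => k < a)%N r &
    forall q, degs (fun k => k < a)%N q -> wip r q = mcoeff (bmnm (enum_val i)) q}.
  apply: cid2; apply: (finite_representation (@wip_l R d m) (@wip_r R d m)).
    by move=> q _; exact: wip_pos_def.
  by move=> c q q'; rewrite mcoeffD mcoeffZ.
pose u i := s2val (rep i); exists n, u, (@mon R d a) => p p0 p0a p0E.
have [c cE] := polP p0a; rewrite {2}cE /pol (beta_sumr (@wip_r R d m)).
apply: eq_bigr => i _; rewrite p0E; last exact: degs_mon.
congr (_ * _); rewrite -p0E; last exact: (s2valP (rep i)).
by rewrite wipC (s2valP' (rep i))// cE mcoeff_pol.
Qed.

(* This replaces Rellich's theorem: the component of p orthogonal to the polynomials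
   of low degree is small by orth_bound, and the remaining component lives in a
   finite-dimensional space, where limits are taken along an ultrafilter. *)
Lemma compact_subsequence : (0 < m)%N -> forall (p : nat -> MP) (C : R),
  (forall n, aform (p n) (p n) <= C) ->
  exists phi : nat -> nat, (forall k, k <= phi k)%N /\
    forall N k l, (N <= k)%N -> (N <= l)%N ->
      wip (p (phi k) - p (phi l)) (p (phi k) - p (phi l)) <= N.+1%:R^-1.
Proof.
move=> m0 p C pC.
have C0 : 0 <= C by apply: le_trans (pC 0%N); exact: aform_ge0.
have [U [UU sU]] := @ultraFilterLemma _ \oo _.
have UF : ProperFilter U by exact: ultra_proper.
have wb n : wip (p n) (p n) <= C / cst_lower.
  rewrite ler_pdivlMr ?cst_lower_gt0// mulrC; exact: le_trans (aform_lower m _) (pC n).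
(* The bounded real sequence [wip (p n) q] converges along the ultrafilter U; S is where it is
   within e/2 of its limit. *)
have D q (e : R) : 0 < e -> exists2 S, U S & forall n n', S n -> S n' -> `|wip (p n - p n') q| <= e.
  move=> e0; pose f n := wip (p n) q; pose M := Num.sqrt (C / cst_lower * wip q q).
  have fM n : f n \in `[- M, M].
    rewrite in_itv /= -ler_norml /f -sqrtr_sqr ler_wsqrtr//.
    by apply: le_trans (wip_CS _ _) _; rewrite ler_wpM2r ?wip_ge0.
  have cM : compact `[- M, M] by exact: segment_compact.
  have [|l [_ fl]] := cM (f @ U) (fmap_proper_filter f UF); first by apply: (@filterS _ U _ setT) => [n _|]; [exact: fM n|exact: filterT].
  exists [set n | ball l (e / 2) (f n)].
    have [//|US] := in_ultra_setVsetC [set n | ball l (e / 2) (f n)] UU.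
    have [] := fl (~` ball l (e / 2)) (ball l (e / 2)) US; last by move=> x [].
    exact: nbhsx_ballx (divr_gt0 _ _).
  move=> n n'; rewrite /ball /= => h h'.
  have -> : wip (p n - p n') q = f n - f n' by rewrite -scaleN1r addrC wip_l mulN1r addrC.
  move: (f n) (f n') h h' => r r' h h'; have -> : r - r' = - (l - r) + (l - r') by ring.
  by apply: le_trans (ler_normD _ _) _; rewrite normrN [leRHS]splitr; apply: lerD; exact: ltW.
have E (e : R) : 0 < e -> exists2 S, U S & forall n n', S n -> S n' ->
    wip (p n - p n') (p n - p n') <= e.
  (* A difference has energy at most 4C, so its component orthogonal to degrees up to a has squared
     norm at most 4C/(a+1) <= e/2. *)
  move=> e0; have [a ae] : exists a : nat, 8 * C / e < a.+1%:R.
    exists (Num.bound (8 * C / e)); apply: lt_le_trans (archi_boundP _) _.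
      by apply: divr_ge0; [exact: mulr_ge0|exact: ltW].
    by rewrite ler_nat.
  have [n [u [v uv]]] := wip_proj_sum a.+1.
  (* Each of the n products has both factors at most e1 <= 1, hence is at most e1, and their sum is
     at most e/2; n + 1 keeps the divisor nonzero. *)
  pose e1 := Num.min 1 (e / (2 * n.+1%:R)).
  have e10 : 0 < e1 by rewrite lt_min ltr01 divr_gt0// mulr_gt0// ltr0n.
  pose S : set nat := [set k | forall i, (s2val (cid2 (D (u i) e1 e10)) `&` s2val (cid2 (D (v i) e1 e10))) k].
  have US : U S.
    apply: filter_forall => i; apply: filterI.
      exact: (s2valP (cid2 (D (u i) e1 e10))).
    exact: (s2valP (cid2 (D (v i) e1 e10))).
  exists S => // k k' Sk Sk'.
  set z := p k - p k'; have [z0 [z0a z0E z0b]] := wip_split a.+1 z.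
  have z1 : wip z0 z0 <= e / 2.
    rewrite (uv z z0)//; apply: (@le_trans _ _ (\sum_(i < n) e / (2 * n.+1%:R))).
      apply: ler_sum => i _; apply: le_trans (ler_norm _) _; rewrite normrM.
      have h1 := s2valP' (cid2 (D (u i) e1 e10)) k k' (Sk i).1 (Sk' i).1.
      have h2 := s2valP' (cid2 (D (v i) e1 e10)) k k' (Sk i).2 (Sk' i).2.
      have le1 : e1 <= 1 by rewrite ge_min lexx.
      apply: (@le_trans _ _ (1 * e1)); first by apply: ler_pM => //; exact: le_trans h1 le1.
      by rewrite mul1r ge_min lexx orbT.
    rewrite sumr_const card_ord -[leLHS]mulr_natr.
    apply: (@le_trans _ _ (e / (2 * n.+1%:R) * n.+1%:R)).
      by rewrite ler_wpM2l ?ler_nat// divr_ge0 ?mulr_ge0// ltW.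
    by rewrite invfM mulrA divfK ?pnatr_eq0.
  have z2 : wip z z - wip z0 z0 <= e / 2.
    have g0 : 0 < (a.+1%:R : R) by rewrite ltr0n.
    rewrite -(ler_pM2l g0).
    have zz : 0 <= wip z z - wip z0 z0.
      have := wip_ge0 m (1 *: z + -1 *: z0).
      rewrite (beta_comb (@wip_l R d m) (@wip_r R d m)) (wipC m z0 z) -(z0E z0)//.
      by move: (wip z z) (wip z0 z0) => *; lra.
    apply: (@le_trans _ _ (\prod_(j < m) gam R d a.+1 j * (wip z z - wip z0 z0))).
      by rewrite ler_wpM2r// prod_gam_ge.
    apply: le_trans z0b _; apply: le_trans (aform_subadd _ _) _.
    have : 4 * C <= a.+1%:R * (e / 2).
      by move: ae; rewrite ltr_pdivrMr// => /ltW; lra.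
    apply: le_trans.
    have := pC k; have := pC k'; move: (aform (p k) (p k)) (aform (p k') (p k')) => x y.
    by move=> ? ?; lra.
  by have := lerD z1 z2; rewrite -splitr addrC subrK.
have posk (k : nat) : 0 < (k.+1%:R^-1 : R) by rewrite invr_gt0 ltr0n.
pose S (k : nat) := s2val (cid2 (E _ (posk k))).
have SU k : U (S k) by exact: (s2valP (cid2 (E _ (posk k)))).
have SE k n n' : S k n -> S k n' -> wip (p n - p n') (p n - p n') <= k.+1%:R^-1.
  by exact: (s2valP' (cid2 (E _ (posk k))) n n').
(* Diagonal choice: finite intersections of members of U belong to U and so are inhabited. *)
have TU k : U [set n | (k <= n)%N /\ forall j, (j <= k)%N -> S j n].
  apply: filterI; first by apply: sU; exact: nbhs_infty_ge.
  elim: k => [|k IH]; first by apply: filterS (SU 0%N) => n Sn j; rewrite leqn0 => /eqP ->.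
  apply: filterS2 IH (SU k.+1) => n h1 h2 j; rewrite leq_eqVlt => /orP[/eqP ->//|].
  exact: h1.
have ex k : {n | (k <= n)%N /\ forall j, (j <= k)%N -> S j n}.
  by apply/cid; exact: (filter_ex (TU k)).
pose phi k := projT1 (ex k).
have phiP k : (k <= phi k)%N /\ forall j, (j <= k)%N -> S j (phi k) := projT2 (ex k).
exists phi; split => [k|N k l Nk Nl]; first exact: (phiP k).1.
by apply: SE; [exact: (phiP k).2|exact: (phiP l).2].
Qed.

Lemma cauchy_maximizing_sequence : exists p : nat -> MP, [/\ forall n, ksq (p n) = 1,
  forall n, gsup - n.+1%:R^-1 < aform (p n) (p n) &
  forall N k l, (N <= k)%N -> (N <= l)%N -> wsq (p k - p l) <= N.+1%:R^-1].
Proof.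
have [m0|m0] := posnP m; last first.
  pose p n := s2val (gsup_approx n).
  have [phi [phik phiE]] : exists phi : nat -> nat, (forall k, k <= phi k)%N /\
    forall N k l, (N <= k)%N -> (N <= l)%N ->
      wip (p (phi k) - p (phi l)) (p (phi k) - p (phi l)) <= N.+1%:R^-1.
    apply: (compact_subsequence m0 (C := gsup)) => n.
    by have := gsup_ub (p n); rewrite (s2valP (gsup_approx n)) mulr1.
  exists (p \o phi); split => [n|n|N k l Nk Nl] /=.
  - exact: (s2valP (gsup_approx _)).
  - apply: le_lt_trans (s2valP' (gsup_approx _)); rewrite lerD2l lerN2 lef_pV2 ?posrE ?ltr0n//.
    by rewrite ler_nat ltnS.
  - by apply: le_trans (wsq_le_wip _) _; exact: phiE.
(* For m = 0 there is no compactness, but [kop] is the identity: the quotient is constantly 1, and a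
   constant sequence is maximising. *)
have [c c0 k1] := normalize_ksq one_neq0.
exists (fun=> c *: 1); split => // [n|N k l _ _]; last first.
  by rewrite subrr /wsq mulr0 expr0n raddf0 invr_ge0.
have k0 p : kop p = p by rewrite /kop m0 !expr0 mul1r scale1r.
have -> : aform (c *: 1) (c *: 1) = 1.
  by rewrite -k1 aformE /ksq !k0 m0 expr0 mul1r expr2.
rewrite ltrBlDr; apply: le_lt_trans gsup_le _.
rewrite /cst_lower (_ : \prod_(j < m) _ = 1); first by rewrite invr1 ltrDl invr_gt0 ltr0n.
by apply: big1 => -[j jm]; exfalso; move: jm; rewrite m0.
Qed.

End maximizing_sequence.

(** * Square-integrable functions and moments *)

Section square_integrable.
Context (R : realType) (d : nat).
Local Notation MP := (mpoly d R).
Local Notation V := 'rV[R]_d.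
Local Notation mu := (lebesgue_rV R d).
Local Notation B := (unit_ball R d).
Local Notation bint := (@bint R d).
Local Notation bintegrable f := (mu.-integrable B (EFin \o f)).
Implicit Types (f g u v h : V -> R) (p q : MP).

Lemma quad_CS (a b c : R) : 0 <= c ->
  (forall s t : R, 0 <= s ^+ 2 * a + s * t * (2 * b) + t ^+ 2 * c) -> b ^+ 2 <= a * c.
Proof.
move=> c0 H; have [c00|cn] := eqVneq c 0; last first.
  have cp : 0 < c by rewrite lt_def cn.
  have := H c (- b); rewrite (_ : _ + _ + _ = c * (a * c - b ^+ 2)); last by ring.
  by rewrite pmulr_rge0// subr_ge0.
have [->|b0] := eqVneq b 0; first by rewrite c00 mulr0 expr0n.
have := H 1 (- (a + 1) / (2 * b)); rewrite c00 mulr0 addr0 expr1n !mul1r.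
have -> : - (a + 1) / (2 * b) * (2 * b) = - (a + 1) by field.
by move=> ?; lra.
Qed.

Lemma bintD f g : bintegrable f -> bintegrable g ->
  bint (fun x => f x + g x) = bint f + bint g.
Proof. by move=> If Ig; apply: RintegralD => //; exact: mB. Qed.

Lemma bintZ c f : bintegrable f -> bint (fun x => c * f x) = c * bint f.
Proof. by move=> If; apply: RintegralZl => //; exact: mB. Qed.

Lemma bint_int_lin c f g : bintegrable f -> bintegrable g ->
  bintegrable (fun x => c * f x + g x).
Proof.
move=> If Ig; rewrite (_ : EFin \o _ = ((fun x => c%:E * (f x)%:E) \+ (EFin \o g))%E)//.
by apply: integrableD; [exact: mB|apply: integrableZl => //; exact: mB|].
Qed.

Lemma bint_lin c f g : bintegrable f -> bintegrable g ->
  bint (fun x => c * f x + g x) = c * bint f + bint g.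
Proof.
move=> If Ig; rewrite bintD// ?bintZ//.
rewrite (_ : EFin \o _ = (fun x => c%:E * (f x)%:E)%E)//.
by apply: integrableZl => //; exact: mB.
Qed.

Lemma bint_ext f g : (forall x, B x -> f x = g x) -> bint f = bint g.
Proof. by move=> fg; apply: eq_Rintegral => x; rewrite inE; exact: fg. Qed.

Lemma bint_le f g : bintegrable f -> bintegrable g ->
  (forall x, B x -> f x <= g x) -> bint f <= bint g.
Proof. by move=> If Ig fg; apply: le_Rintegral => //; exact: mB. Qed.

Lemma bint_ge0 f : (forall x, B x -> 0 <= f x) -> 0 <= bint f.
Proof. by move=> f0; apply: Rintegral_ge0. Qed.

Lemma bint_ae f g : measurable_fun B f -> measurable_fun B g ->
  ae_eq mu B f g -> bint f = bint g.
Proof.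
move=> mf mg fg; congr fine; apply: ae_eq_integral.
- exact: mB.
- exact/measurable_EFinP.
- exact/measurable_EFinP.
- by apply: filterS fg => x fg Bx; rewrite /= fg.
Qed.

Lemma bint_dct (F : nat -> V -> R) f g : bintegrable g -> measurable_fun B f ->
  (forall n, measurable_fun B (F n)) ->
  (forall x, B x -> F n x @[n --> \oo] --> f x) ->
  (forall n x, B x -> `|F n x| <= g x) -> bint (F n) @[n --> \oo] --> bint f.
Proof.
move=> Ig mf mF Ff Fg.
have [|||||If _ cv] := @dominated_convergence _ _ _ mu B (@mB R d)
  (fun n => EFin \o F n) (EFin \o f) (EFin \o g).
- by move=> n; exact/measurable_EFinP.
- exact/measurable_EFinP.
- apply: aeW => x Bx; apply: cvg_EFin; first exact: nearW.
  exact: Ff.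
- exact: Ig.
- by apply: aeW => x n Bx /=; rewrite lee_fin Fg.
apply: fine_cvg; rewrite fineK; first exact: cv.
exact: (@integrable_fin_num _ _ _ mu B (@mB R d) (EFin \o f) If).
Qed.

Lemma L2_meas u : L2 B u -> measurable_fun B u.
Proof. by case. Qed.

Lemma L2_sqr_int u : L2 B u -> bintegrable (fun x => u x ^+ 2).
Proof.
move=> [mu' iu]; apply/integrableP; split.
  by apply/measurable_EFinP; exact: measurable_funX.
rewrite (_ : (\int[mu]_(x in B) _)%E = (\int[mu]_(x in B) ((u x) ^+ 2)%:E)%E)//.
by apply: eq_integral => x _ /=; rewrite ger0_norm// sqr_ge0.
Qed.

Lemma L2_mul_int u v : L2 B u -> L2 B v -> bintegrable (fun x => u x * v x).
Proof.
move=> Lu Lv; have Iu := L2_sqr_int Lu; have Iv := L2_sqr_int Lv.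
apply: (le_integrable (@mB R d) _ _ (bint_int_lin 1 Iu Iv)).
  by apply/measurable_EFinP; apply: measurable_funM; exact: L2_meas.
move=> x _ /=; rewrite lee_fin normrM mul1r.
rewrite [leRHS]ger0_norm ?addr_ge0 ?sqr_ge0// -(real_normK (num_real (u x))).
rewrite -(real_normK (num_real (v x))).
by have := normr_ge0 (u x); have := normr_ge0 (v x); move: `|u x| `|v x| => a b; nra.
Qed.

Lemma L2_lin c u v : L2 B u -> L2 B v -> L2 B (fun x => c * u x + v x).
Proof.
move=> Lu Lv; split.
  apply: measurable_funD; last exact: L2_meas.
  by apply: measurable_funM => //; exact: L2_meas.
have I : bintegrable (fun x => c ^+ 2 * u x ^+ 2 + (2 * c * (u x * v x) + v x ^+ 2)).
  apply: bint_int_lin (L2_sqr_int Lu) _.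
  exact: bint_int_lin (L2_mul_int Lu Lv) (L2_sqr_int Lv).
have /integrableP[_] := I; apply: le_lt_trans; rewrite le_eqVlt; apply/orP; left.
apply/eqP; apply: eq_integral => x _ /=; congr EFin.
rewrite ger0_norm; first by ring.
by rewrite (_ : _ + _ = (c * u x + v x) ^+ 2) ?sqr_ge0//; ring.
Qed.

Lemma L2_0 : L2 B (fun=> 0).
Proof.
split; first exact: measurable_cst.
by under eq_integral do rewrite expr0n; rewrite integral0 ltry.
Qed.

Lemma L2_Z c u : L2 B u -> L2 B (fun x => c * u x).
Proof.
move=> Lu; have := L2_lin c Lu L2_0; congr L2.
by apply/funext => x; rewrite addr0.
Qed.

Lemma L2_sub u v : L2 B u -> L2 B v -> L2 B (fun x => u x - v x).
Proof.
move=> Lu Lv; have := L2_lin (-1) Lv Lu; congr L2.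
by apply/funext => x; rewrite mulN1r addrC.
Qed.

Lemma L2_add u v : L2 B u -> L2 B v -> L2 B (fun x => u x + v x).
Proof.
move=> Lu Lv; have := L2_lin 1 Lu Lv; congr L2.
by apply/funext => x; rewrite mul1r.
Qed.

Lemma L2_sum (I : Type) (r : seq I) (F : I -> V -> R) :
  (forall i, L2 B (F i)) -> L2 B (fun x => \sum_(i <- r) F i x).
Proof.
move=> LF; elim: r => [|i r IH].
  by under eq_fun do rewrite big_nil; exact: L2_0.
by under eq_fun do rewrite big_cons; exact: L2_add.
Qed.

Lemma L2_cont f : continuous f -> L2 B f.
Proof.
move=> cf; split; first by apply: measurable_funTS; exact: continuous_measurable_rV.
have /integrableP[_] : bintegrable (fun x => f x * f x).
  by apply: cont_integrable => x; exact: (cvgM (cf x) (cf x)).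
apply: le_lt_trans; rewrite le_eqVlt; apply/orP; left; apply/eqP.
by apply: eq_integral => x _ /=; rewrite ger0_norm -?expr2// sqr_ge0.
Qed.

Lemma L2_ev p : L2 B (ev p).
Proof. exact/L2_cont/ev_cont. Qed.

Lemma L2_int u : L2 B u -> bintegrable u.
Proof.
move=> Lu; have := L2_mul_int Lu (L2_ev 1); congr (mu.-integrable B _).
by apply/funext => x /=; rewrite ev1 mulr1.
Qed.

Definition ip u v := bint (fun x => u x * v x).

Lemma ipC u v : ip u v = ip v u.
Proof. by apply: bint_ext => x _; rewrite mulrC. Qed.

Lemma ip_l c u v h : L2 B u -> L2 B v -> L2 B h ->
  ip (fun x => c * u x + v x) h = c * ip u h + ip v h.
Proof.
move=> Lu Lv Lh; rewrite /ip -bint_lin; [|exact: L2_mul_int|exact: L2_mul_int].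
by apply: bint_ext => x _; ring.
Qed.

Lemma ip_r c u v h : L2 B u -> L2 B v -> L2 B h ->
  ip h (fun x => c * u x + v x) = c * ip h u + ip h v.
Proof. by move=> Lu Lv Lh; rewrite ipC ip_l// ipC [ip v h]ipC. Qed.

Lemma ip_subl u v h : L2 B u -> L2 B v -> L2 B h ->
  ip (fun x => u x - v x) h = ip u h - ip v h.
Proof.
move=> Lu Lv Lh; rewrite -[RHS]addrC -mulN1r -ip_l//.
by apply: bint_ext => x _; ring.
Qed.

Lemma ip_subr u v h : L2 B u -> L2 B v -> L2 B h ->
  ip h (fun x => u x - v x) = ip h u - ip h v.
Proof. by move=> Lu Lv Lh; rewrite ipC ip_subl// ipC [ip v h]ipC. Qed.

Lemma ip_ge0 u : 0 <= ip u u.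
Proof. by apply: bint_ge0 => x _; rewrite -expr2 sqr_ge0. Qed.

Lemma ip_CS u v : L2 B u -> L2 B v -> ip u v ^+ 2 <= ip u u * ip v v.
Proof.
move=> Lu Lv; apply: quad_CS; first exact: ip_ge0.
move=> s t; have Ls := L2_Z s Lu; have Lt := L2_Z t Lv.
rewrite (_ : _ + _ = ip (fun x => s * u x + t * v x) (fun x => s * u x + t * v x)).
  exact: ip_ge0.
rewrite ip_l ?ip_r//; last exact: L2_lin.
have tl w : L2 B w -> ip (fun x => t * v x) w = t * ip v w.
  by move=> Lw; rewrite -bintZ; [apply: bint_ext => x _; ring|exact: L2_mul_int].
rewrite [ip u (fun x => t * v x)]ipC !tl// [ip v (fun x => t * v x)]ipC tl//.
by rewrite [ip v u]ipC; ring.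
Qed.

Lemma ip_sub u v : L2 B u -> L2 B v ->
  ip (fun x => u x - v x) (fun x => u x - v x) = ip u u - 2 * ip u v + ip v v.
Proof.
move=> Lu Lv; rewrite ip_subl ?ip_subr//; last exact: L2_sub.
by rewrite [ip v u]ipC; ring.
Qed.

Lemma ip_sub_le u v h : L2 B u -> L2 B v -> L2 B h ->
  ip (fun x => u x - v x) (fun x => u x - v x) <=
  2 * ip (fun x => u x - h x) (fun x => u x - h x) +
  2 * ip (fun x => h x - v x) (fun x => h x - v x).
Proof.
move=> Lu Lv Lh; have L1 := L2_sub Lu Lh; have L2' := L2_sub Lh Lv.
rewrite -subr_ge0.
set a := fun x => u x - h x; set b := fun x => h x - v x.
have -> : 2 * ip a a + 2 * ip b b - ip (fun x => u x - v x) (fun x => u x - v x) =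
    ip (fun x => a x - b x) (fun x => a x - b x).
  have -> : ip (fun x => u x - v x) (fun x => u x - v x) =
      ip (fun x => 1 * a x + b x) (fun x => 1 * a x + b x).
    by apply: bint_ext => x _; rewrite /a /b; ring.
  rewrite ip_sub// ip_l ?ip_r//; last exact: L2_lin.
  by rewrite [ip b a]ipC; ring.
exact: ip_ge0.
Qed.

Lemma ip_ev p q : ip (ev p) (ev q) = pint (p * q).
Proof. by apply: bint_ext => x _; rewrite evM. Qed.

Lemma ip_ae0 u : L2 B u -> ip u u = 0 -> ae_eq mu B u (cst 0).
Proof.
move=> Lu u0.
have mu2 : measurable_fun B (EFin \o (fun x => u x * u x)).
  by apply/measurable_EFinP; apply: measurable_funM; exact: L2_meas.
have I := L2_mul_int Lu Lu.
have : ae_eq mu B (EFin \o (fun x => u x * u x)) (cst 0%E).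
  apply/(ae_eq_integral_abs mu (@mB R d) mu2).
  rewrite (_ : (\int[mu]_(x in B) _)%E = (\int[mu]_(x in B) (u x * u x)%:E)%E).
    by rewrite -[LHS]fineK ?(integrable_fin_num (@mB R d) I)// -/(Rintegral mu B _) [Rintegral _ _ _]u0.
  by apply: eq_integral => x _ /=; rewrite ger0_norm -?expr2// sqr_ge0.
apply: filterS => x H Bx; have /eqP := H Bx.
by rewrite /= eqe mulf_eq0 orbb => /eqP.
Qed.

Lemma ip_aeq u v : L2 B u -> L2 B v -> ae_eq mu B u v ->
  forall h, L2 B h -> ip u h = ip v h.
Proof.
move=> Lu Lv uv h Lh; apply: bint_ae.
- by apply: measurable_funM; exact: L2_meas.
- by apply: measurable_funM; exact: L2_meas.
- by apply: filterS uv => x H Bx /=; rewrite H.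
Qed.

End square_integrable.

(** * Functions with vanishing polynomial moments *)

Section moment_problem.
Context (R : realType).

(** The exponent is tuned to the threshold 1/2: the product n 2^n y^n tends to 0 for y < 1/2 and is
    at least n for y >= 1/2. On [0, 1] these polynomials therefore tend to the indicator of y <
    1/2. *)
Definition step_poly (n : nat) (y : R) : R := (1 - y ^+ n) ^+ (n * 2 ^ n).

Lemma bernoulli_ge (x : R) (n : nat) : -1 <= x -> 1 + n%:R * x <= (1 + x) ^+ n.
Proof.
move=> x1; elim: n => [|n IH]; first by rewrite mul0r addr0 expr0.
have x10 : 0 <= 1 + x by lra.
have n0 : 0 <= (n%:R : R) by [].
rewrite exprS; apply: le_trans (ler_wpM2l x10 IH).
rewrite -natr1; move: (n%:R) n0 => k k0; nra.
Qed.

Lemma step_poly01 n (y : R) : 0 <= y <= 1 -> 0 <= step_poly n y <= 1.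
Proof.
move=> /andP[y0 y1]; have h : 0 <= 1 - y ^+ n <= 1.
  by rewrite subr_ge0 gerBl exprn_ge0// exprn_ile1.
by case/andP: h => h0 h1; rewrite exprn_ge0// exprn_ile1.
Qed.

(** Write r = s^2: Bernoulli's inequality for 1/s bounds n s^n, and the other factor s^n tends to
    0. *)
Lemma cvg_natM_expr (r : R) : 0 <= r < 1 -> n%:R * r ^+ n @[n --> \oo] --> (0 : R).
Proof.
move=> /andP[r0 r1]; have [->|rn0] := eqVneq r 0.
  by apply: cvg_near_cst; apply: nearW => -[|n]; rewrite ?mul0r// expr0n mulr0.
have rp : 0 < r by rewrite lt_def rn0.
pose s := Num.sqrt r; have s0 : 0 < s by rewrite sqrtr_gt0.
have s1 : s < 1 by rewrite -sqrtr1 ltr_sqrt.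
have rs : r = s * s by rewrite -expr2 sqr_sqrtr.
pose C := (s^-1 - 1)^-1; have C0 : 0 < s^-1 - 1 by rewrite subr_gt0 invf_gt1.
have nC n : n%:R * s ^+ n <= C.
  rewrite /C -[leRHS]mul1r ler_pdivlMr//.
  have nb : -1 <= s^-1 - 1 by lra.
  have := bernoulli_ge n nb; rewrite [1 + (s^-1 - 1)]addrC subrK.
  have sn0 : 0 < s ^+ n by rewrite exprn_gt0.
  rewrite exprVn -(ler_pM2r sn0) mulVf ?gt_eqF// mulrDl mul1r.
  by rewrite mulrAC; lra.
apply: (@squeeze_cvgr _ _ _ _ (fun=> 0) (fun n => C * s ^+ n)).
- apply: nearW => n; rewrite mulr_ge0 ?exprn_ge0//=.
  by rewrite rs exprMn mulrA ler_wpM2r// exprn_ge0// ltW.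
- exact: cvg_cst.
- rewrite -[X in _ --> X](mulr0 C); apply: cvgM; first exact: cvg_cst.
  by apply: cvg_expr; rewrite ger0_norm// ltW.
Qed.

Lemma cvg_step_poly (y : R) : 0 <= y <= 1 ->
  step_poly n y @[n --> \oo] --> (((y < 2^-1)%R : bool)%:R : R).
Proof.
move=> y01; have /andP[y0 y1] := y01; have [yh|yh] := ltP y 2^-1.
  apply: (@squeeze_cvgr _ _ _ _ (fun n => 1 - n%:R * (2 * y) ^+ n) (fun=> 1)).
  - apply: nearW => n; have /andP[_ ->] := step_poly01 n y01; rewrite andbT.
    have h : -1 <= - y ^+ n by rewrite lerN2 exprn_ile1.
    have := bernoulli_ge (n * 2 ^ n) h; apply: le_trans.
    by rewrite mulrN exprMn natrM natrX mulrA.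
  - rewrite -[X in _ --> X](subr0 1); apply: cvgB; first exact: cvg_cst.
    by apply: cvg_natM_expr; lra.
  - exact: cvg_cst.
apply: (@squeeze_cvgr _ _ _ _ (fun=> 0) (fun n => n.+1%:R^-1)).
- apply: nearW => n; have /andP[-> _] := step_poly01 n y01; rewrite /=.
  set u := y ^+ n; have u0 : 0 <= u by rewrite exprn_ge0.
  have u1 : u <= 1 by rewrite exprn_ile1.
  have nu : n%:R <= (n * 2 ^ n)%:R * u.
    rewrite natrM natrX -mulrA ler_peMr// -exprMn exprn_ege1//; lra.
  (* Since (1 - u)(1 + u) <= 1, the value of [step_poly] is at most the inverse of this power. *)
  have b : (n.+1%:R : R) <= (1 + u) ^+ (n * 2 ^ n).
    apply: le_trans (bernoulli_ge _ _); last by lra.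
    by rewrite -natr1 addrC lerD2l.
  rewrite -[leRHS]mul1r ler_pdivlMr ?ltr0n//.
  apply: (@le_trans _ _ (step_poly n y * (1 + u) ^+ (n * 2 ^ n))).
    by apply: ler_wpM2l => //; case/andP: (step_poly01 n y01).
  rewrite /step_poly -/u -exprMn exprn_ile1//; nra.
- exact: cvg_cst.
- exact: cvg_harmonic.
Qed.

Lemma cvg_prod_seq (I : Type) (r : seq I) (f : I -> nat -> R) (a : I -> R) :
  (forall i, f i n @[n --> \oo] --> a i) ->
  \prod_(i <- r) f i n @[n --> \oo] --> \prod_(i <- r) a i.
Proof.
move=> H; elim: r => [|i r IH].
  by rewrite big_nil; under eq_fun do rewrite big_nil; exact: cvg_cst.
by rewrite big_cons; under eq_fun do rewrite big_cons; exact: cvgM (H i) IH.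
Qed.

Context (d : nat).
Local Notation MP := (mpoly d R).
Local Notation V := 'rV[R]_d.
Local Notation mu := (lebesgue_rV R d).
Local Notation B := (unit_ball R d).
Local Notation bint := (@bint R d).
Implicit Types (h : V -> R) (p q : MP) (s : 'I_d -> R).

Definition quadrant s : set V := [set x | forall i, x ord0 i < s i].

(* For |s i| <= 1 and |x i| <= 1, the argument 1/2 + (x i - s i) / 4 lies in [0, 1],
   and it is < 1/2 exactly when x i < s i. *)
Definition quadrant_poly n s : MP :=
  \prod_i (1 - (mpolyC d (2^-1 - s i / 4) + 4^-1 *: var R i) ^+ n) ^+ (n * 2 ^ n).

Lemma ev_quadrant_poly n s (x : V) :
  ev (quadrant_poly n s) x = \prod_i step_poly n (2^-1 + (x ord0 i - s i) / 4).
Proof.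
rewrite /quadrant_poly /ev rmorph_prod; apply: eq_bigr => i _ /=.
rewrite -!/(ev _ x) evX evB ev1 evX evD evZ ev_var evC /step_poly.
by congr ((1 - _ ^+ _) ^+ _) => /=; field.
Qed.

Lemma measurable_coord_lt i (r : R) : measurable [set x : V | x ord0 i < r].
Proof.
have -> : [set x : V | x ord0 i < r] = setT `&` @rV_coord R d i @^-1` `]-oo, r[.
  by apply/seteqP; split=> [x xr|x [_]]; rewrite ?setTI /= in_itv.
by apply: measurable_rV_coord => //; exact: measurable_itv.
Qed.

Lemma measurable_quadrant s : measurable (quadrant s).
Proof.
have -> : quadrant s = \bigcap_(i in [set: 'I_d]) [set x : V | x ord0 i < s i].
  by apply/seteqP; split=> [x zx i _|x zx i]; [exact: zx|exact: (zx i I)].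
by apply: fin_bigcap_measurable => // i _; exact: measurable_coord_lt.
Qed.

Lemma measurable_sub_quadrants :
  (@measurable _ V) `<=` <<s [set X | exists s, X = quadrant s] >>.
Proof.
set G := [set X | _].
apply: smallest_sub; first exact: smallest_sigma_algebra.
move=> X; rewrite -bigcup_seq /= => -[i _ [Y mY <-]].
have sG : sigma_algebra setT <<s G >> by exact: smallest_sigma_algebra.
pose C : set (set R) := [set Z | <<s G >> (setT `&` @rV_coord R d i @^-1` Z)].
suff : (@measurable _ (measurableTypeR R)) `<=` C by exact.
have CS : sigma_algebra setT C.
  split => [|Z CZ|F CF]; rewrite /C /=.
  - by rewrite preimage_set0 setI0; case: sG.
  - rewrite setTD preimage_setC; case: sG => _ sC _; have := sC _ CZ.
    by rewrite !setTI setTD.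
  - rewrite preimage_bigcup setTI; case: sG => _ _ sU; apply: sU => n.
    by have := CF n; rewrite /C /= setTI.
have -> : (@measurable _ (measurableTypeR R)) = <<s @RGenInftyO.G R >> by exact: RGenInftyO.measurableE.
apply: smallest_sub => // _ [r ->]; rewrite /C /= setTI.
(* A half-space is exhausted by quadrants whose other bounds grow with n. *)
have -> : @rV_coord R d i @^-1` `]-oo, r[ =
    \bigcup_n quadrant (fun j => if j == i then r else n%:R).
  apply/seteqP; split=> x.
    rewrite /= in_itv /= => xr.
    pose M := \sum_j `|x ord0 j|; exists (Num.bound M) => //= j.
    case: eqP => [->//|_]; apply: le_lt_trans (archi_boundP _); last by apply: sumr_ge0 => k _.
    apply: le_trans (ler_norm _) _; rewrite /M (bigD1 j)//= lerDl.
    by apply: sumr_ge0 => k _.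
  by move=> [n _ /(_ i)]; rewrite eqxx /= in_itv.
case: sG => _ _ sU; apply: sU => n; apply: sub_sigma_algebra.
by exists (fun j => if j == i then r else n%:R).
Qed.

Variable h : V -> R.
Hypothesis Lh : L2 B h.
Hypothesis h_moments : forall p, bint (fun x => h x * ev p x) = 0.

Let Ih : mu.-integrable B (EFin \o (fun x => `|h x|)).
Proof.
have := integrable_abse (L2_int Lh); congr (mu.-integrable B _).
Qed.

Let Ih1 (Y : set V) : measurable Y ->
  mu.-integrable B (EFin \o (fun x => h x * \1_Y x)).
Proof.
move=> mY; apply: (le_integrable (@mB R d) _ _ Ih).
  apply/measurable_EFinP; apply: measurable_funM; first exact: L2_meas.
  exact: measurable_indic.
move=> x _ /=; rewrite lee_fin normrM normr_id -[leRHS]mulr1 ler_wpM2l// indicE.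
by case: (_ \in _); rewrite ?normr1 ?normr0.
Qed.

Lemma bint_quadrant s : bint (fun x => h x * \1_(quadrant s) x) = 0.
Proof.
(* Clamping keeps the arguments of [step_poly] in [0, 1]; as |x_i| < 1 on the open ball, it does not
   change the comparison with x_i. *)
pose s' i := Num.max (-1) (Num.min 1 (s i)).
have s'b i : -1 <= s' i <= 1.
  by rewrite /s' le_max lexx /= ge_max ge_min lexx /= andbT; lra.
have x1 (x : V) i : B x -> -1 < x ord0 i < 1.
  move=> Bx; rewrite -ltr_norml -(@ltr_pXn2r _ 2) ?nnegrE// expr1n real_normK ?num_real//.
  apply: le_lt_trans Bx; rewrite (bigD1 i)//= lerDl sumr_ge0// => j _; exact: sqr_ge0.
have ss' (x : V) i : B x -> (x ord0 i < s' i) = (x ord0 i < s i).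
  move=> /(@x1 x i)/andP[a b]; rewrite /s' lt_max lt_min b /=.
  by rewrite ltNge (ltW a).
have H : bint (fun x => h x * ev (quadrant_poly n s') x) @[n --> \oo] -->
    bint (fun x => h x * \1_(quadrant s) x).
  apply: (@bint_dct _ _ _ _ (fun x => `|h x|)) => //.
  - apply: measurable_funM; first exact: L2_meas.
    by apply: measurable_indic; exact: measurable_quadrant.
  - move=> n; apply: measurable_funM; first exact: L2_meas.
    by apply: L2_meas; exact: L2_ev.
  - move=> x Bx; apply: cvgM; first exact: cvg_cst.
    have -> : (\1_(quadrant s) x : R) = \prod_(i < d) (((2^-1 + (x ord0 i - s' i) / 4 < 2^-1)%R : bool)%:R : R).
      rewrite indicE; have [xs|xs] := boolP (x \in quadrant s).
        rewrite big1// => i _; have := set_mem xs i; rewrite -ss'// => xi.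
        by rewrite (_ : (_ < _) = true)//; lra.
      have /existsNP[i /negP xi] : ~ forall i, x ord0 i < s i by move=> H; move/negP: xs; apply; exact/mem_set.
      rewrite (bigD1 i)//= (_ : (_ < _) = false) ?mul0r//.
      by apply/negbTE; move: xi; rewrite -ss'// -!leNgt => xi; lra.
    under eq_fun do rewrite ev_quadrant_poly.
    apply: cvg_prod_seq => i.
    by apply: cvg_step_poly; have := s'b i; have := x1 x i Bx; lra.
  - move=> n x Bx; rewrite normrM -[leRHS]mulr1 ler_wpM2l//.
    rewrite ev_quadrant_poly normr_prod.
    apply: prodr_ile1 => i _; rewrite normr_ge0 /=.
    have /andP[a b] : 0 <= step_poly n (2^-1 + (x ord0 i - s' i) / 4) <= 1.
      by apply: step_poly01; have := s'b i; have := x1 x i Bx; lra.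
    by rewrite ger0_norm.
move: H; rewrite (_ : (fun n => bint _) = fun=> 0); last first.
  by apply/funext => n; rewrite h_moments.
by move=> H; apply: (cvg_unique _ H (cvg_cst 0)).
Qed.

(** Dynkin's theorem: the quadrants are stable under intersection and generate the sigma-algebra,
    and the sets over which h integrates to 0 form a lambda-system by dominated convergence. *)
Lemma bint_measurable (X : set V) : measurable X -> bint (fun x => h x * \1_X x) = 0.
Proof.
pose H : set (set V) := [set X | measurable X /\ bint (fun x => h x * \1_X x) = 0].
have mh (Y : set V) : measurable Y -> measurable_fun B (fun x => h x * \1_Y x).
  move=> mY; apply: measurable_funM; first exact: L2_meas.
  exact: measurable_indic.
have HT : H setT.
  split=> //; rewrite -[RHS](h_moments 1); apply: bint_ext => x _.
  by rewrite indicT ev1.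
have lam : lambda_system setT H.
  split => //.
  - move=> A C CA [mA A0] [mC C0]; split; first exact: measurableD.
    have := bint_lin (-1) (Ih1 mC) (Ih1 mA); rewrite A0 C0 mulr0 addr0 => <-.
    apply: bint_ext => x _; rewrite !indicE in_setD mulN1r.
    have [xC|xC] := boolP (x \in C); last by rewrite andbT mulr0 oppr0 add0r.
    by rewrite (_ : x \in A) ?mulr1 ?mulr0 ?addNr//; exact/mem_set/CA/set_mem.
  - move=> F ndF HF; have mF n : measurable (F n) by case: (HF n).
    split; first exact: bigcup_measurable.
    apply/esym; apply: (@cvg_unique _ (@Rhausdorff R) (bint (fun x => h x * \1_(F n) x) @[n --> \oo])).
      rewrite (_ : (fun n => _) = (fun=> 0)); last by apply/funext => n; case: (HF n).
      exact: cvg_cst.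
    apply: (@bint_dct _ _ _ _ (fun x => `|h x|)) => //.
    + by apply: mh; exact: bigcup_measurable.
    + by move=> n; exact: mh.
    + move=> x _; apply: cvgM; first exact: cvg_cst.
      rewrite indicE; have [/set_mem[n _ Fnx]|xF] := boolP (x \in \bigcup_n F n).
        apply: cvg_near_cst; exists n => // k /= nk; rewrite indicE mem_set//.
        by have /subsetPset := ndF _ _ nk; exact.
      apply: cvg_near_cst; apply: nearW => n; rewrite indicE.
      rewrite (_ : x \in F n = false)//; apply/negP => /set_mem Fnx; move/negP: xF; apply.
      by apply/mem_set; exists n.
    + move=> n x _; rewrite normrM -[leRHS]mulr1 ler_wpM2l// indicE.
      by case: (_ \in _); rewrite ?normr1 ?normr0.
move=> mX; suff : H X by case.
have Q : <<s [set X | exists s, X = quadrant s] >> `<=` H.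
  apply: lambda_system_subset lam _ _ => //.
  - move=> _ _ [s ->] [t ->]; exists (fun i => Num.min (s i) (t i)).
    apply/seteqP; split=> [x [xs xt] i|x xst]; first by rewrite lt_min xs xt.
    by split=> i; have := xst i; rewrite lt_min => /andP[].
  - by move=> _ [s ->]; split; [exact: measurable_quadrant|exact: bint_quadrant].
by apply: Q; exact: measurable_sub_quadrants.
Qed.

(** Density of polynomials in L^2(B), in dual form. The integral of |h| is split over the set where
    h is positive and its complement; both parts vanish. *)
Lemma moments_ae0 : ae_eq mu B h (cst 0).
Proof.
have mh : measurable_fun setT (h \_ B).
  exact: (proj1 (@measurable_restrictT _ _ V (measurableTypeR R) B h (@mB R d)) (L2_meas Lh)).
pose P : set V := [set x | 0 < (h \_ B) x].
have mP : measurable P.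
  rewrite (_ : P = setT `&` (h \_ B) @^-1` `]0, +oo[); last first.
    by apply/seteqP; split=> [x|x [_]]; rewrite /P /= in_itv /= andbT.
  by apply: mh => //; exact: measurable_itv.
have hE : bint (fun x => `|h x|) = 0.
  have := bint_lin (-1) (Ih1 (measurableC mP)) (Ih1 mP).
  rewrite !bint_measurable//; last exact: measurableC.
  rewrite mulr0 addr0 => <-; apply: bint_ext => x Bx; rewrite !indicE.
  have hB : (h \_ B) x = h x by rewrite patchE mem_set.
  have [/set_mem|] := boolP (x \in P); rewrite /P /= ?hB => xP.
    rewrite (_ : x \in ~` _ = false) ?mulr0 ?mulr1 ?add0r ?gtr0_norm//.
    by apply/negP => /set_mem; apply; rewrite /= hB.
  have h0 : h x <= 0.
    by rewrite leNgt; apply/negP => h0; move/negP: xP; apply; apply/mem_set; rewrite /= hB.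
  rewrite (_ : x \in ~` _ = true); first by rewrite mulr1 mulr0 addr0 mulN1r ler0_norm.
  by apply/mem_set => /=; rewrite hB; apply/negP; rewrite -leNgt.
have mh2 : measurable_fun B (EFin \o h) by apply/measurable_EFinP; exact: L2_meas.
have : ae_eq mu B (EFin \o h) (cst 0%E).
  apply/(ae_eq_integral_abs mu (@mB R d) mh2).
  pose habs x := `|h x|.
  rewrite (_ : (\int[mu]_(x in B) _)%E = (\int[mu]_(x in B) (habs x)%:E)%E)//.
  rewrite -[LHS]fineK; last exact: (@integrable_fin_num _ _ _ mu B (@mB R d) _ Ih).
  by rewrite -/(Rintegral mu B habs) -/(bint _) hE.
by apply: filterS => x H Bx; have /eqP := H Bx; rewrite /= eqe => /eqP.
Qed.

End moment_problem.

(** * Approximation by test functions *)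

Section flat_functions.
Context (R : realType).
Implicit Types (t : R) (a : nat).

(** Keeping the power of 1/t as an index makes the span of these functions stable under
    differentiation. *)
Definition flat a t : R := if 0 < t then expR (- t^-1) * t^-1 ^+ a else 0.

Lemma flat_ge0 a t : 0 <= flat a t.
Proof.
rewrite /flat; case: ifP => // t0.
by rewrite mulr_ge0 ?expR_ge0// exprn_ge0// invr_ge0 ltW.
Qed.

(** With y = 1/t, the exponential series gives y^a <= a! exp y. *)
Lemma flat_le a t : flat a t <= a`!%:R.
Proof.
rewrite /flat; case: ifP => // t0; have y0 : 0 <= t^-1 by rewrite invr_ge0 ltW.
rewrite expRN mulrC ler_pdivrMr ?expR_gt0//.
case: a => [|a]; first by rewrite expr0 fact0 mul1r -expR0 ler_expR.
have := expR_ge1Dxn a y0; have f0 : 0 < (a.+1`!%:R : R) by rewrite ltr0n fact_gt0.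
rewrite -(ler_pM2l f0) mulrDr mulr1 mulrCA mulfV ?gt_eqF// mulr1.
by move=> h; lra.
Qed.

Lemma flatS a t : flat a.+1 t * t = flat a t.
Proof.
rewrite /flat; case: ifP => [t0|_]; last by rewrite mul0r.
by rewrite exprSr mulrA mulfVK// gt_eqF.
Qed.

Lemma flat_le0 a t : t <= 0 -> flat a t = 0.
Proof. by move=> t0; rewrite /flat ltNge t0. Qed.

Lemma cvg_flat0 a : flat a h @[h --> (0 : R)^'] --> (0 : R).
Proof.
apply: (@squeeze_cvgr _ _ _ _ (fun=> 0) (fun h => a.+1`!%:R * `|h|)).
- apply: nearW => h; rewrite flat_ge0 /=; have [h0|h0] := ltP 0 h.
    by rewrite gtr0_norm// -flatS ler_wpM2r ?flat_le// ltW.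
  by rewrite flat_le0// mulr_ge0.
- exact: cvg_cst.
- rewrite -[X in _ --> X](mulr0 (a.+1`!%:R)); apply: cvgM; first exact: cvg_cst.
  rewrite -[X in _ --> X](@normr0 R R); apply: cvg_norm; exact: nbhs_dnbhs.
Qed.

Lemma is_derive_flat a t :
  is_derive t 1 (flat a) (flat a.+2 t - a%:R * flat a.+1 t).
Proof.
have [t0|t0|->] := ltgtP t 0.
- rewrite !(flat_le0 _ (ltW t0)) mulr0 subr0.
  have D0 : is_derive t 1 (cst (0 : R)) (0 : R) by exact: is_derive_cst.
  apply: (near_eq_is_derive _ D0); near=> s; rewrite flat_le0//; apply: ltW; near: s.
  exact: lt_nbhsl.
- apply: (@near_eq_is_derive _ _ _ (fun s : R => expR (- s^-1) * s^-1 ^+ a)).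
    by near=> s; rewrite /flat ifT//; near: s; exact: lt_nbhsr.
  have dV : is_derive t 1 (fun s : R => s^-1) (- t ^- 2).
    have := @is_deriveV R (@id R) t 1 1 (lt0r_neq0 t0) (is_derive_id _ _).
    by move=> h; apply: is_derive_eq h _; exact: mulr1.
  have dE : is_derive t 1 (fun s : R => expR (- s^-1)) (expR (- t^-1) * t ^- 2).
    apply: (@is_derive1_comp _ expR (fun s : R => - s^-1)).
    by have := is_deriveN dV; rewrite opprK.
  have dX := @is_deriveX _ _ (fun s : R => s^-1) a t 1 _ dV.
  have -> : (fun s : R => expR (- s^-1) * s^-1 ^+ a) =
      (fun s : R => expR (- s^-1)) * ((fun s : R => s^-1) ^+ a).
    by rewrite exprfctE.
  have := is_deriveM dE dX; move/is_derive_eq; apply.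
  rewrite exprfctE /flat t0 /GRing.scale /= -!exprVn.
  clear dE dV dX; set e := expR _; move: e (t^-1) => e y.
  case: a => [|a]; first by rewrite !exprS !expr0; ring.
  by rewrite !exprS /=; ring.
(* At 0 the difference quotient of [flat a] is [flat a.+1] itself, which tends to 0. *)
- rewrite !flat_le0// mulr0 subr0.
  have E : (fun h => h^-1 *: (flat a (h *: 1 + 0) - flat a 0)) = flat a.+1.
    apply/funext => h; rewrite addr0 (_ : h *: 1 = h); last exact: mulr1.
    rewrite (flat_le0 a (lexx 0)) subr0 -flatS /=; have [->|h0] := eqVneq h 0.
      by rewrite !flat_le0// invr0; exact: mul0r.
    by rewrite mulrC; exact: mulKf.
  have C : (fun h => h^-1 *: (flat a (h *: 1 + 0) - flat a 0)) h @[h --> (0 : R)^'] --> (0 : R).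
    by rewrite E; exact: cvg_flat0.
  by apply: DeriveDef; [apply/cvg_ex; exists 0|exact: cvg_lim C].
Unshelve. all: by end_near. Qed.

Lemma flat_cont a : continuous (flat a).
Proof.
move=> t; apply: differentiable_continuous; apply/derivable1_diffP.
by have [] := is_derive_flat a t.
Qed.

(** The argument tends to infinity, where exp (-1/z) tends to 1 and every positive power of 1/z to
    0. *)
Lemma cvg_flat a (r : R) : 0 < r -> flat a (n%:R * r - 1) @[n --> \oo] --> ((a == 0)%:R : R).
Proof.
move=> r0; pose z n : R := n%:R * r - 1.
have zoo : z n @[n --> \oo] --> +oo.
  apply/cvgryPge => A; near=> n; rewrite /z lerBrDr -ler_pdivrMr//.
  by near: n; exact: nbhs_infty_ger.
have z0 : \forall n \near \oo, 0 < z n by move/cvgryPgt : zoo; exact.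
have zV : (z n)^-1 @[n --> \oo] --> (0 : R) by exact: (proj2 (gtr0_cvgV0 z0) zoo).
case: a => [|a] /=.
  apply: (@squeeze_cvgr _ _ _ _ (fun n => 1 - (z n)^-1) (fun=> 1)).
  - near=> n; rewrite (le_trans (flat_le _ _)) ?fact0// andbT.
    rewrite /flat ifT; last by near: n.
    by rewrite expr0 mulr1 (le_trans (expR_ge1Dx _)).
  - rewrite -[X in _ --> X](subr0 (1 : R)); apply: cvgB => //; exact: cvg_cst.
  - exact: cvg_cst.
apply: (@squeeze_cvgr _ _ _ _ (fun=> 0) (fun n => a`!%:R * (z n)^-1)).
- near=> n; rewrite flat_ge0 /= ler_pdivlMr; last by near: n.
  by rewrite flatS flat_le.
- exact: cvg_cst.
- rewrite -[X in _ --> X](mulr0 (a`!%:R : R)); apply: cvgM => //; exact: cvg_cst.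
Unshelve. all: by end_near. Qed.

End flat_functions.

(** * Test functions cut off near the sphere *)

Section bump_functions.
Context (R : realType) (d : nat).
Local Notation MP := (mpoly d R).
Local Notation V := 'rV[R]_d.
Local Notation mu := (lebesgue_rV R d).
Local Notation B := (unit_ball R d).
Local Notation bint := (@bint R d).
Local Notation var := (@var R d).
Local Notation rho := (@rho R d).
Local Notation mderiv := (@mderiv d R).
Implicit Types (p q : MP) (L : seq (nat * MP)) (x : V).

Lemma evN p x : ev (- p) x = - ev p x.
Proof. by rewrite -scaleN1r evZ mulN1r. Qed.

Lemma is_derive_line (F : V -> R) x (v : V) (c : R) :
  is_derive x v F c <-> is_derive (0 : R) 1 (fun h : R => F (h *: v + x)) c.
Proof.
have E : (fun h : R => h^-1 *: (F (h *: v + x) - F x)) =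
    (fun h : R => h^-1 *: (F ((h *: 1 + 0) *: v + x) - F (0 *: v + x))).
  apply/funext => h; rewrite scale0r add0r addr0 (_ : h *: 1 = h)//; exact: mulr1.
split=> -[ex <-]; split.
- by move: ex; rewrite /derivable E.
- by rewrite /derive E.
- by rewrite /derivable E.
- by rewrite /derive E.
Qed.

Lemma is_derive_comp_dir (g : R -> R) (F : V -> R) x (v : V) (a b : R) :
  is_derive x v F b -> is_derive (F x) 1 g a -> is_derive x v (g \o F) (a * b).
Proof.
move=> /is_derive_line dF dg; apply/is_derive_line.
apply: (@is_derive1_comp _ g (fun h : R => F (h *: v + x))) => //.
by rewrite scale0r add0r.
Qed.

Section terms.
Variable tau : MP.

(** A list of pairs (a, q) encodes the sum of the terms [flat a] of tau times q, so that
    differentiation becomes an operation on lists and smoothness follows at all orders. *)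
Definition flat_sum L x : R := \sum_(u <- L) flat u.1 (ev tau x) * ev u.2 x.

Definition flat_deriv i (u : nat * MP) : seq (nat * MP) :=
  [:: (u.1.+2, mderiv i tau * u.2);
      (u.1.+1, (- u.1%:R) *: (mderiv i tau * u.2)); (u.1, mderiv i u.2)].

Lemma flat_sum_cat L L' x : flat_sum (L ++ L') x = flat_sum L x + flat_sum L' x.
Proof. by rewrite /flat_sum big_cat. Qed.

Lemma flat_sum_cons u L x :
  flat_sum (u :: L) x = flat u.1 (ev tau x) * ev u.2 x + flat_sum L x.
Proof. by rewrite /flat_sum big_cons. Qed.

Lemma flat_sum_nil x : flat_sum [::] x = 0.
Proof. by rewrite /flat_sum big_nil. Qed.

Lemma is_derive_flat_sum i L x :
  is_derive x (delta_mx ord0 i) (flat_sum L) (flat_sum (flatten (map (flat_deriv i) L)) x).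
Proof.
elim: L => [|u L IH].
  rewrite (_ : flat_sum [::] = cst 0); first exact: is_derive_cst.
  by apply/funext => y; rewrite flat_sum_nil.
rewrite (_ : flat_sum (u :: L) = (flat u.1 \o ev tau) * ev u.2 + flat_sum L); last first.
  by apply/funext => y; rewrite flat_sum_cons.
have dg := is_derive_comp_dir (ev_derive tau i x) (is_derive_flat u.1 (ev tau x)).
have := is_deriveD (is_deriveM dg (ev_derive u.2 i x)) IH.
move=> H; apply: (is_derive_eq H).
rewrite -[flatten (map _ (u :: L))]/(flat_deriv i u ++ flatten (map (flat_deriv i) L)) flat_sum_cat /=; congr (_ + _).
rewrite !flat_sum_cons flat_sum_nil /= evZ !evM /GRing.scale /=.
by ring.
Qed.

Lemma partial_flat_sum i L :
  partial i (flat_sum L) = flat_sum (flatten (map (flat_deriv i) L)).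
Proof.
by apply/funext => x; rewrite /partial; have [_ ->] := is_derive_flat_sum i L x.
Qed.

Lemma flat_sum_cont L : continuous (flat_sum L).
Proof.
elim: L => [|u L IH] x.
  rewrite (_ : flat_sum [::] = cst 0); first exact: cst_continuous.
  by apply/funext => y; rewrite flat_sum_nil.
rewrite (_ : flat_sum (u :: L) = fun y => flat u.1 (ev tau y) * ev u.2 y + flat_sum L y); last first.
  by apply/funext => y; rewrite flat_sum_cons.
have c : continuous (flat u.1 \o ev tau).
  by move=> y; apply: continuous_comp; [exact: ev_cont|exact: flat_cont].
exact: (cvgD (cvgM (c x) (@ev_cont R d u.2 x)) (IH x)).
Qed.

Lemma smooth_flat_sum L : smooth (flat_sum L).
Proof.
move=> s; have [L' ->] : exists L', partials s (flat_sum L) = flat_sum L'.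
  elim: s => [|i s [L' /= ->]]; first by exists L.
  by rewrite partial_flat_sum; eexists.
split=> [|i x]; first exact: flat_sum_cont.
by have [] := is_derive_flat_sum i L' x.
Qed.

Lemma flat_sum_neq0 L x : flat_sum L x != 0 -> 0 < ev tau x.
Proof.
apply: contraNT; rewrite -leNgt => t0; rewrite /flat_sum big1// => u _.
by rewrite flat_le0// mul0r.
Qed.

End terms.

Definition cutoff n : MP := n%:R *: rho - 1.

Lemma ev_cutoff n x : ev (cutoff n) x = n%:R * ev rho x - 1.
Proof. by rewrite /cutoff evB evZ ev1. Qed.

Lemma test_flat_sum n L : test_function B (flat_sum (cutoff n) L).
Proof.
pose S := [set x | flat_sum (cutoff n) L x != 0]; pose C : set V := [set x | 0 <= ev (cutoff n) x].
have SC : closure S `<=` C.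
  have cC : closed C.
    rewrite (_ : C = ev (cutoff n) @^-1` [set r : R | 0 <= r])//.
    by apply: closed_comp; [move=> x _; exact: ev_cont|exact: closed_ge].
  have /closure_id -> := cC; apply: closure_subset => x.
  by move=> /flat_sum_neq0/ltW.
have CB : C `<=` B.
  move=> x; rewrite /C /= ev_cutoff ev_rho subr_ge0 ballE => h.
  rewrite ltNge; apply/negP => h1; suff : n%:R * (1 - sqn x) <= 0 by lra.
  by rewrite mulr_ge0_le0// subr_le0.
split; [exact: smooth_flat_sum| |exact: subset_trans SC CB].
apply: (@subclosed_compact _ _ (@cube R d)); first exact: closed_closure.
  by apply: (@rV_compact R d (fun=> `[-1, 1]%classic)) => i; exact: segment_compact.
exact: subset_trans SC (subset_trans CB (@ball_cube R d)).
Qed.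

Definition weighted k L : seq (nat * MP) := map (fun u => (u.1, rho ^+ k * u.2)) L.

Definition cut_deriv k i (u : nat * MP) : seq (nat * MP) :=
  [:: (u.1.+2, -2 *: (var i * u.2)); (u.1.+1, (2 * u.1%:R - 2) *: (var i * u.2));
      (u.1, (2 * u.1%:R - 2 * k%:R) *: (var i * u.2) + rho * mderiv i u.2)].

(* With y = 1 / (n rho - 1) one has d_i y = 2 x_i (y^2 + y) / rho: differentiation
   lowers the power of rho by one, with coefficients independent of n. *)
Lemma partial_cut n k i L :
  partial i (flat_sum (cutoff n) (weighted k.+1 L)) =
  flat_sum (cutoff n) (weighted k (flatten (map (cut_deriv k.+1 i) L))).
Proof.
rewrite partial_flat_sum; apply/funext => x; elim: L => [//|u L IH].
rewrite -[flatten (map _ (weighted _ (u :: L)))]/(flat_deriv (cutoff n) i (u.1, rho ^+ k.+1 * u.2) ++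
  flatten (map (flat_deriv (cutoff n) i) (weighted k.+1 L))) flat_sum_cat IH.
rewrite -[weighted k (flatten (map _ (u :: L)))]/(weighted k (cut_deriv k.+1 i u ++
  flatten (map (cut_deriv k.+1 i) L))) /weighted map_cat flat_sum_cat; congr (_ + _).
rewrite /= !flat_sum_cons flat_sum_nil /=.
have -> : mderiv i (cutoff n) = - (n%:R * 2) *: var i.
  by rewrite /cutoff raddfB /= linearZ /= mderiv_rho -mpolyC1 mderivC subr0 scalerN scalerA scaleNr.
rewrite mderivM mderiv_rhoX.
have T := ev_cutoff n x; have F1 := flatS u.1.+1 (ev (cutoff n) x).
have F0 := flatS u.1 (ev (cutoff n) x); move: T F1 F0; move: (cutoff n) => c; move: rho => rr T F1 F0.
rewrite !(evM, evZ, evD, evN, evX, ev_var) -{}F0 -{}F1 {}T exprS.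
set g := flat _ _; move: g (ev rr x) (ev u.2 x) (ev (mderiv i u.2) x) => g r q q'.
rewrite -[k.+1%:R]natr1; move: (u.1%:R) (n%:R) (x ord0 i) (r ^+ k) (k%:R) => a N X K k'.
ring.
Qed.

(** The limit of the encoded function as the cut-off is removed: by [cvg_flat] only the terms with
    index 0 survive. *)
Definition lead L : MP := \sum_(u <- L) (if u.1 == 0%N then u.2 else 0).

Lemma lead_cut_deriv k i L :
  mderiv i (rho ^+ k.+1 * lead L) = rho ^+ k * lead (flatten (map (cut_deriv k.+1 i) L)).
Proof.
elim: L => [|u L IH]; rewrite /lead; first by rewrite /= !big_nil !mulr0 raddf0.
rewrite big_cons mulrDr raddfD -/(lead L) [X in _ + X]IH.
rewrite -[flatten (map _ (u :: L))]/(cut_deriv k.+1 i u ++ flatten (map (cut_deriv k.+1 i) L)).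
rewrite big_cat mulrDr; congr (_ + _); rewrite !big_cons big_nil /= !add0r addr0.
case: u => -[|a] q /=; last by rewrite mulr0 raddf0 !mulr0.
rewrite mderivM mderiv_rhoX exprSr mulr0 sub0r scaleNr -!mul_mpolyC.
by rewrite [k.+1%:R * 2]mulrC; ring.
Qed.

(** The list L does not depend on n. The derivatives of the cut-off functions therefore have an
    n-independent bound, and their limit, given by [lead], is the derivative of the uncut
    polynomial. *)
Lemma partials_cut k s q : (size s <= k)%N -> exists L,
  (forall n, partials s (flat_sum (cutoff n) [:: (0%N, rho ^+ k * q)]) =
             flat_sum (cutoff n) (weighted (k - size s) L)) /\
  pderivs s (rho ^+ k * q) = rho ^+ (k - size s) * lead L.
Proof.
elim: s => [|i s IH] sk.
  exists [:: (0%N, q)]; split; first by rewrite subn0.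
  by rewrite /lead big_seq1 subn0.
have [L [EL pL]] := IH (ltnW sk).
have ks : (k - size s = (k - size (i :: s)).+1)%N by rewrite /= subnSK.
exists (flatten (map (cut_deriv (k - size s) i) L)); split=> [n|] /=.
  by rewrite EL {1}ks partial_cut -ks.
by rewrite pL {1}ks lead_cut_deriv -ks.
Qed.

Lemma cvg_flat_sum L x : B x ->
  flat_sum (cutoff n) L x @[n --> \oo] --> ev (lead L) x.
Proof.
move=> Bx; have r0 : 0 < ev rho x by rewrite ev_rho subr_gt0 -ballE.
elim: L => [|u L IH].
  rewrite /lead big_nil (_ : ev 0 x = 0) ?/ev ?meval0//; under eq_fun do rewrite flat_sum_nil; exact: cvg_cst.
rewrite /lead big_cons evD; under eq_fun do rewrite flat_sum_cons.
apply: cvgD => //; under eq_fun do rewrite ev_cutoff.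
have -> : ev (if u.1 == 0%N then u.2 else 0) x = (u.1 == 0%N)%:R * ev u.2 x.
  by case: ifP; rewrite ?mul1r// mul0r /ev meval0.
by apply: cvgM; [exact: cvg_flat|exact: cvg_cst].
Qed.

(** A polynomial majorant for dominated convergence, independent of the cut-off: [flat a] is at most
    a!, and |q| <= 1 + q^2. *)
Definition flat_bound L : MP := \sum_(u <- L) (u.1`!%:R *: (1 + u.2 ^+ 2)).

Lemma flat_sum_le tau L x : `|flat_sum tau L x| <= ev (flat_bound L) x.
Proof.
rewrite /flat_sum /flat_bound ev_sum; apply: le_trans (ler_norm_sum _ _ _) _.
apply: ler_sum => u _; rewrite normrM (ger0_norm (flat_ge0 _ _)) evZ evD ev1 evX.
apply: ler_pM; rewrite ?flat_ge0// ?flat_le//.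
rewrite -(real_normK (num_real (ev u.2 x))); move: (normr_ge0 (ev u.2 x)).
by move: `|_| => a a0; nra.
Qed.

Lemma flat_sum_ip L :
  let D n x := ev (lead L) x - flat_sum (cutoff n) L x in
  ip (D n) (D n) @[n --> \oo] --> (0 : R).
Proof.
move=> D; have -> : (0 : R) = bint (fun=> 0).
  by rewrite /bint Rintegral_cst ?mul0r//; exact: mB.
pose M := 1 + lead L ^+ 2 + flat_bound L.
have cD n : continuous (D n).
  by move=> x; exact: (cvgB (@ev_cont R d (lead L) x) (@flat_sum_cont (cutoff n) L x)).
apply: (@bint_dct _ _ _ _ (ev (M ^+ 2))).
- exact: ev_int.
- exact: measurable_cst.
- move=> n; apply: measurable_funM; apply: L2_meas; exact: L2_cont.
- move=> x Bx; rewrite -[X in _ --> X](mulr0 0).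
  have H : D n x @[n --> \oo] --> (0 : R).
    rewrite -[X in _ --> X](subrr (ev (lead L) x)).
    by apply: cvgB; [exact: cvg_cst|exact: cvg_flat_sum].
  exact: (cvgM H H).
- move=> n x Bx.
  have H : `|D n x| <= ev M x.
    rewrite /D (le_trans (ler_normB _ _))// /M evD lerD ?flat_sum_le// evD ev1 evX.
    rewrite -(real_normK (num_real (ev (lead L) x))); move: (normr_ge0 (ev (lead L) x)).
    by move: `|_| => a a0; nra.
  by rewrite normrM -expr2 evX ler_pXn2r// nnegrE (le_trans (normr_ge0 (D n x))).
Qed.

(* Multiplying rho^m q by exp (- 1 / (n rho - 1)), cut off where n rho <= 1, turns it
   into a test function. *)
Lemma test_approx m q : exists phi : nat -> V -> R,
  (forall n, test_function B (phi n)) /\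
  forall s, (size s <= m)%N ->
    let D n x := partials s (ev (rho ^+ m * q)) x - partials s (phi n) x in
    ip (D n) (D n) @[n --> \oo] --> (0 : R).
Proof.
exists (fun n => flat_sum (cutoff n) [:: (0%N, rho ^+ m * q)]); split=> [n|s sm].
  exact: test_flat_sum.
have [L [EL pL]] := partials_cut q sm.
have E : pderivs s (rho ^+ m * q) = lead (weighted (m - size s) L).
  rewrite pL /lead /weighted big_map mulr_sumr; apply: eq_bigr => u _ /=.
  by case: ifP; rewrite ?mulr0.
move=> D; have ED n : D n = fun x => ev (lead (weighted (m - size s) L)) x -
    flat_sum (cutoff n) (weighted (m - size s) L) x.
  by apply/funext => x; rewrite /D partials_ev E EL.
under eq_fun do rewrite ED; exact: flat_sum_ip.
Qed.

Lemma sqr_le_cvg0 (a c : R) (u : nat -> R) :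
  (forall n, a ^+ 2 <= c * u n) -> u @ \oo --> (0 : R) -> a = 0.
Proof.
move=> au u0; apply/eqP; rewrite -sqrf_eq0; apply/eqP.
have cu : (fun n => c * u n) @ \oo --> (0 : R).
  by rewrite -[X in _ --> X](mulr0 c); apply: cvgM => //; exact: cvg_cst.
have H : (fun=> a ^+ 2 : R) n @[n --> \oo] --> (0 : R); last first.
  exact: (cvg_unique (@Rhausdorff R) (cvg_cst (a ^+ 2)) H).
apply: (@squeeze_cvgr _ _ _ _ (fun=> 0) (fun n => c * u n)) => //; last exact: cvg_cst.
by apply: nearW => n; rewrite sqr_ge0 au.
Qed.

(** By [test_approx] with m = 0 polynomials are L^2-limits of test functions, so all polynomial
    moments of h vanish. *)
Lemma test_orth_ae0 (h : V -> R) : L2 B h ->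
  (forall phi, test_function B phi -> ip h phi = 0) -> ae_eq mu B h (cst 0).
Proof.
move=> Lh H; apply: moments_ae0 => // p.
have [phi [Tphi /(_ [::] (leqnn _))]] := test_approx 0 p; rewrite /= expr0 mul1r => cv.
have Lp n : L2 B (phi n) by apply: L2_cont; have [/(_ [::])[]] := Tphi n.
apply: (sqr_le_cvg0 (c := ip h h) _ cv) => n.
have := ip_CS Lh (L2_sub (L2_ev p) (Lp n)).
by rewrite ip_subr//; [rewrite (H _ (Tphi n)) subr0|exact: L2_ev].
Qed.

End bump_functions.

(** * Weak derivatives and the space H^m_0 *)

Section weak_derivatives.
Context (R : realType) (d : nat).
Local Notation MP := (mpoly d R).
Local Notation V := 'rV[R]_d.
Local Notation mu := (lebesgue_rV R d).
Local Notation B := (unit_ball R d).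
Local Notation bint := (@bint R d).
Local Notation wp := (weak_partials B).
Local Notation test := (test_function B).
Implicit Types (f g u v phi psi : V -> R) (p q : MP) (s t : seq 'I_d).

Lemma partials_cat s t f : partials (s ++ t) f = partials s (partials t f).
Proof. by rewrite /partials foldr_cat. Qed.

Lemma smooth_partials s f : smooth f -> smooth (partials s f).
Proof. by move=> sf t; rewrite -partials_cat; exact: sf. Qed.

Lemma smooth_cont f : smooth f -> continuous f.
Proof. by move=> /(_ [::])[]. Qed.

Lemma smooth_L2 f : smooth f -> L2 B f.
Proof. by move=> sf; apply: L2_cont; exact: smooth_cont. Qed.

Lemma smooth_is_derive f i (x : V) : smooth f -> is_derive x (delta_mx ord0 i) f (partial i f x).
Proof. by move=> /(_ [::])[_ /(_ i x)] df; split. Qed.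

Lemma closure_support_partial i f :
  closure [set x | partial i f x != 0] `<=` closure [set x | f x != 0].
Proof.
have /closure_id -> := @closed_closure _ [set x | f x != 0].
apply: closure_subset => x /= dx; apply: contrapT => nx.
have O : open (~` closure [set x | f x != 0]) by apply: closed_openC; exact: closed_closure.
have N : \near x, cst 0 x = f x.
  move: (open_nbhs_nbhs (conj O nx)); apply: filterS => y ny; apply/esym/eqP.
  by apply/negPn/negP => fy; apply: ny; exact: subset_closure.
have D0 : is_derive x (delta_mx ord0 i) (cst (0 : R)) (0 : R) by exact: is_derive_cst.
by move: dx; rewrite /partial; have [_ ->] := near_eq_is_derive N D0; rewrite eqxx.
Qed.

Lemma test_smooth phi : test phi -> smooth phi. Proof. by case. Qed.

Lemma test_partials s phi : test phi -> test (partials s phi).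
Proof.
move=> Tphi; elim: s => [//|i s [sf cf fB]] /=.
have sub := @closure_support_partial i (partials s phi).
split; first by have := @smooth_partials [:: i] _ sf.
- by apply: subclosed_compact cf sub; exact: closed_closure.
- exact: subset_trans sub fB.
Qed.

Lemma test_sphere phi (x : V) : test phi -> sqn x = 1 -> phi x = 0.
Proof.
move=> [_ _ phB] x1; apply/eqP/negPn/negP => px.
by have := phB x (@subset_closure _ [set x | phi x != 0] x px); rewrite ballE x1 ltxx.
Qed.

Lemma ip_ibp i f phi : smooth f -> test phi ->
  ip (partial i f) phi = - ip f (partial i phi).
Proof.
move=> sf tphi; have sp := test_smooth tphi.
have df x := smooth_is_derive i x sf; have dp x := smooth_is_derive i x sp.
have E : partial i (fun x => f x * phi x) = fun x => f x * partial i phi x + phi x * partial i f x.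
  by apply/funext => x; rewrite [LHS](@derive_val _ _ _ _ _ _ _ (is_deriveM (df x) (dp x))).
have cc (g h : V -> R) : continuous g -> continuous h -> continuous (fun x => g x * h x).
  by move=> cg ch x; exact: (cvgM (cg x) (ch x)).
have cf := smooth_cont sf; have cp := smooth_cont sp.
have cf' := smooth_cont (@smooth_partials [:: i] _ sf).
have cp' := smooth_cont (@smooth_partials [:: i] _ sp).
have : bint (partial i (fun x => f x * phi x)) = 0.
  apply: integral_partial_ball => [x||x x1].
  - by have [] := is_deriveM (df x) (dp x).
  - rewrite E => x; exact: (cvgD (cc _ _ cf cp' x) (cc _ _ cp cf' x)).
  - by rewrite (test_sphere tphi x1) mulr0.
rewrite E bintD; try exact/cont_integrable/cc.
move=> h; rewrite [LHS]ipC; apply/eqP; rewrite -addr_eq0 addrC; apply/eqP; exact: h.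
Qed.

Lemma ip_partials s f phi : smooth f -> test phi ->
  ip f (partials s phi) = (-1) ^+ size s * ip (partials (rev s) f) phi.
Proof.
move=> + tphi; elim: s f => [|i s IH] f sf; first by rewrite mul1r.
rewrite rev_cons -cats1 partials_cat /= exprS -mulrA -IH.
  by rewrite (ip_ibp i sf (test_partials s tphi)) mulN1r opprK.
exact: (@smooth_partials [:: i]).
Qed.

(** The relation is stable under sums and limits, unlike the choice made by [weak_partials], to
    which [wp_ae] returns almost everywhere. *)
Definition wd s u g := L2 B g /\ is_weak_partials B s u g.

(* The derivatives are moved one at a time, hence the reversed list; replacing
   [rev s] by [s] would require the symmetry of second derivatives. *)
Lemma wd_smooth s f : smooth f -> wd s f (partials (rev s) f).
Proof.
move=> sf; split; first exact/smooth_L2/smooth_partials.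
by move=> phi tphi; exact: ip_partials.
Qed.

Lemma wd_nil u : L2 B u -> wd [::] u u.
Proof. by move=> Lu; split => // phi _; rewrite mul1r. Qed.

Lemma wd_unique s u g g' : wd s u g -> wd s u g' -> ae_eq mu B g g'.
Proof.
move=> [Lg wg] [Lg' wg'].
have : ae_eq mu B (fun x => g x - g' x) (cst 0).
  apply: test_orth_ae0; first exact: L2_sub.
  move=> phi tphi; have Lp := smooth_L2 (test_smooth tphi).
  rewrite ip_subl//; apply/eqP; rewrite subr_eq0; apply/eqP.
  apply: (@mulfI _ ((-1) ^+ size s)); first by rewrite signr_eq0.
  by have := wg _ tphi; rewrite (wg' _ tphi) => ->.
by apply: filterS => x H Bx; have /= := H Bx; move/eqP; rewrite subr_eq0 => /eqP.
Qed.

Lemma wd_lin s c u u' g g' : L2 B u -> L2 B u' -> wd s u g -> wd s u' g' ->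
  wd s (fun x => c * u x + u' x) (fun x => c * g x + g' x).
Proof.
move=> Lu Lu' [Lg wg] [Lg' wg']; split; first exact: L2_lin.
move=> phi tphi; have Lp := smooth_L2 (test_smooth tphi).
have Ls := smooth_L2 (test_smooth (test_partials s tphi)).
rewrite -!/(bint _) -!/(ip _ _) !ip_l//.
have := wg _ tphi; rewrite -!/(bint _) -!/(ip _ _) => ->.
have := wg' _ tphi; rewrite -!/(bint _) -!/(ip _ _) => ->.
by ring.
Qed.

Lemma wd_0 s : wd s (fun=> 0) (fun=> 0).
Proof.
split; first exact: L2_0.
move=> phi _; rewrite -!/(bint _).
have Z (F : V -> R) : bint (fun x => 0 * F x) = 0.
  rewrite -[RHS](mul0r (fine (mu B))) -(@Rintegral_cst _ _ _ mu B (@mB R d)) /=.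
  by apply: bint_ext => x _; rewrite mul0r.
by rewrite !Z mulr0.
Qed.

Lemma wd_sub s u u' g g' : L2 B u -> L2 B u' -> wd s u g -> wd s u' g' ->
  wd s (fun x => u x - u' x) (fun x => g x - g' x).
Proof.
move=> Lu Lu' wg wg'; have := wd_lin (-1) Lu' Lu wg' wg.
by congr wd; apply/funext => x; rewrite mulN1r addrC.
Qed.

Lemma wd_sum s (I : Type) (r : seq I) (F G : I -> V -> R) :
  (forall i, L2 B (F i)) -> (forall i, wd s (F i) (G i)) ->
  wd s (fun x => \sum_(i <- r) F i x) (fun x => \sum_(i <- r) G i x).
Proof.
move=> LF H; elim: r => [|i r IH].
  by under eq_fun do rewrite big_nil; under [X in wd _ _ X]eq_fun do rewrite big_nil; exact: wd_0.
under eq_fun do rewrite big_cons; under [X in wd _ _ X]eq_fun do rewrite big_cons.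
have := wd_lin 1 (LF i) (L2_sum r LF) (H i) IH.
by congr wd; apply/funext => x; rewrite mul1r.
Qed.

(** The derivative of phi along t is again a test function and may be used in the relation for g;
    the common sign is then cancelled. *)
Lemma wd_decomp s t u g k : wd s u g -> wd (s ++ t) u k -> wd t g k.
Proof.
move=> [_ wg] [Lk wk]; split=> // phi tphi.
have := wg _ (test_partials t tphi); rewrite -partials_cat (wk _ tphi) size_cat exprD -mulrA.
by move/(@mulfI _ ((-1) ^+ size s)); rewrite signr_eq0 => ->.
Qed.

Lemma wpP s u g : wd s u g -> wd s u (wp s u).
Proof. by move=> H; rewrite /weak_partials; case: xgetP => [g' ->//|/(_ g)[]]. Qed.

Lemma wp_ae s u g : wd s u g -> ae_eq mu B (wp s u) g.
Proof. by move=> H; apply: wd_unique (wpP H) H. Qed.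

(** Both functions have the same set of weak derivatives, hence the same chosen representative: the
    conclusion is an equality of functions, as iterated weak Laplacians require. *)
Lemma wp_congr s u u' : L2 B u -> L2 B u' -> ae_eq mu B u u' -> wp s u = wp s u'.
Proof.
move=> Lu Lu' uu'; rewrite /weak_partials; congr xget; apply/seteqP.
have E phi : test phi -> ip u (partials s phi) = ip u' (partials s phi).
  by move=> tp; apply: ip_aeq => //; apply: smooth_L2; exact/test_smooth/test_partials.
by split=> g [Lg wg]; split=> // phi tphi; rewrite -(wg _ tphi) -!/(bint _) -!/(ip _ _) E.
Qed.

End weak_derivatives.

(** * Convergence of weak derivatives and of the energy form *)

Section sobolev_convergence.
Context (R : realType) (d : nat).
Local Notation MP := (mpoly d R).
Local Notation V := 'rV[R]_d.
Local Notation mu := (lebesgue_rV R d).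
Local Notation B := (unit_ball R d).
Local Notation bint := (@bint R d).
Local Notation wp := (weak_partials B).
Local Notation wl := (weak_laplacian B).
Local Notation form := (polyharmonic_form B).
Implicit Types (f g h u v phi psi : V -> R) (p q w : MP) (s t : seq 'I_d).

Definition sqn2 f : R := ip f f.

Lemma sqn2_ge0 f : 0 <= sqn2 f. Proof. exact: ip_ge0. Qed.

Lemma cvg0_le (a b : nat -> R) : (forall n, 0 <= a n <= b n) ->
  b @ \oo --> (0 : R) -> a @ \oo --> (0 : R).
Proof.
move=> ab b0; apply: (@squeeze_cvgr _ _ _ _ (fun=> 0) b) => //; last exact: cvg_cst.
exact: nearW.
Qed.

Lemma cvg0_lin (c c' : R) (a b : nat -> R) : a @ \oo --> (0 : R) -> b @ \oo --> (0 : R) ->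
  (fun n => c * a n + c' * b n) @ \oo --> (0 : R).
Proof.
move=> a0 b0; rewrite -[X in _ --> X](addr0 (0 : R)) -[X in _ --> X + _](mulr0 c).
rewrite -[X in _ --> _ + X](mulr0 c').
by apply: cvgD; apply: cvgM => //; exact: cvg_cst.
Qed.

Lemma cvg_sum_seq (I : Type) (r : seq I) (f : I -> nat -> R) (a : I -> R) :
  (forall i, f i n @[n --> \oo] --> a i) ->
  \sum_(i <- r) f i n @[n --> \oo] --> \sum_(i <- r) a i.
Proof.
move=> H; elim: r => [|i r IH].
  by rewrite big_nil; under eq_fun do rewrite big_nil; exact: cvg_cst.
by rewrite big_cons; under eq_fun do rewrite big_cons; exact: cvgD (H i) IH.
Qed.

Lemma bint0 : bint (fun=> 0) = 0.
Proof. by rewrite /bint Rintegral_cst ?mul0r//; exact: mB. Qed.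

Lemma sqn2_ae f g : L2 B f -> L2 B g -> ae_eq mu B f g -> sqn2 f = sqn2 g.
Proof.
move=> Lf Lg fg; rewrite /sqn2 (ip_aeq Lf Lg fg Lf) ipC.
exact: (ip_aeq Lf Lg fg Lg).
Qed.

Lemma sqn2_add f g : L2 B f -> L2 B g ->
  sqn2 (fun x => f x + g x) <= 2 * sqn2 f + 2 * sqn2 g.
Proof.
move=> Lf Lg; have Lg' : L2 B (fun x => - g x).
  by have := L2_Z (-1) Lg; congr L2; apply/funext => x; rewrite mulN1r.
have := ip_sub_le Lf Lg' (@L2_0 R d); rewrite /sqn2.
have -> : ip (fun x => f x - - g x) (fun x => f x - - g x) =
  ip (fun x => f x + g x) (fun x => f x + g x).
  by apply: bint_ext => x _; rewrite !opprK.
have -> : ip (fun x => f x - 0) (fun x => f x - 0) = ip f f.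
  by apply: bint_ext => x _; rewrite !subr0.
suff -> : ip (fun x => 0 - - g x) (fun x => 0 - - g x) = ip g g by [].
by apply: bint_ext => x _; rewrite !opprK !add0r.
Qed.

Lemma sqn2_tri f g h : L2 B f -> L2 B g -> L2 B h ->
  sqn2 (fun x => f x - h x) <=
  2 * sqn2 (fun x => f x - g x) + 2 * sqn2 (fun x => g x - h x).
Proof. by move=> Lf Lg Lh; exact: ip_sub_le. Qed.

Lemma sqn2_subC f g : sqn2 (fun x => f x - g x) = sqn2 (fun x => g x - f x).
Proof. by apply: bint_ext => x _; ring. Qed.

Lemma sqn2_sum_cvg (I : Type) (r : seq I) (F : I -> nat -> V -> R) :
  (forall i n, L2 B (F i n)) -> (forall i, sqn2 (F i n) @[n --> \oo] --> (0 : R)) ->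
  sqn2 (fun x => \sum_(i <- r) F i n x) @[n --> \oo] --> (0 : R).
Proof.
move=> LF F0; elim: r => [|i r IH].
  rewrite (_ : (fun n => _) = fun=> 0); first exact: cvg_cst.
  apply/funext => n; rewrite -[RHS]bint0.
  by apply: bint_ext => x _; rewrite big_nil mul0r.
apply: cvg0_le (cvg0_lin 2 2 (F0 i) IH) => n; rewrite sqn2_ge0 /=.
have := sqn2_add (LF i n) (L2_sum r (fun j => LF j n)); apply: le_trans.
rewrite le_eqVlt; apply/orP; left; apply/eqP.
by apply: bint_ext => x _; rewrite big_cons.
Qed.

Lemma cvg0_sqr (a b : nat -> R) (c : R) : (forall n, a n ^+ 2 <= c * b n) ->
  b @ \oo --> (0 : R) -> a @ \oo --> (0 : R).
Proof.
move=> ab b0.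
have a2 : (fun n => a n ^+ 2) @ \oo --> (0 : R).
  apply: (@cvg0_le _ (fun n => c * b n + 0 * b n)); last exact: cvg0_lin.
  by move=> n; rewrite mul0r addr0 sqr_ge0 ab.
have := cvg_comp (fun n => a n ^+ 2) Num.sqrt a2 (@sqrt_continuous R 0).
move=> H; apply/norm_cvg0P; move: H; rewrite sqrtr0.
by rewrite /comp; under eq_fun do rewrite sqrtr_sqr.
Qed.

Lemma ip_cvg (F : nat -> V -> R) f h : (forall n, L2 B (F n)) -> L2 B f -> L2 B h ->
  sqn2 (fun x => F n x - f x) @[n --> \oo] --> (0 : R) -> ip (F n) h @[n --> \oo] --> ip f h.
Proof.
move=> LF Lf Lh c0; apply/subr_cvg0; apply: (cvg0_sqr (c := ip h h) _ c0) => n.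
by rewrite -ip_subl// mulrC; apply: ip_CS => //; exact: L2_sub.
Qed.

Lemma bint_sum (I : Type) (r : seq I) (F : I -> V -> R) :
  (forall i, mu.-integrable B (EFin \o F i)) ->
  bint (fun x => \sum_(i <- r) F i x) = \sum_(i <- r) bint (F i).
Proof.
move=> IF; pose S r' := mu.-integrable B (EFin \o (fun x => \sum_(i <- r') F i x)).
suff [] : S r /\ bint (fun x => \sum_(i <- r) F i x) = \sum_(i <- r) bint (F i) by [].
elim: r => [|i r [IS IH]].
  have I0 := L2_int (@L2_0 R d); rewrite /S; under eq_fun do rewrite big_nil; split.
    by move: I0; congr (mu.-integrable B _); apply/funext => x /=; rewrite big_nil.
  by rewrite big_nil bint0.
have E : (fun x => \sum_(j <- i :: r) F j x) = fun x => F i x + \sum_(j <- r) F j x.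
  by apply/funext => x; rewrite big_cons.
rewrite /S E big_cons -IH; split; last exact: bintD.
have := bint_int_lin 1 (IF i) IS; congr (mu.-integrable B _).
by apply/funext => x /=; rewrite mul1r.
Qed.

Lemma Hm_L2 m u : Hm B m u -> L2 B u. Proof. by case. Qed.

Lemma Hm_wp m u s : Hm B m u -> (size s <= m)%N -> wd s u (wp s u).
Proof. by move=> [_ H] /H[g wg]; exact: (@wpP R d s u g wg). Qed.

Lemma Hm_wpL2 m u s : Hm B m u -> (size s <= m)%N -> L2 B (wp s u).
Proof. by move=> Hu sm; have [] := Hm_wp Hu sm. Qed.

Lemma Hm_smooth m f : smooth f -> Hm B m f.
Proof. by move=> sf; split=> [|s _]; [exact: smooth_L2|eexists; exact: wd_smooth]. Qed.

Lemma wd_wl k u s : Hm B k.+2 u -> (size s <= k)%N ->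
  wd s (wl u) (fun x => \sum_i wp ([:: i; i] ++ s) u x).
Proof.
move=> Hu sk; apply: wd_sum => i; first exact: (Hm_wpL2 Hu).
by apply: (@wd_decomp _ _ [:: i; i] _ u); exact: (Hm_wp Hu).
Qed.

Lemma Hm_wl k u : Hm B k.+2 u -> Hm B k (wl u).
Proof.
move=> Hu; split; first by apply: L2_sum => i; exact: (Hm_wpL2 Hu).
by move=> s sk; eexists; exact: (wd_wl Hu sk).
Qed.

Lemma Hm_iter_wl j k u : Hm B (k + j.*2) u -> Hm B k (iter j wl u).
Proof.
elim: j k => [|j IH] k; first by rewrite addn0.
by rewrite doubleS !addnS => Hu; apply: Hm_wl; apply: IH; rewrite !addSn.
Qed.

(** Convergence in H^k, stated one derivative at a time so that it passes through the weak Laplacian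
    with a loss of two orders. *)
Definition jet_cvg k (U : nat -> V -> R) u :=
  [/\ forall n, Hm B k (U n), Hm B k u & forall s, (size s <= k)%N ->
    sqn2 (fun x => wp s (U n) x - wp s u x) @[n --> \oo] --> (0 : R)].

Lemma jet_cvg_intro k (U : nat -> V -> R) u (G : nat -> seq 'I_d -> V -> R) (H : seq 'I_d -> V -> R) :
  (forall n, L2 B (U n)) -> L2 B u ->
  (forall n s, (size s <= k)%N -> wd s (U n) (G n s)) ->
  (forall s, (size s <= k)%N -> wd s u (H s)) ->
  (forall s, (size s <= k)%N -> sqn2 (fun x => G n s x - H s x) @[n --> \oo] --> (0 : R)) ->
  jet_cvg k U u.
Proof.
move=> LU Lu wU wu GH; have HU n : Hm B k (U n).
  by split=> // s sk; exists (G n s); exact: wU.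
have Hu : Hm B k u by split=> // s sk; exists (H s); exact: wu.
split=> // s sk; rewrite (_ : (fun n => _) = fun n => sqn2 (fun x => G n s x - H s x)).
  exact: GH.
apply/funext => n; apply: sqn2_ae.
- by apply: L2_sub; [exact: (Hm_wpL2 (HU n))|exact: (Hm_wpL2 Hu)].
- by apply: L2_sub; [exact: (proj1 (wU n s sk))|exact: (proj1 (wu s sk))].
have a1 := wp_ae (wU n s sk); have a2 := wp_ae (wu s sk).
by apply: filterS2 a1 a2 => x h1 h2 Bx; rewrite h1// h2.
Qed.

Lemma jet_cvg_wl k (U : nat -> V -> R) u : jet_cvg k.+2 U u ->
  jet_cvg k (fun n => wl (U n)) (wl u).
Proof.
move=> [HU Hu c]; apply: (jet_cvg_intro (fun n => Hm_L2 (Hm_wl (HU n))) (Hm_L2 (Hm_wl Hu))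
  (fun n s => @wd_wl k _ s (HU n)) (fun s => @wd_wl k _ s Hu)) => s sk.
rewrite (_ : (fun n => _) = fun n => sqn2 (fun x => \sum_i
  (wp ([:: i; i] ++ s) (U n) x - wp ([:: i; i] ++ s) u x))); last first.
  by apply/funext => n; congr sqn2; apply/funext => x; rewrite sumrB.
apply: sqn2_sum_cvg => [i n|i]; last exact: c.
by apply: L2_sub; [exact: (Hm_wpL2 (HU n))|exact: (Hm_wpL2 Hu)].
Qed.

Lemma jet_cvg_iter j k (U : nat -> V -> R) u : jet_cvg (k + j.*2) U u ->
  jet_cvg k (fun n => iter j wl (U n)) (iter j wl u).
Proof.
elim: j k => [|j IH] k; first by rewrite addn0.
by rewrite doubleS !addnS => c; apply: jet_cvg_wl; apply: IH; rewrite !addSn.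
Qed.

Lemma formC m u v : form m u v = form m v u.
Proof.
rewrite /polyharmonic_form; case: ifP => _; apply: bint_ext => x _; last exact: mulrC.
by apply: eq_bigr => i _; exact: mulrC.
Qed.

Lemma form_ge0 m u : 0 <= form m u u.
Proof.
rewrite /polyharmonic_form; case: ifP => _; apply: bint_ge0 => x _; rewrite -?expr2 ?sqr_ge0//.
by apply: sumr_ge0 => i _; rewrite -expr2 sqr_ge0.
Qed.

Lemma Hm_half m u : Hm B m u -> Hm B (odd m) (iter m./2 wl u).
Proof. by move=> Hu; apply: Hm_iter_wl; rewrite odd_double_half. Qed.

Lemma formE m u v : Hm B m u -> Hm B m v -> form m u v =
  if odd m then \sum_i ip (wp [:: i] (iter m./2 wl u)) (wp [:: i] (iter m./2 wl v))
  else ip (iter m./2 wl u) (iter m./2 wl v).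
Proof.
move=> /Hm_half Hu /Hm_half Hv; rewrite /polyharmonic_form; case: ifP Hu Hv => // _ Hu Hv.
by rewrite -/(bint _) bint_sum// => i; apply: L2_mul_int; [exact: (Hm_wpL2 Hu)|exact: (Hm_wpL2 Hv)].
Qed.

Lemma form_cvg m (U : nat -> V -> R) u v : jet_cvg m U u -> Hm B m v ->
  form m (U n) v @[n --> \oo] --> form m u v.
Proof.
move=> c Hv; have [HU Hu _] := c.
under eq_fun do rewrite (formE (HU _) Hv).
rewrite (formE Hu Hv).
have : jet_cvg (odd m) (fun n => iter m./2 wl (U n)) (iter m./2 wl u).
  by apply: jet_cvg_iter; rewrite odd_double_half.
move/Hm_half : Hv; case: (odd m) => Hv [HU' Hu' c'].
  apply: cvg_sum_seq => i; apply: ip_cvg; last exact: c'.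
  - by move=> n; exact: (Hm_wpL2 (HU' n)).
  - exact: (Hm_wpL2 Hu').
  - exact: (Hm_wpL2 Hv).
apply: ip_cvg; [by move=> n; exact: (Hm_L2 (HU' n))|exact: (Hm_L2 Hu')|exact: (Hm_L2 Hv)|].
rewrite (_ : (fun n => _) = fun n => sqn2 (fun x => wp [::] (iter m./2 wl (U n)) x -
  wp [::] (iter m./2 wl u) x)); first exact: (c' [::] isT).
apply/funext => n; have L1 := Hm_L2 (HU' n); have L2' := Hm_L2 Hu'.
apply/esym/sqn2_ae; [|exact: L2_sub|].
  by apply: L2_sub; [exact: (Hm_wpL2 (HU' n))|exact: (Hm_wpL2 Hu')].
by apply: filterS2 (wp_ae (wd_nil L1)) (wp_ae (wd_nil L2')) => x h1 h2 Bx; rewrite h1// h2.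
Qed.

End sobolev_convergence.

(** * The space H^m_0 and Green's formula against polynomials *)

Section dirichlet_space.
Context (R : realType) (d : nat).
Local Notation MP := (mpoly d R).
Local Notation V := 'rV[R]_d.
Local Notation mu := (lebesgue_rV R d).
Local Notation B := (unit_ball R d).
Local Notation rho := (@rho R d).
Local Notation lap := (@lap R d).
Local Notation wp := (weak_partials B).
Local Notation wl := (weak_laplacian B).
Local Notation test := (test_function B).
Local Notation form := (polyharmonic_form B).
Implicit Types (f g h u v phi psi : V -> R) (p q w : MP) (s t : seq 'I_d).

Lemma Hm0_Hm m u : Hm0 B m u -> Hm B m u. Proof. by case. Qed.

Lemma Hm_norm_sqn2 m u : Hm_norm B m u =
  Num.sqrt (\sum_(k < m.+1) \sum_(s : k.-tuple 'I_d) sqn2 (wp s u)).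
Proof.
by congr Num.sqrt; apply: eq_bigr => k _; apply: eq_bigr => s _; exact: bint_ext.
Qed.

Lemma Hm0_intro m u (G : seq 'I_d -> V -> R) : L2 B u ->
  (forall s, (size s <= m)%N -> wd s u (G s)) ->
  (forall eps : R, 0 < eps -> exists2 phi, test phi & forall s, (size s <= m)%N ->
    sqn2 (fun x => G s x - partials (rev s) phi x) <= eps) ->
  Hm0 B m u.
Proof.
move=> Lu wu ap; have Hu : Hm B m u by split=> // s sm; exists (G s); exact: wu.
split=> // eps eps0.
(* The number of terms in the norm; dividing by T + 1 makes the final inequality strict. *)
pose T : R := \sum_(k < m.+1) \sum_(s : k.-tuple 'I_d) 1.
have T0 : 0 <= T by apply: sumr_ge0 => k _; apply: sumr_ge0.
have e0 : 0 < eps ^+ 2 / (T + 1) by rewrite divr_gt0 ?exprn_gt0// ltr_wpDl.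
have [phi tphi H] := ap _ e0; exists phi; split=> //.
rewrite Hm_norm_sqn2 -[ltRHS]gtr0_norm// -sqrtr_sqr ltr_sqrt ?exprn_gt0//.
apply: (@le_lt_trans _ _ (eps ^+ 2 / (T + 1) * T)).
  rewrite mulr_sumr; apply: ler_sum => k _; rewrite mulr_sumr; apply: ler_sum => s _.
  have sm : (size s <= m)%N by rewrite size_tuple -ltnS.
  rewrite mulr1; apply: le_trans (H s sm).
  have sphi := test_smooth tphi.
  have W := wd_sub Lu (smooth_L2 sphi) (wu s sm) (wd_smooth s sphi).
  by rewrite (sqn2_ae (proj1 (wpP W)) (proj1 W) (wp_ae W)).
by rewrite mulrAC ltr_pdivrMr ?ltr_wpDl// ltr_pM2l ?exprn_gt0// ltrDl.
Qed.

Lemma Hm0_elim m u (eps : R) : Hm0 B m u -> 0 < eps ->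
  exists2 phi, test phi & forall s, (size s <= m)%N ->
    sqn2 (fun x => wp s u x - partials (rev s) phi x) <= eps.
Proof.
move=> [Hu ap] eps0; have e0 : 0 < Num.sqrt eps by rewrite sqrtr_gt0.
have [phi [tphi]] := ap _ e0; rewrite Hm_norm_sqn2 ltr_sqrt// => H.
exists phi => // s sm; apply: le_trans (ltW H).
have sm' : (size s < m.+1)%N by [].
rewrite (bigD1 (Ordinal sm'))//= (bigD1 (in_tuple s))//=.
have sphi := test_smooth tphi.
have W := wd_sub (Hm_L2 Hu) (smooth_L2 sphi) (Hm_wp Hu sm) (wd_smooth s sphi).
rewrite -(sqn2_ae (proj1 (wpP W)) (proj1 W) (wp_ae W)) -addrA lerDl addr_ge0//.
  by apply: sumr_ge0 => t _; exact: sqn2_ge0.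
by apply: sumr_ge0 => k _; apply: sumr_ge0 => t _; exact: sqn2_ge0.
Qed.

Lemma Hm0_tests m v : Hm0 B m v ->
  exists phi : nat -> V -> R, (forall n, test (phi n)) /\ jet_cvg m phi v.
Proof.
move=> Hv; have n0 (n : nat) : 0 < (n.+1%:R : R)^-1 by rewrite invr_gt0.
have E n : exists phi, test phi /\ forall s, (size s <= m)%N ->
    sqn2 (fun x => wp s v x - partials (rev s) phi x) <= n.+1%:R^-1.
  by have [phi t H] := Hm0_elim Hv (n0 n); exists phi.
have [phi H] := choice E.
have tphi n : test (phi n) by case: (H n).
exists phi; split=> //.
apply: (jet_cvg_intro (G := fun n s => partials (rev s) (phi n)) (H := fun s => wp s v)).
- by move=> n; exact/smooth_L2/test_smooth.
- by case: Hv => [[]].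
- by move=> n s _; exact/wd_smooth/test_smooth.
- by move=> s sm; exact: (Hm_wp (Hm0_Hm Hv)).
move=> s sm; apply: (cvg0_le _ (@cvg_harmonic R)) => n.
by rewrite sqn2_ge0 sqn2_subC; case: (H n) => _; exact.
Qed.

Lemma Hm0_rho m q : Hm0 B m (ev (rho ^+ m * q)).
Proof.
have sw := smooth_ev (rho ^+ m * q); have [phi [tphi cv]] := test_approx m q.
apply: (Hm0_intro (G := fun s => partials (rev s) (ev (rho ^+ m * q)))).
- exact: smooth_L2.
- by move=> s _; exact: wd_smooth.
move=> eps eps0; suff [n Hn] : exists n, forall s, (size s <= m)%N ->
    sqn2 (fun x => partials s (ev (rho ^+ m * q)) x - partials s (phi n) x) <= eps.
  by exists (phi n) => // s sm; apply: Hn; rewrite size_rev.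
have : \forall n \near \oo, forall s, (size s <= m)%N ->
    sqn2 (fun x => partials s (ev (rho ^+ m * q)) x - partials s (phi n) x) <= eps.
  have F : \forall n \near \oo, forall k : 'I_m.+1, forall s : k.-tuple 'I_d,
    sqn2 (fun x => partials s (ev (rho ^+ m * q)) x - partials s (phi n) x) <= eps.
    apply: filter_forall => k; apply: filter_forall => s.
    have sm : (size s <= m)%N by rewrite size_tuple -ltnS.
    by have /cvgr_le := cv s sm; apply.
  apply: filterS F => n F s sm; have sm' : (size s < m.+1)%N by [].
  exact: (F (Ordinal sm') (in_tuple s)).
by move=> [N _ HN]; exists N; apply: (HN N); exact: leqnn.
Qed.

Lemma smooth_sum (I : Type) (r : seq I) (F : I -> V -> R) : (forall i, smooth (F i)) ->
  smooth (fun x => \sum_(i <- r) F i x).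
Proof.
move=> sF s; have : partials s (fun x => \sum_(i <- r) F i x) = (fun x => \sum_(i <- r) partials s (F i) x) /\
    forall i x, derivable (fun x => \sum_(i <- r) partials s (F i) x) x (delta_mx ord0 i).
  have D t i x : is_derive x (delta_mx ord0 i) (fun x => \sum_(j <- r) partials t (F j) x)
      (\sum_(j <- r) partial i (partials t (F j)) x).
    elim: r => [|j r IH].
      by under eq_fun do rewrite big_nil; rewrite big_nil; exact: is_derive_cst.
    rewrite big_cons; have := is_deriveD (smooth_is_derive i x (smooth_partials t (sF j))) IH.
    by congr is_derive; apply/funext => y; rewrite big_cons.
  split; last by move=> i x; have [] := D s i x.
  elim: s => [//|i s IH] /=; rewrite IH; apply/funext => x.
  by rewrite /partial; have [_ ->] := D s i x.
move=> [-> H]; split=> // x.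
have c (j : I) : continuous (partials s (F j)) by exact/smooth_cont/smooth_partials.
exact: sum_cont.
Qed.

Definition slap f : V -> R := fun x => \sum_i partials [:: i; i] f x.

Lemma smooth_slap f : smooth f -> smooth (slap f).
Proof. by move=> sf; apply: smooth_sum => i; exact: (@smooth_partials R d [:: i; i]). Qed.

Lemma test_slap phi : test phi -> test (slap phi).
Proof.
move=> tphi; have [sphi cphi phiB] := tphi.
have sub : closure [set x | slap phi x != 0] `<=` closure [set x | phi x != 0].
  have /closure_id -> := @closed_closure _ [set x | phi x != 0].
  apply: closure_subset => x /= sx; apply: contrapT => nx; move/eqP: sx; apply.
  rewrite /slap big1// => i _; apply/eqP/negPn/negP => px; apply: nx.
  apply: (@closure_support_partial R d i phi); apply: (@closure_support_partial R d i (partial i phi)).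
  exact: (@subset_closure _ [set x | partials [:: i; i] phi x != 0] x px).
split; first exact: smooth_slap.
- by apply: subclosed_compact cphi sub; exact: closed_closure.
- exact: subset_trans sub phiB.
Qed.

Lemma wl_smooth f : smooth f -> ae_eq mu B (wl f) (slap f).
Proof.
move=> sf; have H : \forall x \ae mu, forall i : 'I_d, B x -> wp [:: i; i] f x = partials [:: i; i] f x.
  apply: filter_forall => i; exact: (wp_ae (wd_smooth [:: i; i] sf)).
by apply: filterS H => x H Bx; apply: eq_bigr => i _; exact: H.
Qed.

Lemma wl_congr u v : L2 B u -> L2 B v -> ae_eq mu B u v -> wl u = wl v.
Proof.
move=> Lu Lv uv; apply/funext => x; apply: eq_bigr => i _.
by rewrite (wp_congr [:: i; i] Lu Lv uv).
Qed.

Lemma L2_wl_smooth f : smooth f -> L2 B (wl f).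
Proof. by move=> sf; exact: (Hm_L2 (Hm_wl (Hm_smooth 2 sf))). Qed.

Lemma smooth_iter_slap j f : smooth f -> smooth (iter j slap f).
Proof. by move=> sf; elim: j => [|j IH]; [exact: sf|exact: (smooth_slap IH)]. Qed.

Lemma iter_wl_smooth j f : smooth f -> ae_eq mu B (iter j wl f) (iter j slap f).
Proof.
elim: j f => [|j IH] f sf; first exact: aeW.
have sl := smooth_slap sf; rewrite !iterSr; have := IH _ sl; case: j {IH} => [|j] /=.
  by move=> _; exact: wl_smooth.
(* After one step the weak and classical Laplacians agree only almost everywhere, but the next weak
   Laplacian no longer sees the difference. *)
rewrite -!iterS !iterSr (wl_congr (L2_wl_smooth sf) (smooth_L2 sl))//; exact: wl_smooth.
Qed.

Lemma slap_ev w : slap (ev w) = ev (lap w).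
Proof.
apply/funext => x; rewrite /slap /lap ev_sum; apply: eq_bigr => i _.
by rewrite partials_ev.
Qed.

Lemma iter_slap_ev j w : iter j slap (ev w) = ev (iter j lap w).
Proof. by elim: j => //= j ->; rewrite slap_ev. Qed.

Lemma test_iter_slap j phi : test phi -> test (iter j slap phi).
Proof. by move=> tphi; elim: j => [|j IH]; [exact: tphi|exact: (test_slap IH)]. Qed.

Lemma ip_suml (I : Type) (r : seq I) (F : I -> V -> R) h : (forall i, L2 B (F i)) -> L2 B h ->
  ip (fun x => \sum_(i <- r) F i x) h = \sum_(i <- r) ip (F i) h.
Proof.
move=> LF Lh; rewrite /ip -bint_sum; last by move=> i; exact: L2_mul_int.
by apply: bint_ext => x _; rewrite mulr_suml.
Qed.

Lemma ip_slap f phi : smooth f -> test phi -> ip f (slap phi) = ip (slap f) phi.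
Proof.
move=> sf tphi; have Lphi := smooth_L2 (test_smooth tphi); have Lf := smooth_L2 sf.
have Lp g : smooth g -> forall i, L2 B (partials [:: i; i] g).
  by move=> sg i; exact: (smooth_L2 (@smooth_partials R d [:: i; i] g sg)).
have sum_l g h : smooth g -> L2 B h -> ip (slap g) h = \sum_i ip (partials [:: i; i] g) h.
  by move=> sg Lh; exact: (ip_suml _ (Lp _ sg) Lh).
apply: etrans (ipC _ _) _; apply: etrans (sum_l _ _ (test_smooth tphi) Lf) _.
apply: etrans (esym (sum_l _ _ sf Lphi)).
apply: eq_bigr => i _; apply: etrans (ipC _ _) _.
apply: etrans (ip_partials [:: i; i] sf tphi) _.
by rewrite [size _]/= expr2 mulrNN !mul1r.
Qed.

Lemma ip_iter_slap j f phi : smooth f -> test phi ->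
  ip f (iter j slap phi) = ip (iter j slap f) phi.
Proof.
move=> + tphi; elim: j f => // j IH f sf.
apply: etrans (ip_slap sf (test_iter_slap j tphi)) _.
by apply: etrans (IH _ (smooth_slap sf)) _; rewrite iterSr.
Qed.

(** Green's formula m/2 times on each side when m is even; when m is odd, one integration by parts
    of the gradient gives a further Laplacian and the sign. *)
Lemma form_test m w phi : test phi ->
  form m (ev w) phi = (-1) ^+ m * ip (ev (iter m lap w)) phi.
Proof.
move=> tphi; have sphi := test_smooth tphi; have sw := smooth_ev w.
rewrite (formE (Hm_smooth m sw) (Hm_smooth m sphi)); set j := m./2.
have jw := iter_wl_smooth j sw; have jp := iter_wl_smooth j sphi.
have sW := smooth_iter_slap j sw; have sP := smooth_iter_slap j sphi.
have LW : L2 B (iter j wl (ev w)) by exact: (Hm_L2 (Hm_half (Hm_smooth m sw))).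
have LP : L2 B (iter j wl phi) by exact: (Hm_L2 (Hm_half (Hm_smooth m sphi))).
have tP := test_iter_slap j tphi.
rewrite -iter_slap_ev; have mE := odd_double_half m; rewrite -/j in mE.
have LsW := smooth_L2 sW; have LsP := smooth_L2 sP.
rewrite -signr_odd; case: (boolP (odd m)) => om; last first.
  rewrite mul1r (ip_aeq LW LsW jw LP) ipC (ip_aeq LP LsP jp LsW) ipC.
  rewrite (ip_iter_slap j sW tphi) -iterD addnn; congr (ip (iter _ _ _) _).
  by rewrite -mE (negbTE om).
have Lp (f : V -> R) i : smooth f -> L2 B (partial i f).
  by move=> sf; exact: (smooth_L2 (@smooth_partials R d [:: i] f sf)).
transitivity (\sum_i - ip (partials [:: i; i] (iter j slap (ev w))) (iter j slap phi)).
  apply: eq_bigr => i _.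
  rewrite (wp_congr [:: i] LW LsW jw) (wp_congr [:: i] LP LsP jp).
  have wW := wd_smooth [:: i] sW; have wP := wd_smooth [:: i] sP.
  rewrite (ip_aeq (proj1 (wpP wW)) (Lp _ i sW) (wp_ae wW) (proj1 (wpP wP))) ipC.
  rewrite (ip_aeq (proj1 (wpP wP)) (Lp _ i sP) (wp_ae wP) (Lp _ i sW)) ipC.
  by rewrite (ip_ibp i (@smooth_partials R d [:: i] _ sW) tP) opprK.
have LL i : L2 B (partials [:: i; i] (iter j slap (ev w))).
  exact: (smooth_L2 (@smooth_partials R d [:: i; i] _ sW)).
rewrite sumrN -(ip_suml _ LL LsP) -/(slap (iter j slap (ev w))) expr1 mulN1r.
congr (- _); apply: etrans (ip_iter_slap j (smooth_slap sW) tphi) _; congr (ip _ phi).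
by rewrite -iterS -iterD; congr iter; rewrite -[RHS]mE om addnS addnn.
Qed.

(** Both sides are continuous in v for H^m convergence, and test functions are dense in H^m_0. The
    boundary conditions are carried by v; the polynomial w is arbitrary. *)
Lemma form_poly m w v : Hm0 B m v ->
  form m (ev w) v = (-1) ^+ m * ip (ev (iter m lap w)) v.
Proof.
move=> Hv; have [phi [tphi c]] := Hm0_tests Hv.
have sw := smooth_ev w; have [Hphi Hv' c'] := c.
have c1 := form_cvg c (Hm_smooth m sw).
have E : (fun n => form m (phi n) (ev w)) = fun n => (-1) ^+ m * ip (phi n) (ev (iter m lap w)).
  by apply/funext => n; rewrite formC form_test// ipC.
rewrite E in c1; rewrite formC ipC.
apply: (cvg_unique (@Rhausdorff R) c1); apply: cvgM; first exact: cvg_cst.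
have Lphi n : L2 B (phi n) by exact: (Hm_L2 (Hphi n)).
have Lv := Hm_L2 Hv'.
apply: (ip_cvg Lphi Lv (L2_ev _)).
rewrite (_ : (fun n => _) = fun n => sqn2 (fun x => wp [::] (phi n) x - wp [::] v x)).
  exact: (c' [::] isT).
apply/funext => n; apply/esym/sqn2_ae; [|exact: L2_sub|].
  by apply: L2_sub; [exact: (Hm_wpL2 (Hphi n))|exact: (Hm_wpL2 Hv')].
by apply: filterS2 (wp_ae (wd_nil (Lphi n))) (wp_ae (wd_nil Lv)) => x h1 h2 Bx; rewrite h1// h2.
Qed.

End dirichlet_space.

(** * Completeness of L^2 on the ball *)

Section riesz_fischer.
Context (R : realType) (d : nat).
Local Notation V := 'rV[R]_d.
Local Notation mu := (lebesgue_rV R d).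
Local Notation B := (unit_ball R d).
Local Notation bint := (@bint R d).
Implicit Types (f : nat -> R) (F : nat -> V -> R).

(** With e_k = M / 2^k, the sequence f + e is nonincreasing and f - e is nondecreasing; their common
    limit lies between them, which also gives the rate. *)
Lemma geometric_cvg f (M : R) : 0 <= M ->
  (forall j, 4 ^+ j.+1 * (f j.+1 - f j) ^+ 2 <= M ^+ 2) ->
  exists l : R, f @ \oo --> l /\ forall k, `|f k - l| <= M * 2^-1 ^+ k.
Proof.
move=> M0 H; pose e k : R := M * 2^-1 ^+ k.
have eS k : e k = e k.+1 + e k.+1 by rewrite /e exprS; field.
have e_ge0 k : 0 <= e k by rewrite mulr_ge0// exprn_ge0.
have fe k : `|f k.+1 - f k| <= e k.+1.
  rewrite -(@ler_pXn2r _ 2) ?nnegrE// real_normK ?num_real//.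
  have p4 : 0 < (4 ^+ k.+1 : R) by rewrite exprn_gt0.
  rewrite -(ler_pM2l p4); apply: le_trans (H k) _.
  rewrite /e exprMn mulrCA -exprM mulnC exprM -exprMn.
  by rewrite (_ : 4 * 2^-1 ^+ 2 = 1) ?expr1n ?mulr1//; field.
have up : nonincreasing_seq (fun k => f k + e k).
  apply/nonincreasing_seqP => k; have := fe k; rewrite ler_norml => /andP[_].
  by have := eS k; lra.
have dn : nondecreasing_seq (fun k => f k - e k).
  apply/nondecreasing_seqP => k; have := fe k; rewrite ler_norml => /andP[+ _].
  by have := eS k; lra.
have c : cvgn (fun k => f k + e k).
  apply: nonincreasing_is_cvgn => //; exists (f 0%N - e 0%N) => _ [k _ <-].
  have := dn 0%N k (leq0n k); have := e_ge0 k; rewrite /=; lra.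
have e0 : e @ \oo --> (0 : R).
  rewrite -[X in _ --> X](mulr0 M); apply: cvgM; first exact: cvg_cst.
  by apply: cvg_expr; rewrite ger0_norm//; lra.
pose l := limn (fun k => f k + e k).
have fl : f @ \oo --> l.
  have -> : f = fun k => (f k + e k) - e k by apply/funext => k; rewrite addrK.
  by rewrite -[X in _ --> X]subr0; apply: cvgB.
have dl : (fun k => f k - e k) @ \oo --> l.
  by rewrite -[X in _ --> X]subr0; apply: cvgB.
exists l; split=> // k; rewrite -/(e k) ler_norml.
have h1 := nonincreasing_cvgn_ge up c k.
have h2 := nondecreasing_cvgn_le dn (cvgP _ dl) k.
by rewrite (cvg_lim _ dl) // in h2; rewrite -/l in h1; apply/andP; split; lra.
Qed.

Lemma fast_L2_limit F : (forall n, L2 B (F n)) ->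
  (forall j, sqn2 (fun x => F j.+1 x - F j x) <= 8^-1 ^+ j.+1) ->
  exists u, L2 B u /\ sqn2 (fun x => F n x - u x) @[n --> \oo] --> (0 : R).
Proof.
move=> LF HF.
(* Against the bound 8^-(j+1) the weight still leaves the summable 2^-(j+1), while pointwise it
   forces increments of order 2^-(j+1). *)
pose h j (x : V) : R := 4 ^+ j.+1 * (F j.+1 x - F j x) ^+ 2.
have h0 j x : 0 <= h j x by rewrite mulr_ge0 ?sqr_ge0.
have LD j := L2_sub (LF j.+1) (LF j).
have Ih j : mu.-integrable B (EFin \o h j).
  have := L2_mul_int (L2_Z (4 ^+ j.+1) (LD j)) (LD j); congr (mu.-integrable B _).
  by apply/funext => x /=; rewrite /h expr2 mulrA.
have mh j : measurable_fun B (EFin \o h j) by have /integrableP[] := Ih j.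
pose H (x : V) : \bar R := (\sum_(0 <= j <oo) (h j x)%:E)%E.
have H0 x : (0 <= H x)%E by apply: nneseries_ge0 => n _ _; rewrite lee_fin.
have mH : measurable_fun B H.
  have := @ge0_emeasurable_sum _ V R B (fun j x => (h j x)%:E) xpredT.
  by apply=> [k x _ _|k _]; [rewrite lee_fin|exact: mh].
have IH : mu.-integrable B H.
  apply/integrableP; split=> //.
  under eq_integral do rewrite gee0_abs//.
  rewrite (integral_nneseries mu (@mB R d))//; last by move=> n x _; rewrite lee_fin.
  apply: (@le_lt_trans _ _ 1%E); last exact: ltry.
  have E j : (\int[mu]_(x in B) (h j x)%:E)%E = (bint (h j))%:E.
    by rewrite /bint /Rintegral fineK//; exact: (integrable_fin_num (@mB R d) (Ih j)).
  under eq_eseriesr do rewrite E.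
  have bh j : bint (h j) <= 2^-1 ^+ j.+1.
    have -> : bint (h j) = 4 ^+ j.+1 * sqn2 (fun x => F j.+1 x - F j x).
      rewrite -bintZ; last exact: L2_mul_int.
      by apply: bint_ext => x _; rewrite /h expr2.
    apply: le_trans (ler_wpM2l (exprn_ge0 _ _) (HF j)) _ => //.
    by rewrite -exprMn (_ : 4 * 8^-1 = 2^-1)//; field.
  apply: lime_le.
    by apply: is_cvg_nneseries => n _ _; rewrite lee_fin; apply: bint_ge0 => x _.
  apply: nearW => n; rewrite sumEFin lee_fin.
  suff : \sum_(0 <= i < n) bint (h i) <= 1 - 2^-1 ^+ n.
    by move/le_trans; apply; rewrite gerBl exprn_ge0.
  elim: n => [|n IHn]; first by rewrite big_nil expr0 subrr.
  rewrite big_nat_recr//=; apply: le_trans (lerD IHn (bh n)) _.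
  by rewrite exprS; lra.
(* The set of full measure where the series is finite. Functions are multiplied by its indicator so
   that the pointwise limit exists everywhere and is measurable. *)
pose E := B `&` [set x | H x \is a fin_num].
have mE : measurable E by exact: (emeasurable_fin_num (@mB R d) mH).
have aeE : ae_eq mu B (cst (1 : R)) (\1_E).
  have := integrable_ae (@mB R d) IH; apply: filterS => x Hx Bx.
  by rewrite indicE mem_set//; split=> //; exact: Hx.
pose S (x : V) : R := fine (H x).
have IS : mu.-integrable B (EFin \o S).
  apply: (le_integrable (@mB R d) _ _ IH).
  - apply/measurable_EFinP; apply: (@measurable_comp _ _ _ _ _ _ setT fine _ H) => //.
  - move=> x _ /=; rewrite /S; have := H0 x; case: (H x) => //=.
    by rewrite normr0 => _; rewrite leey.
have hS x j : E x -> h j x <= S x.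
  move=> [Bx fx]; rewrite -lee_fin /S fineK//.
  have p n : (0 <= n)%N -> true -> (0 <= (h n x)%:E)%E by rewrite lee_fin.
  apply: le_trans (nneseries_lim_ge j.+1 p); rewrite big_nat_recr//= leeDr//.
  by apply: sume_ge0 => i _; rewrite lee_fin.
have S0 x : 0 <= S x by rewrite fine_ge0.
have PW x : exists l : R, E x -> F n x @[n --> \oo] --> l /\
    forall k, `|F k x - l| <= Num.sqrt (S x) * 2^-1 ^+ k.
  have [Ex|nEx] := pselect (E x); last by exists 0.
  have [|j|l [c b]] := @geometric_cvg (fun n => F n x) (Num.sqrt (S x)).
  - exact: sqrtr_ge0.
  - by rewrite sqr_sqrtr//; exact: hS.
  - by exists l.
have [l Hl] := choice PW.
pose u x := l x * \1_E x.
pose G n x := F n x * \1_E x.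
have mG n : measurable_fun B (G n).
  apply: measurable_funM; first exact: L2_meas.
  exact: measurable_indic.
have Gu x : G n x @[n --> \oo] --> u x.
  rewrite /G /u indicE; have [/set_mem Ex|_] := boolP (x \in E).
    by apply: cvgM; [case: (Hl x Ex)|exact: cvg_cst].
  by rewrite mulr0; under eq_fun do rewrite mulr0; exact: cvg_cst.
have mu' : measurable_fun B u.
  by apply: (measurable_fun_cvg mG) => // x _; exact: Gu.
have bd k x : (G k x - u x) ^+ 2 <= S x * 4^-1 ^+ k.
  rewrite /G /u indicE; have [/set_mem Ex|_] := boolP (x \in E); last first.
    by rewrite !mulr0 subrr expr0n mulr_ge0// exprn_ge0.
  rewrite !mulr1 -(real_normK (num_real _)); have [_ /(_ k) b] := Hl x Ex.
  apply: le_trans (_ : (Num.sqrt (S x) * 2^-1 ^+ k) ^+ 2 <= _).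
    by rewrite ler_pXn2r// nnegrE mulr_ge0 ?sqrtr_ge0// exprn_ge0.
  have q : (2^-1 : R) ^+ 2 = 4^-1 by field.
  by rewrite exprMn sqr_sqrtr// -exprM mulnC exprM q.
have LG n : L2 B (G n).
  split=> //; have [_ fin] := LF n; apply: le_lt_trans fin; apply: ge0_le_integral.
  - exact: mB.
  - by move=> x _; rewrite lee_fin sqr_ge0.
  - by apply/measurable_EFinP; exact: measurable_funX.
  - by apply/measurable_EFinP; apply: measurable_funX; exact: L2_meas.
  move=> x _; rewrite lee_fin /G indicE; case: (x \in E); rewrite ?mulr1//.
  by rewrite mulr0 expr0n sqr_ge0.
have LGu : L2 B (fun x => G 0%N x - u x).
  split; first exact: measurable_funB.
  have /integrableP[_] := IS; apply: le_lt_trans; apply: ge0_le_integral.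
  - exact: mB.
  - by move=> x _; rewrite lee_fin sqr_ge0.
  - by apply/measurable_EFinP; apply: measurable_funX; exact: measurable_funB.
  - by apply: measurableT_comp => //; have /integrableP[] := IS.
  by move=> x _; rewrite /= lee_fin ger0_norm//; have := bd 0%N x; rewrite expr0 mulr1.
have Lu : L2 B u.
  have := L2_sub (LG 0%N) LGu; congr L2; apply/funext => x.
  by rewrite opprB addrC subrK.
exists u; split=> //.
apply: (@cvg0_le R _ (fun k => bint S * 4^-1 ^+ k)); last first.
  rewrite -[X in _ --> X](mulr0 (bint S)); apply: cvgM; first exact: cvg_cst.
  by apply: cvg_expr; rewrite ger0_norm//; lra.
move=> k; rewrite sqn2_ge0 /=.
have -> : sqn2 (fun x => F k x - u x) = sqn2 (fun x => G k x - u x).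
  apply: sqn2_ae; [exact: L2_sub|exact: L2_sub|].
  apply: filterS aeE => x Hx Bx; have := Hx Bx; rewrite /G /= => <-.
  by rewrite mulr1.
rewrite mulrC -bintZ//; apply: bint_le.
- exact: L2_mul_int (L2_sub (LG k) Lu) (L2_sub (LG k) Lu).
- rewrite (_ : EFin \o _ = (fun x => (4^-1 ^+ k)%:E * (S x)%:E)%E)//.
  by apply: integrableZl => //; exact: mB.
- by move=> x _; rewrite -expr2 mulrC; exact: bd.
Qed.

Lemma L2_complete F : (forall n, L2 B (F n)) ->
  (forall eps : R, 0 < eps -> exists N, forall k l, (N <= k)%N -> (N <= l)%N ->
    sqn2 (fun x => F k x - F l x) <= eps) ->
  exists u, L2 B u /\ sqn2 (fun x => F n x - u x) @[n --> \oo] --> (0 : R).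
Proof.
move=> LF C.
have e0 (j : nat) : 0 < (8^-1 ^+ j.+1 : R) by rewrite exprn_gt0.
have [N HN] := choice (fun j => C _ (e0 j)).
pose phi := fix phi j := if j is i.+1 then (maxn (N i.+1) (phi i)).+1 else N 0%N.
have phiN j : (N j <= phi j)%N by case: j => //= j; rewrite ltnW// ltnS leq_maxl.
have phiS j : (phi j <= phi j.+1)%N by rewrite /= ltnW// ltnS leq_maxr.
have phi_ge j : (j <= phi j)%N.
  by elim: j => // j IH; rewrite /= ltnS (leq_trans IH)// leq_maxr.
have [||u [Lu cu]] := @fast_L2_limit (fun j => F (phi j)).
- by move=> j; exact: LF.
- by move=> j; apply: (HN j); rewrite ?phiN// (leq_trans (phiN j)).
exists u; split=> //; apply/cvgrPdist_le => eps eps0.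
have e4 : 0 < eps / 4 by rewrite divr_gt0.
have [N1 HN1] := C _ e4; have /cvgrPdist_le/(_ _ e4) [K _ HK] := cu.
exists N1 => // n /= nN; rewrite sub0r normrN ger0_norm ?sqn2_ge0//.
pose j := maxn N1 K.
have h1 := HN1 n (phi j) nN (leq_trans (leq_maxl N1 K) (phi_ge j)).
have := HK j (leq_maxr N1 K); rewrite /= sub0r normrN ger0_norm ?sqn2_ge0// => h2.
by apply: le_trans (sqn2_tri (LF n) (LF (phi j)) Lu) _; lra.
Qed.

End riesz_fischer.

(** * The first eigenvalue *)

Section first_eigenvalue.
Context (R : realType) (d m : nat).
Hypothesis d0 : (0 < d)%N.
Local Notation MP := (mpoly d R).
Local Notation V := 'rV[R]_d.
Local Notation B := (unit_ball R d).
Local Notation rho := (@rho R d).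
Local Notation wp := (weak_partials B).
Local Notation form := (polyharmonic_form B m).
Local Notation kop := (@kop R d m).
Local Notation aform := (@aform R d m).
Local Notation ksq := (@ksq R d m).
Local Notation wsq := (@wsq R d m).
Local Notation gsup := (@gsup R d m).
Implicit Types (u v phi : V -> R) (p q f : MP) (s : seq 'I_d).

Lemma cvg0_uniform (a : seq 'I_d -> nat -> R) (eps : R) : 0 < eps ->
  (forall s, (size s <= m)%N -> a s n @[n --> \oo] --> (0 : R)) ->
  exists n, forall s, (size s <= m)%N -> a s n <= eps.
Proof.
move=> eps0 H.
have F : \forall n \near \oo, forall k : 'I_m.+1, forall s : k.-tuple 'I_d, a s n <= eps.
  apply: filter_forall => k; apply: filter_forall => s.
  have sm : (size s <= m)%N by rewrite size_tuple -ltnS.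
  by have /cvgr_le := H s sm; apply.
have [N _ HN] := F; exists N => s sm; have sm' : (size s < m.+1)%N by [].
exact: (HN N (leqnn N) (Ordinal sm') (in_tuple s)).
Qed.

Lemma Hm0_limit (U : nat -> V -> R) u :
  (forall n, Hm0 B m (U n)) -> jet_cvg m U u -> Hm0 B m u.
Proof.
move=> HU [_ Hu c]; apply: (Hm0_intro (G := fun s => wp s u)).
- exact: (Hm_L2 Hu).
- by move=> s sm; exact: (Hm_wp Hu sm).
move=> eps eps0; have e4 : 0 < eps / 4 by rewrite divr_gt0.
have [n Hn] := cvg0_uniform e4 c; have [phi tphi Hphi] := Hm0_elim (HU n) e4.
exists phi => // s sm; have h1 := Hn s sm; have h2 := Hphi s sm.
have Ls : L2 B (partials (rev s) phi) by exact/smooth_L2/smooth_partials/test_smooth.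
apply: le_trans (sqn2_tri (Hm_wpL2 Hu sm) (Hm_wpL2 (Hm0_Hm (HU n)) sm) Ls) _.
by rewrite sqn2_subC; lra.
Qed.

Lemma wd_limit s (U G : nat -> V -> R) u g :
  (forall n, L2 B (U n)) -> L2 B u -> (forall n, wd s (U n) (G n)) -> L2 B g ->
  sqn2 (fun x => U n x - u x) @[n --> \oo] --> (0 : R) ->
  sqn2 (fun x => G n x - g x) @[n --> \oo] --> (0 : R) -> wd s u g.
Proof.
move=> LU Lu W Lg cU cG; split=> // phi tphi.
have Lp := smooth_L2 (test_smooth tphi).
have Ls := smooth_L2 (test_smooth (test_partials s tphi)).
have c1 := ip_cvg LU Lu Ls cU.
have c2 : ((-1) ^+ size s * ip (G n) phi) @[n --> \oo] --> (-1) ^+ size s * ip g phi.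
  by apply: cvgM; [exact: cvg_cst|apply: ip_cvg => // n; case: (W n)].
have E : (fun n => ip (U n) (partials s phi)) = fun n => (-1) ^+ size s * ip (G n) phi.
  by apply/funext => n; case: (W n) => _; exact.
by rewrite E in c1; exact: (cvg_unique (@Rhausdorff R) c1 c2).
Qed.

(** Derivatives of order m are bounded by the energy; below that, each missing derivative is added
    by Poincare's inequality at the cost of a factor 4. *)
Lemma pderivs_bound s p : (size s <= m)%N ->
  pint (pderivs s (rho ^+ m * p) ^+ 2) <= 4 ^+ (m - size s) * aform p p.
Proof.
move=> sm; have [k km] : exists k, k = (m - size s)%N by exists (m - size s)%N.
rewrite -km; elim: k s sm km => [|k IH] s sm km.
  have sE : size s = m by apply/eqP; rewrite eqn_leq sm -subn_eq0 -km.
  rewrite mul1r aform_tform -[X in tform X]sE; apply: tform_bound; rewrite sE.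
  by exists p.
have sm' : (size s < m)%N by rewrite -subn_gt0 -km.
pose i : 'I_d := Ordinal d0.
apply: (@le_trans _ _ (4 * pint (pderivs (i :: s) (rho ^+ m * p) ^+ 2))).
  apply: pint_poincare; apply: (@rdiv_le _ _ _ (m - size s)); first by rewrite subn_gt0.
  by apply: rdiv_pderivs => //; exists p.
by rewrite [4 ^+ _]exprS -[leRHS]mulrA ler_pM2l//; apply: IH => //=; rewrite subnS -km.
Qed.

Lemma aform_sqr_le p : aform p p ^+ 2 <= wsq p * ksq p.
Proof. by rewrite aformE; exact: pint_CS0. Qed.

Lemma ksq_sub_le p q : ksq (p - q) <= 2 * ksq p + 2 * ksq q.
Proof.
rewrite /ksq raddfB /= -!pintZ -pintD; apply: pint_le => x _.
move: (kop p) (kop q) => a b; rewrite evD !evZ !evX evB.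
move: (ev a x) (ev b x) => a' b'; rewrite -subr_ge0.
by rewrite (_ : _ - _ = (a' + b') ^+ 2) ?sqr_ge0//; ring.
Qed.

Lemma pderivsB s p q : pderivs s (p - q) = pderivs s p - pderivs s q.
Proof. by elim: s => //= i s ->; rewrite raddfB. Qed.

Lemma form_kop p v : Hm0 B m v -> form (ev (rho ^+ m * p)) v = ip (ev (kop p)) v.
Proof.
move=> Hv; rewrite form_poly// /kop; have Lv := Hm_L2 (Hm0_Hm Hv).
rewrite /ip -bintZ; last by apply: L2_mul_int => //; exact: L2_ev.
by apply: bint_ext => x _; rewrite evZ mulrA.
Qed.

(** Let f_n be the polynomial [kop (p n)], of norm 1. As the f_n are bounded, w_n being Cauchy in
    L^2 makes it Cauchy in energy, hence in all derivatives up to order m. Replacing f_n by w_n /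
    gsup in form(w_n, v) = <f_n, v> costs an error D_n that tends to 0, and the equation passes to
    the limit. *)
Lemma eigenvalue_gsup : is_eigenvalue B m gsup^-1.
Proof.
have [p [k1 ap wc]] := @cauchy_maximizing_sequence R d m d0; have g0 := @gsup_gt0 R d m d0.
pose w n := rho ^+ m * p n.
have sw n := smooth_ev (w n).
have wsqE k l : wsq (p k - p l) = sqn2 (fun x => ev (w k) x - ev (w l) x).
  rewrite /sqn2; transitivity (ip (ev (rho ^+ m * (p k - p l))) (ev (rho ^+ m * (p k - p l)))).
    by rewrite ip_ev /wsq expr2.
  by apply: bint_ext => x _; rewrite mulrBr evB.
have acauchy N k l : (N <= k)%N -> (N <= l)%N -> aform (p k - p l) (p k - p l) ^+ 2 <= 4 / N.+1%:R.
  move=> Nk Nl; apply: le_trans (aform_sqr_le _) _; rewrite mulrC.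
  apply: ler_pM; [exact: ksq_ge0|exact: wsq_ge0| |exact: wc].
  by apply: le_trans (ksq_sub_le _ _) _; rewrite !k1; lra.
have dcauchy s : (size s <= m)%N -> forall eps : R, 0 < eps -> exists N, forall k l,
    (N <= k)%N -> (N <= l)%N ->
    sqn2 (fun x => partials s (ev (w k)) x - partials s (ev (w l)) x) <= eps.
  move=> sm eps eps0; pose C : R := 4 ^+ (m - size s).
  have C0 : 0 < C by rewrite exprn_gt0.
  (* Chosen so that the bound 4/(N+1) on the squared energy is at most (eps/C)^2. *)
  have e0 : 0 < (eps / C) ^+ 2 / 4 by rewrite divr_gt0// exprn_gt0// divr_gt0.
  have [N _ HN] := @cvgr_le _ _ _ _ _ _ (@cvg_harmonic R) _ e0.
  exists N => k l Nk Nl.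
  have -> : sqn2 (fun x => partials s (ev (w k)) x - partials s (ev (w l)) x) =
      pint (pderivs s (rho ^+ m * (p k - p l)) ^+ 2).
    rewrite expr2 -ip_ev /sqn2; apply: bint_ext => x _.
    by rewrite !partials_ev [rho ^+ m * _]mulrBr pderivsB evB.
  apply: le_trans (pderivs_bound _ sm) _; rewrite -/C mulrC -ler_pdivlMr//.
  rewrite -(@ler_pXn2r _ 2) ?nnegrE ?aform_ge0 ?divr_ge0 ?(ltW eps0) ?(ltW C0)//.
  apply: le_trans (acauchy N k l Nk Nl) _.
  have := HN N (leqnn N); rewrite /= => h; rewrite mulrC -ler_pdivlMr//.
have Lw s n : L2 B (partials s (ev (w n))) by exact/smooth_L2/smooth_partials.
have exG s : exists g, (size s <= m)%N -> L2 B g /\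
    sqn2 (fun x => partials (rev s) (ev (w n)) x - g x) @[n --> \oo] --> (0 : R).
  have [sm|_] := leqP (size s) m; last by exists (fun=> 0).
  have sm' : (size (rev s) <= m)%N by rewrite size_rev.
  by have [g [Lg cg]] := L2_complete (Lw (rev s)) (dcauchy _ sm'); exists g.
have [G HG] := choice exG; pose u := G [::].
have [Lu cu] := HG [::] (leq0n m).
have wdu s : (size s <= m)%N -> wd s u (G s).
  move=> sm; have [Lg cg] := HG s sm.
  exact: (wd_limit (fun n => Lw [::] n) Lu (fun n => wd_smooth s (sw n)) Lg cu cg).
have jc : jet_cvg m (fun n => ev (w n)) u.
  apply: (jet_cvg_intro (G := fun n s => partials (rev s) (ev (w n))) (H := G)) => //.
  - by move=> n; exact: smooth_L2.
  - by move=> n s _; exact: wd_smooth.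
  - by move=> s sm; have [] := HG s sm.
have Hu : Hm0 B m u by apply: Hm0_limit jc => n; exact: Hm0_rho.
have Lf n : L2 B (ev (kop (p n))) by exact: L2_ev.
have Lwn n : L2 B (ev (w n)) by exact: L2_ev.
pose D n (x : V) := ev (w n) x - gsup * ev (kop (p n)) x.
have LD n : L2 B (D n) by apply: L2_sub => //; exact: L2_Z.
have cD : sqn2 (D n) @[n --> \oo] --> (0 : R).
  apply: (@cvg0_le R _ (fun n => 2 * gsup * n.+1%:R^-1 + 0 * n.+1%:R^-1)); last first.
    by apply: cvg0_lin; exact: cvg_harmonic.
  move=> n; rewrite sqn2_ge0 /= mul0r addr0.
  have -> : sqn2 (D n) = pint ((rho ^+ m * p n - gsup *: kop (p n)) ^+ 2).
    by rewrite expr2 -ip_ev; apply: bint_ext => x _; rewrite evB evZ.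
  apply: le_trans (@wsq_sub_ksq R d m d0 (p n)) _; rewrite k1 mulr1 ler_pM2l ?mulr_gt0//.
  by rewrite lerBlDr addrC -lerBlDr ltW.
exists u; split=> //.
  (* If the limit were 0, then gsup f_n = w_n - D_n would tend to 0, although its norm is gsup. *)
  move=> u0.
  have uz : sqn2 u = 0.
    by rewrite (sqn2_ae Lu (@L2_0 R d) u0) -[RHS](@bint0 R d); apply: bint_ext => x _; rewrite mul0r.
  have z : sqn2 (ev (w n)) @[n --> \oo] --> (0 : R).
    apply: (@cvg0_le R _ (fun n => 2 * sqn2 (fun x => ev (w n) x - u x) +
      0 * sqn2 (fun x => ev (w n) x - u x))); last exact: cvg0_lin.
    move=> n; rewrite sqn2_ge0 /= mul0r addr0.
    have := sqn2_add (L2_sub (Lwn n) Lu) Lu; rewrite uz mulr0 addr0; apply: le_trans.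
    rewrite le_eqVlt; apply/orP; left; apply/eqP; apply: bint_ext => x _.
    by rewrite !subrK.
  have gc : (fun=> gsup ^+ 2 : R) n @[n --> \oo] --> (0 : R).
    apply: (@cvg0_le R _ (fun n => 2 * sqn2 (ev (w n)) + 2 * sqn2 (D n))); last exact: cvg0_lin.
    move=> n; rewrite sqr_ge0 /=; have := sqn2_add (L2_Z (-1) (LD n)) (Lwn n).
    have -> : sqn2 (fun x => -1 * D n x + ev (w n) x) = gsup ^+ 2.
      have <- : gsup ^+ 2 * ksq (p n) = gsup ^+ 2 by rewrite k1 mulr1.
      rewrite /ksq -pintZ; apply: bint_ext => x _; rewrite evZ evX /D; ring.
    have -> : sqn2 (fun x => -1 * D n x) = sqn2 (D n) by apply: bint_ext => x _; ring.
    by rewrite addrC.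
  have g20 : gsup ^+ 2 = 0 by exact: (cvg_unique (@Rhausdorff R) (cvg_cst (gsup ^+ 2)) gc).
  by move/eqP: g20; rewrite sqrf_eq0 gt_eqF.
move=> v Hv; have Lv := Hm_L2 (Hm0_Hm Hv).
have c1 := form_cvg jc (Hm0_Hm Hv).
have cw : ip (ev (w n)) v @[n --> \oo] --> ip u v by exact: ip_cvg.
have c2 : ip (D n) v @[n --> \oo] --> (0 : R).
  apply: (cvg0_sqr (c := ip v v) _ cD) => n; rewrite mulrC; exact: ip_CS.
have E n : form (ev (w n)) v = gsup^-1 * (ip (ev (w n)) v - ip (D n) v).
  rewrite (form_kop _ Hv) /D ip_subl//; last exact: L2_Z.
  rewrite opprB addrC subrK.
  have -> : ip (fun x => gsup * ev (kop (p n)) x) v = gsup * ip (ev (kop (p n))) v.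
    by rewrite /ip -bintZ; [apply: bint_ext => x _; rewrite mulrA|exact: L2_mul_int].
  by rewrite mulKf// gt_eqF.
have c3 : (gsup^-1 * (ip (ev (w n)) v - ip (D n) v)) @[n --> \oo] --> gsup^-1 * (ip u v - 0).
  by apply: cvgM; [exact: cvg_cst|exact: cvgB].
have FE : (fun n => form (ev (w n)) v) = fun n => gsup^-1 * (ip (ev (w n)) v - ip (D n) v).
  by apply/funext => n; exact: E.
by rewrite subr0 -FE in c3; exact: (cvg_unique (@Rhausdorff R) c1 c3).
Qed.

(* If u is an eigenfunction for lam, the moment functional l(f) = <f, u> satisfies
   l(kop p) = lam l(rho^m p); iterating this with wsq p <= gsup^2 ksq p shows that l
   vanishes when |lam| gsup < 1. *)
Lemma eigenvalue_ge_gsup lam : is_eigenvalue B m lam -> gsup^-1 <= lam.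
Proof.
have g0 := @gsup_gt0 R d m d0.
move=> [u [Hu u0 eig]]; rewrite leNgt; apply/negP => lt_lam; apply: u0.
have Lu := Hm_L2 (Hm0_Hm Hu).
have lg : lam * gsup < 1 by rewrite -ltr_pdivlMr// mul1r.
(* Very negative values are excluded by the sign of the form: lam < 0 and form(u, u) >= 0 force u to
   have norm 0. *)
have [neg|lg1] := leP (lam * gsup) (-1).
  apply: ip_ae0 => //; apply/eqP; rewrite eq_le ip_ge0 andbT.
  have lam0 : lam < 0 by rewrite -(pmulr_llt0 _ g0); lra.
  by have := form_ge0 m u; rewrite (eig _ Hu) nmulr_rge0.
apply: moments_ae0 => // f; rewrite -/(ip u (ev f)) ipC.
have step p : ip (ev (kop p)) u = lam * ip (ev (rho ^+ m * p)) u.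
  by rewrite -form_kop// formC (eig _ (Hm0_rho m p)) ipC.
have bound n q : ip (ev q) u ^+ 2 <= (lam * gsup) ^+ 2 ^+ n * (pint (q ^+ 2) * ip u u).
  elim: n q => [|n IH] q; first by rewrite mul1r expr2 -ip_ev; exact: ip_CS (L2_ev q) Lu.
  have [p <-] := kop_surj m d0 q; rewrite step exprMn.
  apply: le_trans (ler_wpM2l (sqr_ge0 lam) (IH _)) _.
  rewrite [in leRHS]exprS [in X in _ <= X * _ * _]exprMn.
  have := @wsq_le_ksq R d m d0 p; rewrite /wsq /ksq => h.
  have X0 : 0 <= lam ^+ 2 * (lam * gsup) ^+ 2 ^+ n * ip u u.
    by apply: mulr_ge0 (ip_ge0 u); apply: mulr_ge0 (sqr_ge0 _) (exprn_ge0 _ (sqr_ge0 _)).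
  have := ler_wpM2l X0 h; move: (ip u u) (pint _) (pint _) (_ ^+ n) => a b c e h'.
  by apply: le_trans (le_trans h' _); rewrite le_eqVlt; apply/orP; left; apply/eqP; ring.
apply: (sqr_le_cvg0 (c := pint (f ^+ 2) * ip u u) (u := fun n => (lam * gsup) ^+ 2 ^+ n)).
  by move=> n; rewrite mulrC.
apply: cvg_expr; rewrite ger0_norm ?sqr_ge0//.
by move: (lam * gsup) lg lg1 => r; nra.
Qed.

Lemma first_eigenvalueE : first_eigenvalue B m = gsup^-1.
Proof.
have H : is_first_eigenvalue B m gsup^-1.
  by split; [exact: eigenvalue_gsup|exact: eigenvalue_ge_gsup].
rewrite /first_eigenvalue; case: xgetP => [lam -> [e le]|/(_ _ H)//].
by apply/eqP; rewrite eq_le le ?eigenvalue_ge_gsup//; exact: eigenvalue_gsup.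
Qed.

Lemma first_eigenvalue_ge : cst_lower R d m <= first_eigenvalue B m.
Proof.
have g0 := @gsup_gt0 R d m d0; have c0 := @cst_lower_gt0 R d m d0.
by rewrite first_eigenvalueE -[leLHS]invrK lef_pV2 ?posrE ?invr_gt0// gsup_le.
Qed.

(** This is [wsq_le_aform] at p = 1, where [kop] takes the constant value [cst_lower]. *)
Lemma first_eigenvalue_le :
  first_eigenvalue B m <= cst_lower R d m * pint (rho ^+ m) / pint (rho ^+ (m + m)).
Proof.
have g0 := @gsup_gt0 R d m d0.
have aE : aform 1 1 = cst_lower R d m * pint (rho ^+ m).
  by rewrite /aform /wip kop1 -scalerAr !mulr1 pintZ.
have wE : wsq 1 = pint (rho ^+ (m + m)) by rewrite /wsq mulr1 -exprM muln2 addnn.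
have := @wsq_le_aform R d m d0 1; rewrite first_eigenvalueE -aE wE => h.
by rewrite ler_pdivlMr ?pint_rhoX_gt0// mulrC ler_pdivrMr// mulrC.
Qed.

End first_eigenvalue.

(** * The Gamma function and Stirling's formula *)

Section gamma_function.
Context (R : realType).
Local Notation leb := (@lebesgue_measure R).
Implicit Types (x t : R).

Definition gamma_fun x t : R := t `^ (x - 1) * expR (- t).

Definition hline : set R := `]0%R, +oo[%classic.

(** [Gamma] is the [fine] part and would hide divergence as 0; in the extended reals, finiteness is
    obtained together with the value. *)
Definition egamma x : \bar R := (\int[leb]_(t in hline) (gamma_fun x t)%:E)%E.

Lemma GammaE x : Gamma x = fine (egamma x). Proof. by []. Qed.

Lemma gamma_fun_ge0 x t : 0 <= gamma_fun x t.
Proof. by rewrite mulr_ge0 ?powR_ge0 ?expR_ge0. Qed.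

Lemma measurable_gamma_fun x (D : set R) : measurable_fun D (gamma_fun x).
Proof.
apply: measurable_funTS; apply: measurable_funM; first exact: measurable_powR.
by apply: measurableT_comp => //; exact: measurable_funN.
Qed.

Lemma is_derive_gamma_fun x t : 0 < t ->
  is_derive t 1 (gamma_fun (x + 1)) (x * gamma_fun x t - gamma_fun (x + 1) t).
Proof.
move=> t0; have dE : is_derive t 1 (fun s : R => expR (- s)) (- expR (- t)).
  have := @is_derive1_comp _ expR -%R t _ _ (is_derive_expR (- t)) (is_deriveNid _ _).
  by rewrite mulrN1.
have dP := is_derive1_powR (x + 1 - 1) t0.
have := is_deriveM dP dE => H; apply: (is_derive_eq H).
rewrite /gamma_fun /GRing.scale /= addrK; ring.
Qed.

Lemma gamma_fun_cont x t : 0 < t -> {for t, continuous (gamma_fun x)}.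
Proof.
move=> t0; apply: differentiable_continuous; apply/derivable1_diffP.
by have [] := is_derive_gamma_fun (x - 1) t0; rewrite subrK.
Qed.

(** Compact intervals exhausting the half-line, on which the integrand is continuous and integrable.
    Starting at 2 makes every one of them nondegenerate. *)
Definition trunc n : set R := `[n.+2%:R^-1, n.+2%:R]%classic.

Lemma measurable_trunc n : measurable (trunc n).
Proof. exact: measurable_itv. Qed.

Lemma trunc_lt n : (n.+2%:R^-1 : R) < n.+2%:R.
Proof.
apply: (@lt_trans _ _ 1); last by rewrite ltr1n.
by rewrite invf_lt1 ?ltr0n// ltr1n.
Qed.

Lemma trunc_gt0 n t : trunc n t -> 0 < t.
Proof. by rewrite /trunc /= in_itv /= => /andP[+ _]; apply: lt_le_trans; rewrite invr_gt0. Qed.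

Lemma trunc_bigcup : \bigcup_n trunc n = hline.
Proof.
apply/seteqP; split=> t; first by move=> [n _ /trunc_gt0 t0]; rewrite /hline /= in_itv /= t0.
rewrite /hline /= in_itv /= andbT => t0; exists (Num.bound t + Num.bound t^-1)%N => //.
have h1 := archi_boundP (ltW t0); have t1 : 0 <= t^-1 by rewrite invr_ge0 ltW.
have h2 := archi_boundP t1.
rewrite /trunc /= in_itv /=; apply/andP; split.
  rewrite -[leRHS]invrK lef_pV2 ?posrE ?invr_gt0//; apply: le_trans (ltW h2) _.
  by rewrite ler_nat; lia.
by apply: le_trans (ltW h1) _; rewrite ler_nat; lia.
Qed.

Lemma trunc_homo : {homo trunc : n k / (n <= k)%N >-> (n <= k)%O}.
Proof.
move=> n k nk; apply/subsetPset => t; rewrite /trunc /= !in_itv /= => /andP[a b].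
apply/andP; split; last by apply: le_trans b _; rewrite ler_nat.
by apply: le_trans a; rewrite lef_pV2 ?posrE ?ltr0n// ler_nat.
Qed.

Lemma cvg_trunc (f : R -> R) : measurable_fun hline f -> (forall t, 0 < t -> 0 <= f t) ->
  (\int[leb]_(t in trunc n) (f t)%:E)%E @[n --> \oo] -->
  (\int[leb]_(t in hline) (f t)%:E)%E.
Proof.
move=> mf f0; rewrite -trunc_bigcup; apply: ge0_nondecreasing_set_cvg_integral.
- exact: trunc_homo.
- exact: measurable_trunc.
- move=> n; apply/measurable_EFinP; apply: measurable_funS mf; first exact: measurable_itv.
  by rewrite -trunc_bigcup; exact: (@bigcup_sup _ _ n).
- by move=> n t /trunc_gt0 t0; rewrite lee_fin f0.
Qed.

Definition igamma n x : R := \int[leb]_(t in trunc n) gamma_fun x t.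

Lemma integrable_trunc n x : leb.-integrable (trunc n) (EFin \o gamma_fun x).
Proof.
apply: continuous_compact_integrable; first exact: segment_compact.
apply: continuous_in_subspaceT => t; rewrite inE => /trunc_gt0 t0.
exact: gamma_fun_cont.
Qed.

Lemma igammaE n x : (\int[leb]_(t in trunc n) (gamma_fun x t)%:E)%E = (igamma n x)%:E.
Proof.
rewrite /igamma /Rintegral fineK//.
exact: (@integrable_fin_num _ _ _ leb _ (@measurable_trunc n) _ (integrable_trunc n x)).
Qed.

Lemma cvg_igamma x : (igamma n x)%:E @[n --> \oo] --> egamma x.
Proof.
under eq_fun do rewrite -igammaE; apply: cvg_trunc; first exact: measurable_gamma_fun.
by move=> t _; exact: gamma_fun_ge0.
Qed.

Lemma egamma_fin x : egamma x \is a fin_num -> igamma n x @[n --> \oo] --> Gamma x.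
Proof.
move=> fx; have c : (igamma n x)%:E @[n --> \oo] --> (Gamma x)%:E.
  by rewrite GammaE fineK//; exact: (@cvg_igamma x).
exact: (fine_cvg c).
Qed.

Lemma egammaP x (l : R) : igamma n x @[n --> \oo] --> l -> egamma x = l%:E.
Proof.
move=> c; have c' : (igamma n x)%:E @[n --> \oo] --> l%:E by apply: cvg_EFin => //; exact: nearW.
by rewrite -(cvg_lim _ (@cvg_igamma x))//; exact: cvg_lim c'.
Qed.

Lemma igammaS n x : igamma n (x + 1) =
  x * igamma n x - (gamma_fun (x + 1) n.+2%:R - gamma_fun (x + 1) n.+2%:R^-1).
Proof.
have mt := measurable_trunc n.
have I0 := integrable_trunc n x; have I1 := integrable_trunc n (x + 1).
have Ix : leb.-integrable (trunc n) (EFin \o (fun t => x * gamma_fun x t)).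
  by rewrite (_ : EFin \o _ = (fun t => x%:E * (gamma_fun x t)%:E)%E)//; exact: integrableZl.
have a0 : 0 < (n.+2%:R^-1 : R) by rewrite invr_gt0.
have E : (\int[leb]_(t in trunc n) (x * gamma_fun x t - gamma_fun (x + 1) t)%:E)%E =
    ((gamma_fun (x + 1) n.+2%:R)%:E - (gamma_fun (x + 1) n.+2%:R^-1)%:E)%E.
  apply: (continuous_FTC2 (trunc_lt n)).
  - apply: continuous_in_subspaceT => t; rewrite inE => /trunc_gt0 t0.
    apply: cvgB; last exact: gamma_fun_cont.
    by apply: cvgM; [exact: cvg_cst|exact: gamma_fun_cont].
  - split.
    + move=> t; rewrite in_itv /= => /andP[at_ _]; have t0 := lt_trans a0 at_.
      by have [] := is_derive_gamma_fun x t0.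
    + apply: cvg_at_right_filter; exact: gamma_fun_cont.
    + by apply: cvg_at_left_filter; apply: gamma_fun_cont; rewrite ltr0n.
  - move=> t; rewrite in_itv /= => /andP[at_ _]; have t0 := lt_trans a0 at_.
    by rewrite derive1E; have [_ ->] := is_derive_gamma_fun x t0.
have : \int[leb]_(t in trunc n) (x * gamma_fun x t - gamma_fun (x + 1) t) =
    gamma_fun (x + 1) n.+2%:R - gamma_fun (x + 1) n.+2%:R^-1 by rewrite /Rintegral E.
by rewrite RintegralB// RintegralZl// -!/(igamma _ _) => <-; ring.
Qed.

Lemma cvg_powR_expRN x : gamma_fun (x + 1) n.+2%:R @[n --> \oo] --> (0 : R).
Proof.
pose k := Num.bound `|x|; have kx : x <= k%:R.
  by apply: le_trans (ler_norm x) _; apply: ltW; exact: archi_boundP.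
apply: (@cvg0_le R _ (fun n => k.+1`!%:R * n.+1%:R^-1 + 0 * n.+1%:R^-1)); last first.
  by apply: cvg0_lin; exact: cvg_harmonic.
move=> n; rewrite gamma_fun_ge0 /= mul0r addr0 /gamma_fun addrK.
set t : R := n.+2%:R; have t0 : 0 < t by rewrite ltr0n.
have t1 : 1 <= t by rewrite ler1n.
(* Read at 1/t, the bound says exp (-t) t^(k+1) <= (k+1)!. *)
have := flat_le k.+1 t^-1; rewrite /flat invr_gt0 t0 invrK => h.
apply: (@le_trans _ _ (k.+1`!%:R * t^-1)); last first.
  by rewrite ler_wpM2l// lef_pV2 ?posrE ?ltr0n// ler_nat.
have tx : t `^ x <= t ^+ k.
  by apply: le_trans (ler_powR t1 kx) _; rewrite powR_mulrn// ltW.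
rewrite ler_pdivlMr//; apply: le_trans h; rewrite exprS.
have e0 : 0 <= expR (- t) * t by rewrite mulr_ge0 ?expR_ge0 ?(ltW t0).
have := ler_wpM2l e0 tx; move: (t `^ x) (t ^+ k) (expR _) => a b c; rewrite mulrA.
by rewrite [c * t * a]mulrC mulrA.
Qed.

(** For t <= 1 and x >= 1/2, the power t^x is at most the square root of t; half-integer arguments
    ask for no more. *)
Lemma cvg_gamma_fun0 x : 2^-1 <= x -> gamma_fun (x + 1) n.+2%:R^-1 @[n --> \oo] --> (0 : R).
Proof.
move=> x2; pose e (n : nat) : R := n.+2%:R^-1.
have e01 n : 0 < e n <= 1 by rewrite invr_gt0 ltr0n /= invf_le1 ?ler1n.
have e0 : e n @[n --> \oo] --> (0 : R).
  apply: (@cvg0_le R _ (fun n => n.+1%:R^-1)); last exact: cvg_harmonic.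
  by move=> n; rewrite invr_ge0 ler0n /= lef_pV2 ?posrE ?ltr0n// ler_nat.
apply: (@cvg0_le R _ (fun n => Num.sqrt (e n))); last first.
  by have := cvg_comp e Num.sqrt e0 (@sqrt_continuous R 0); rewrite sqrtr0.
move=> n; rewrite gamma_fun_ge0 /= /gamma_fun addrK -/(e n).
have /andP[en0 en1] := e01 n; rewrite -(powR12_sqrt (ltW en0)) -[leRHS]mulr1.
apply: ler_pM; rewrite ?powR_ge0 ?expR_ge0 ?ger_powR//.
by rewrite -expR0 ler_expR oppr_le0 (ltW en0).
Qed.

Lemma egammaS x : 2^-1 <= x -> egamma x \is a fin_num -> egamma (x + 1) = (x * Gamma x)%:E.
Proof.
move=> x2 fx; apply: egammaP; rewrite -[x * _]subr0 -[X in _ - X](subr0 0).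
under eq_fun do rewrite igammaS.
apply: cvgB; first by apply: cvgM; [exact: cvg_cst|exact: egamma_fin].
by apply: cvgB; [exact: cvg_powR_expRN|exact: cvg_gamma_fun0].
Qed.

Lemma egamma1 : egamma 1 = 1%:E.
Proof.
apply: egammaP; have E n : igamma n 1 = expR (- n.+2%:R^-1) - gamma_fun (0 + 1) n.+2%:R.
  rewrite -{1}(add0r 1) igammaS mul0r sub0r opprB; congr (_ - _).
  by rewrite /gamma_fun addrK powRr0 mul1r.
rewrite (_ : (fun n => _) = fun n => expR (- n.+2%:R^-1) - gamma_fun (0 + 1) n.+2%:R); last exact/funext.
rewrite -[X in _ --> X](subr0 1); apply: cvgB; last exact: cvg_powR_expRN.
apply: (@squeeze_cvgr _ _ _ _ (fun n : nat => 1 - n.+1%:R^-1) (fun=> 1)).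
- apply: nearW => n; apply/andP; split; last by rewrite -[leRHS]expR0 ler_expR oppr_le0 invr_ge0.
  apply: le_trans (expR_ge1Dx _); rewrite lerD2l lerN2.
  by rewrite lef_pV2 ?posrE ?ltr0n// ler_nat.
- by rewrite -[X in _ --> X](subr0 (1 : R)); apply: cvgB; [exact: cvg_cst|exact: cvg_harmonic].
- exact: cvg_cst.
Qed.

End gamma_function.

Section half_integers.
Context (R : realType).
Local Notation leb := (@lebesgue_measure R).
Local Notation I0 := (@gauss_integral_proof.integral0_gauss R).
Implicit Types (x t : R).

Lemma is_derive_gauss x : 0 < x -> is_derive x 1 I0 (gauss_fun x).
Proof.
move=> x0; have [||||dF Fx] := @continuous_FTC1_closed R (@gauss_fun R) 0 x (x + 1).
- by rewrite ltrDl.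
- apply: continuous_compact_integrable; first exact: segment_compact.
  by apply: continuous_subspaceT; exact: continuous_gauss_fun.
- exact: x0.
- exact: continuous_gauss_fun.
exact: (DeriveDef dF (etrans (esym (derive1E _ _)) Fx)).
Qed.

Lemma gauss_integral_le x : 0 <= x -> I0 x <= x.
Proof.
move=> x0; have E : \int[leb]_(t in `[0, x]) cst (1 : R) t = x.
  rewrite Rintegral_cst ?mul1r; last exact: measurable_itv.
  rewrite /= lebesgue_measure_itv /= lte_fin; case: ifP => [_|/negbT]; rewrite /= ?oppr0 ?addr0//.
  rewrite -leNgt => xle; by apply/le_anti; rewrite x0 xle.
rewrite -[leRHS]E; apply: le_Rintegral.
- exact: measurable_itv.
- apply: continuous_compact_integrable; first exact: segment_compact.
  by apply: continuous_subspaceT; exact: continuous_gauss_fun.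
- apply: continuous_compact_integrable; first exact: segment_compact.
  by apply: continuous_subspaceT => t; exact: cvg_cst.
- by move=> t _; exact: gauss_fun_le1.
Qed.

(** The substitution t = s^2 in differential form: it links Gamma(1/2) to the Gauss integral. *)
Lemma is_derive_gauss_sqrt t : 0 < t ->
  is_derive t 1 (fun s => 2 * I0 (Num.sqrt s)) (gamma_fun 2^-1 t).
Proof.
move=> t0; have s0 : 0 < Num.sqrt t by rewrite sqrtr_gt0.
have := is_derive1_comp (is_derive_gauss s0) (is_derive1_sqrt t0) => H.
have := @is_deriveZ _ _ _ (I0 \o Num.sqrt) 2 t 1 _ H => H2; apply: (is_derive_eq H2).
rewrite /GRing.scale /= /gauss_fun sqr_sqrtr ?ltW// /gamma_fun.
have -> : t `^ (2^-1 - 1) = (Num.sqrt t)^-1.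
  by rewrite -powR12_sqrt ?ltW// -powRN; congr (_ `^ _); lra.
by field; rewrite gt_eqF.
Qed.

Lemma egamma_half : egamma (2^-1 : R) = (Num.sqrt pi)%:E.
Proof.
apply: egammaP.
have E n : igamma n 2^-1 = 2 * I0 (Num.sqrt n.+2%:R) - 2 * I0 (Num.sqrt n.+2%:R^-1).
  have D (t : R) : 0 < t -> {for t, continuous (fun s => 2 * I0 (Num.sqrt s))}.
    move=> t0; apply: differentiable_continuous; apply/derivable1_diffP.
    by have [] := is_derive_gauss_sqrt t0.
  have a0 : 0 < (n.+2%:R^-1 : R) by rewrite invr_gt0.
  suff H : (\int[leb]_(t in trunc n) (gamma_fun 2^-1 t)%:E)%E =
    ((2 * I0 (Num.sqrt n.+2%:R))%:E - (2 * I0 (Num.sqrt n.+2%:R^-1))%:E)%E by rewrite /igamma /Rintegral H.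
  apply: (continuous_FTC2 (F := fun s => 2 * I0 (Num.sqrt s)) (trunc_lt _ n)).
  - apply: continuous_in_subspaceT => t; rewrite inE => /(@trunc_gt0 R n) t0.
    exact: gamma_fun_cont.
  - split.
    + move=> t; rewrite in_itv /= => /andP[at_ _]; have t0 := lt_trans a0 at_.
      by have [] := is_derive_gauss_sqrt t0.
    + by apply: cvg_at_right_filter; exact: D.
    + by apply: cvg_at_left_filter; apply: D; rewrite ltr0n.
  - move=> t; rewrite in_itv /= => /andP[at_ _]; have t0 := lt_trans a0 at_.
    by rewrite derive1E; have [_ ->] := is_derive_gauss_sqrt t0.
rewrite (_ : (fun n => _) = fun n => 2 * I0 (Num.sqrt n.+2%:R) - 2 * I0 (Num.sqrt n.+2%:R^-1)); last exact/funext.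
have c1 : I0 (Num.sqrt n.+2%:R) @[n --> \oo] --> Num.sqrt pi / 2.
  have inf : Num.sqrt (n.+2%:R : R) @[n --> \oo] --> +oo.
    apply/cvgryPge => A; near=> n; apply: le_trans (ler_norm A) _.
    rewrite -sqrtr_sqr ler_sqrt ?ler0n//; apply: (@le_trans _ _ n%:R); last by rewrite ler_nat ltnW.
    by near: n; exact: nbhs_infty_ger.
  have := cvg_comp _ _ inf (@gauss_integral_proof.cvg_integral0_gauss_sqr R) => c.
  have := cvg_comp _ _ c (@sqrt_continuous R (pi / 4)).
  have -> : Num.sqrt (pi / 4) = Num.sqrt pi / 2 :> R.
    rewrite sqrtrM ?pi_ge0// sqrtrV// (_ : 4 = 2 ^+ 2); last by rewrite expr2 -natrM.
    by rewrite sqrtr_sqr ger0_norm.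
  rewrite (_ : _ \o _ = fun n => I0 (Num.sqrt n.+2%:R))//; apply/funext => n /=.
  by rewrite sqrtr_sqr ger0_norm// gauss_integral_proof.integral0_gauss_ge0.
have c2 : I0 (Num.sqrt n.+2%:R^-1) @[n --> \oo] --> (0 : R).
  have e0 : (n.+2%:R^-1 : R) @[n --> \oo] --> (0 : R).
    apply: (@cvg0_le R _ (fun n => n.+1%:R^-1)); last exact: cvg_harmonic.
    by move=> n; rewrite invr_ge0 ler0n /= lef_pV2 ?posrE ?ltr0n// ler_nat.
  apply: (@cvg0_le R _ (fun n => Num.sqrt n.+2%:R^-1)).
    by move=> n; rewrite gauss_integral_proof.integral0_gauss_ge0 gauss_integral_le// sqrtr_ge0.
  by have := cvg_comp _ Num.sqrt e0 (@sqrt_continuous R 0); rewrite sqrtr0.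
have -> : Num.sqrt pi = 2 * (Num.sqrt pi / 2) - 2 * 0 :> R by field.
by apply: cvgB; apply: cvgM => //; exact: cvg_cst.
Unshelve. all: by end_near. Qed.

Lemma gamma_fun_addhalf x t : 0 < t ->
  gamma_fun (x + 2^-1) t = gamma_fun x t * Num.sqrt t.
Proof.
move=> t0; rewrite /gamma_fun (_ : x + 2^-1 - 1 = (x - 1) + 2^-1); last by ring.
have nz : (x - 1 + 2^-1 == 0) ==> (t != 0) by rewrite (gt_eqF t0) implybT.
by rewrite (powRD nz) (powR12_sqrt (ltW t0)) mulrAC.
Qed.

(** Cauchy-Schwarz for the functions 1 and t^(1/2) with weight t^(x-1) exp (-t). It yields
    log-convexity of Gamma in half steps. *)
Lemma igamma_CS n x : igamma n (x + 2^-1) ^+ 2 <= igamma n x * igamma n (x + 1) :> R.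
Proof.
have mt : @measurable _ (measurableTypeR R) (trunc n) by exact: measurable_itv.
have I x' : leb.-integrable (trunc n) (EFin \o gamma_fun x') by exact: integrable_trunc.
have IZ (c : R) x' : leb.-integrable (trunc n) (EFin \o (fun t => c * gamma_fun x' t)).
  by have := integrableZl mt c (I x'); congr (leb.-integrable _ _).
apply: quad_CS => [|s u].
  by apply: Rintegral_ge0 => t _; exact: gamma_fun_ge0.
have -> : s ^+ 2 * igamma n x + s * u * (2 * igamma n (x + 2^-1)) + u ^+ 2 * igamma n (x + 1) =
    \int[leb]_(t in trunc n) ((s ^+ 2 * gamma_fun x t + s * u * 2 * gamma_fun (x + 2^-1) t) +
      u ^+ 2 * gamma_fun (x + 1) t).
  rewrite RintegralD//; last first.
    have := integrableD mt (IZ (s ^+ 2) x) (IZ (s * u * 2) (x + 2^-1)).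
    by congr (leb.-integrable _ _).
  by rewrite RintegralD// !RintegralZl// -!/(igamma _ _); ring.
apply: Rintegral_ge0 => t /trunc_gt0 t0.
have r0 : 0 <= gamma_fun x t by exact: gamma_fun_ge0.
set r := Num.sqrt t.
have -> : gamma_fun (x + 1) t = gamma_fun x t * r * r.
  by rewrite -!gamma_fun_addhalf//; congr (gamma_fun _ t); lra.
rewrite gamma_fun_addhalf// -/r.
rewrite (_ : _ + _ = gamma_fun x t * (s + u * r) ^+ 2); last by ring.
by rewrite mulr_ge0// sqr_ge0.
Qed.

Lemma egamma_half_fin k : egamma (k.+1%:R / 2 : R) \is a fin_num.
Proof.
suff [] : egamma (k.+1%:R / 2 : R) \is a fin_num /\ egamma (k.+2%:R / 2 : R) \is a fin_num by [].
elim: k => [|k [IH1 IH2]].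
  by rewrite mul1r egamma_half divff// egamma1.
split; first exact: IH2.
rewrite (_ : k.+3%:R / 2 = k.+1%:R / 2 + 1 :> R); last by rewrite -!natr1; field.
rewrite egammaS// -[leLHS]mul1r ler_pM2r ?invr_gt0// ler1n//.
Qed.

(** The shift starts the table at Gamma(1/2) and makes [hgamma k] equal to Gamma(d/2) for d = k + 1.
    The functional equation becomes a recursion in steps of two, so inductions carry two consecutive
    values. *)
Definition hgamma k : R := Gamma (k.+1%:R / 2).

Lemma hgammaSS k : hgamma k.+2 = k.+1%:R / 2 * hgamma k.
Proof.
rewrite /hgamma (_ : k.+3%:R / 2 = k.+1%:R / 2 + 1 :> R); last by rewrite -!natr1; field.
rewrite GammaE egammaS//; first by rewrite -[leLHS]mul1r ler_pM2r ?invr_gt0// ler1n.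
exact: egamma_half_fin.
Qed.

Lemma hgamma0 : hgamma 0 = Num.sqrt pi.
Proof. by rewrite /hgamma mul1r GammaE egamma_half. Qed.

Lemma hgamma1 : hgamma 1 = 1.
Proof. by rewrite /hgamma divff// GammaE egamma1. Qed.

Lemma hgamma_gt0 k : 0 < hgamma k.
Proof.
suff [] : 0 < hgamma k /\ 0 < hgamma k.+1 by [].
elim: k => [|k [IH1 IH2]]; first by rewrite hgamma0 hgamma1 sqrtr_gt0 pi_gt0.
split; first exact: IH2.
by rewrite hgammaSS; apply: mulr_gt0 IH1; rewrite divr_gt0 ?ltr0n.
Qed.

Lemma hgamma_fact m : hgamma (m.*2).+1 = m`!%:R.
Proof.
elim: m => [|m IH]; first exact: hgamma1.
rewrite doubleS hgammaSS IH factS natrM; congr (_ * _).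
by rewrite -doubleS -muln2 natrM mulfK.
Qed.

Lemma hgamma_CS k : hgamma k.+1 ^+ 2 <= hgamma k * hgamma k.+2.
Proof.
have c j := egamma_fin (egamma_half_fin j).
have E1 : k.+2%:R / 2 = k.+1%:R / 2 + 2^-1 :> R by rewrite -!natr1; field.
have E2 : k.+3%:R / 2 = k.+1%:R / 2 + 1 :> R by rewrite -!natr1; field.
have := c k.+2; have := c k.+1; rewrite E1 E2 => c1 c2; have c0 := c k.
have l : igamma n (k.+1%:R / 2 + 2^-1) ^+ 2 @[n --> \oo] --> Gamma (k.+1%:R / 2 + 2^-1 : R) ^+ 2.
  by rewrite expr2; under eq_fun do rewrite expr2; exact: (cvgM c1 c1).
have r : igamma n (k.+1%:R / 2) * igamma n (k.+1%:R / 2 + 1) @[n --> \oo] -->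
    (Gamma (k.+1%:R / 2) * Gamma (k.+1%:R / 2 + 1) : R) by exact: (cvgM c0 c2).
rewrite /hgamma E1 E2.
rewrite -(cvg_lim (@Rhausdorff R) l) -(cvg_lim (@Rhausdorff R) r).
apply: ler_lim; [exact: cvgP l|exact: cvgP r|].
by apply: nearW => n; exact: igamma_CS.
Qed.

End half_integers.

(** * Stirling's formula and quotients of Gamma values *)

Section stirling.
Context (R : realType).
Implicit Types (x : R).
Local Notation hgamma := (@hgamma R).

Lemma deriv_ge0_ge0 (f f' : R -> R) : f 0 = 0 ->
  (forall x, 0 <= x -> is_derive x 1 f (f' x)) -> (forall x, 0 <= x -> 0 <= f' x) ->
  forall x, 0 <= x -> 0 <= f x.
Proof.
move=> f0 df f'0 x x0; rewrite -f0.
apply: (@ger0_derive1_ndecry R f 0) => // [y|y|].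
- by rewrite in_itv /= andbT => /ltW y0; have [] := df _ y0.
- by rewrite in_itv /= andbT => /ltW y0; rewrite derive1E; have [_ ->] := df _ y0; exact: f'0.
- apply: continuous_in_subspaceT => y; rewrite inE /= in_itv /= andbT => y0.
  by apply: differentiable_continuous; apply/derivable1_diffP; have [] := df _ y0.
Qed.

Lemma is_derive_ln1 x : 0 <= x -> is_derive x 1 (fun y => ln (1 + y)) (1 + x)^-1.
Proof.
move=> x0; have p : 0 < 1 + x by lra.
have dD : is_derive x 1 (fun y : R => 1 + y) 1.
  have := is_deriveD (is_derive_cst (1 : R) x 1) (is_derive_id x (1 : R)).
  by rewrite add0r.
have := @is_derive1_comp R (@ln R) (fun y => 1 + y) x _ _ (is_derive1_ln p) dD.
by rewrite mulr1.
Qed.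

(** At x = 1/N the left side is 2/(2N+1), exactly what makes the increments of [ln (stir n)]
    nonpositive. *)
Lemma ln1_ge x : 0 <= x -> 2 * x / (2 + x) <= ln (1 + x).
Proof.
move=> x0; rewrite -subr_ge0.
apply: (@deriv_ge0_ge0 (fun x => ln (1 + x) - 2 * x / (2 + x))
  (fun x => (1 + x)^-1 - 4 * (2 + x) ^- 2)) => // [|y y0|y y0].
- by rewrite addr0 ln1 mulr0 mul0r subrr.
- have nz : 2 + y != 0 by rewrite gt_eqF//; lra.
  have dn : is_derive y 1 (fun y : R => 2 * y) 2.
    have := is_deriveZ (2 : R) (is_derive_id y (1 : R)).
    by rewrite /GRing.scale /= mulr1.
  have dd : is_derive y 1 (fun y : R => 2 + y) 1.
    have := is_deriveD (is_derive_cst (2 : R) y 1) (is_derive_id y (1 : R)).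
    by rewrite add0r.
  have := is_deriveB (is_derive_ln1 y0) (is_deriveM dn (is_deriveV nz dd)) => H.
  by apply: (is_derive_eq H); rewrite /GRing.scale /=; field; apply/andP; split; rewrite gt_eqF//; lra.
- rewrite (_ : _ - _ = y ^+ 2 / ((1 + y) * (2 + y) ^+ 2)).
    by rewrite divr_ge0 ?sqr_ge0// mulr_ge0 ?sqr_ge0//; lra.
  by field; apply/andP; split; rewrite gt_eqF//; lra.
Qed.

(** Third order makes the terms in 1/N cancel: the increments of [ln (stir n)] are then at least
    -(1/(6 N^2) + 1/(3 N^3)), which 1/N - 1/(N+1) compensates. *)
Lemma ln1_le x : 0 <= x -> ln (1 + x) <= x - x ^+ 2 / 2 + x ^+ 3 / 3.
Proof.
move=> x0; rewrite -subr_ge0.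
pose F (y : R) := y - 2^-1 * (y * y) + 3^-1 * (y * y * y) - ln (1 + y).
pose F' (y : R) := 1 - y + y ^+ 2 - (1 + y)^-1.
have F0 : F 0 = 0 by rewrite /F addr0 ln1; ring.
have dF (y : R) : 0 <= y -> is_derive y 1 F (F' y).
  move=> y0; have d1 := is_derive_id y (1 : R); have d2 := is_deriveM d1 d1.
  have H := is_deriveB (is_deriveD (is_deriveB d1 (is_deriveZ 2^-1 d2))
    (is_deriveZ 3^-1 (is_deriveM d2 d1))) (is_derive_ln1 y0).
  apply: (is_derive_eq H); rewrite /F' /GRing.scale /=.
  by rewrite mulrfctE; field; rewrite gt_eqF//; lra.
have F'0 (y : R) : 0 <= y -> 0 <= F' y.
  move=> y0; rewrite /F' (_ : _ - _ = y ^+ 3 / (1 + y)).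
    by rewrite divr_ge0 ?exprn_ge0//; lra.
  by field; rewrite gt_eqF//; lra.
have := deriv_ge0_ge0 F0 dF F'0 x0; rewrite /F; congr (0 <= _ - _).
by field.
Qed.

(* The square of n! / ((n / e)^n n^(1/2)). *)
Definition stir (n : nat) : R :=
  n`!%:R ^+ 2 * expR (2 * n%:R) / (n%:R ^+ (2 * n) * n%:R).

Lemma stir_gt0 n : (0 < n)%N -> 0 < stir n.
Proof.
move=> n0; have nR : 0 < (n%:R : R) by rewrite ltr0n.
by rewrite /stir divr_gt0 ?mulr_gt0 ?exprn_gt0 ?expR_gt0// ltr0n fact_gt0.
Qed.

Lemma ln_stirS n (N := n.+1%:R : R) :
  ln (stir n.+2) = ln (stir n.+1) + (2 - (2 * N + 1) * ln (1 + N^-1)).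
Proof.
have N0 : 0 < N by rewrite ltr0n.
have X0 : 0 < 1 + N^-1 by rewrite addr_gt0// invr_gt0.
have E : stir n.+2 = stir n.+1 * expR (2 - (2 * N + 1) * ln (1 + N^-1)).
  have -> : 2 * N + 1 = (2 * n.+1).+1%:R by rewrite -[RHS]natr1 natrM.
  rewrite expRD expRN [_ * ln _]mulrC expRM_natr lnK// /stir.
  have -> : 1 + N^-1 = n.+2%:R / N by rewrite -(natr1 n.+1) -/N mulrDl mul1r divff// gt_eqF.
  have -> : 2 * n.+2%:R = 2 * N + 2 :> R by rewrite -(natr1 n.+1) -/N; ring.
  rewrite expRD factS natrM exprMn -/N.
  have M0 : (n.+2%:R : R) != 0 by rewrite pnatr_eq0.
  have N0' : N != 0 by rewrite gt_eqF.
  have -> : (2 * n.+2 = (2 * n.+1).+2)%N by rewrite mulnS.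
  move: (2 * n.+1)%N => k; rewrite expr_div_n !(exprS _ k.+1) !(exprS _ k).
  move: (n.+2%:R) (n.+1`!%:R) (expR _) (expR _) M0 => M f e e' M0.
  have Mk : M ^+ k != 0 by rewrite expf_neq0.
  have Nk : N ^+ k != 0 by rewrite expf_neq0.
  move: (N) (M ^+ k) (N ^+ k) N0' Mk Nk => N' Mk Nk N0' Mk0 Nk0.
  by field; rewrite M0 Mk0 Nk0 N0'.
by rewrite E lnM ?posrE ?stir_gt0 ?expR_gt0// expRK.
Qed.

Lemma stir_cvg : exists l : R, 0 < l /\ stir n @[n --> \oo] --> l.
Proof.
pose L n := ln (stir n.+1); pose e (n : nat) : R := n.+1%:R^-1.
have LS n : L n.+1 = L n + (2 - (2 * n.+1%:R + 1) * ln (1 + n.+1%:R^-1)) by exact: ln_stirS.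
have up : nonincreasing_seq L.
  apply/nonincreasing_seqP => n; rewrite LS gerDl subr_le0.
  have N0 : 0 < (n.+1%:R : R) by rewrite ltr0n.
  have x0 : 0 <= (n.+1%:R^-1 : R) by rewrite invr_ge0 ltW.
  have q0 : 0 <= (2 * n.+1%:R + 1 : R) by lra.
  apply: le_trans (ler_wpM2l q0 (ln1_ge x0)).
  by rewrite le_eqVlt; apply/orP; left; apply/eqP; field; rewrite !gt_eqF//=; lra.
have dn : nondecreasing_seq (fun n => L n - e n).
  apply/nondecreasing_seqP => n; rewrite LS /e.
  set N : R := n.+1%:R; have N1 : 1 <= N by rewrite ler1n.
  have -> : n.+2%:R^-1 = (N + 1)^-1 by rewrite -(natr1 n.+1).
  have x0 : 0 <= N^-1 by rewrite invr_ge0; lra.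
  have q0 : 0 <= 2 * N + 1 by lra.
  have := ler_wpM2l q0 (ln1_le x0).
  have -> : (2 * N + 1) * (N^-1 - N^-1 ^+ 2 / 2 + N^-1 ^+ 3 / 3) =
     2 + N^-1 ^+ 2 / 6 + N^-1 ^+ 3 / 3 by field; lra.
  have h3 : N^-1 ^+ 3 <= N^-1 ^+ 2.
    by rewrite exprS ler_piMl ?sqr_ge0// invf_le1//; lra.
  have h2 : N^-1 ^+ 2 / 2 <= N^-1 - (N + 1)^-1.
    rewrite (_ : N^-1 - (N + 1)^-1 = N^-1 ^+ 2 * (N / (N + 1))); last by field; lra.
    apply: ler_wpM2l; first exact: sqr_ge0.
    by rewrite ler_pdivlMr; lra.
  move: ((2 * N + 1) * _) (N^-1 ^+ 3) (N^-1 ^+ 2) h3 h2 => p a b h3 h2.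
  by move: (L n) (N^-1) ((N + 1)^-1) h2 => r u v h2 h1; lra.
have c : cvgn L.
  apply: nonincreasing_is_cvgn => //; exists (L 0%N - e 0%N) => _ [k _ <-].
  apply: le_trans (dn 0%N k (leq0n k)) _; rewrite gerBl invr_ge0//.
exists (expR (limn L)); split; first exact: expR_gt0.
rewrite -(cvg_shiftS stir).
rewrite (_ : (fun n => stir n.+1) = expR \o L).
  by apply: cvg_comp c _; exact: continuous_expR.
by apply/funext => n /=; rewrite lnK// posrE stir_gt0.
Qed.

(** Legendre's duplication formula at m + 1/2, by the recursion alone. *)
Lemma hgamma_duplication m : hgamma m.*2 * 4 ^+ m * m`!%:R = Num.sqrt pi * (m.*2)`!%:R.
Proof.
elim: m => [|m IH]; first by rewrite hgamma0 !mulr1.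
rewrite doubleS hgammaSS factS exprS natrM.
have -> : (m.*2.+2)`!%:R = m.*2.+2%:R * m.*2.+1%:R * (m.*2)`!%:R :> R by rewrite !factS !natrM mulrA.
have -> : m.*2.+2%:R = 2 * m.+1%:R :> R by rewrite -doubleS -muln2 natrM mulrC.
transitivity (2 * m.+1%:R * m.*2.+1%:R * (hgamma m.*2 * 4 ^+ m * m`!%:R)); first by field.
by rewrite IH; ring.
Qed.

Definition wallis (m : nat) : R := m%:R * hgamma m.*2 ^+ 2 / m`!%:R ^+ 2.

(* By log-convexity, Gamma(m + 1/2)^2 lies between m!^2 / (m + 1/2) and m!^2 / m. *)
Lemma wallis_cvg : wallis m @[m --> \oo] --> (1 : R).
Proof.
rewrite -(cvg_shiftS wallis).
apply: (@squeeze_cvgr _ _ _ _ (fun n : nat => 1 - n.+1%:R^-1) (fun=> 1)).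
- apply: nearW => n; have f0 : 0 < (n.+1`!%:R : R) by rewrite ltr0n fact_gt0.
  have f20 : 0 < (n.+1`!%:R ^+ 2 : R) by rewrite exprn_gt0.
  have N0 : 0 < (n.+1%:R : R) by rewrite ltr0n.
  have h1 := @hgamma_CS R (n.*2).+1; have h2 := @hgamma_CS R (n.+1).*2.
  rewrite -!doubleS !hgamma_fact in h1; rewrite hgammaSS hgamma_fact in h2.
  rewrite /wallis ler_pdivrMr// mul1r ler_pdivlMr//; apply/andP; split; last first.
    apply: le_trans (ler_wpM2l (ltW N0) h1) _.
    by rewrite mulrA factS natrM -expr2 -[_ * n`!%:R]natrM -factS expr2.
  have dE : n.+1.*2.+1%:R / 2 = n.+1%:R + 2^-1 :> R by rewrite -natr1 -muln2 natrM; field.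
  rewrite mulrCA dE -expr2 in h2.
  apply: le_trans (ler_wpM2l _ h2) _.
    by rewrite subr_ge0 invf_le1// ler1n.
  rewrite mulrA; apply: ler_wpM2r; first exact: sqr_ge0.
  move: (n.+1%:R) N0 => N N0; rewrite mulrBl mul1r mulrDr mulVf ?gt_eqF//.
  have Ni : 0 <= N^-1 by rewrite invr_ge0 ltW.
  by lra.
- by rewrite -[X in _ --> X](subr0 (1 : R)); apply: cvgB; [exact: cvg_cst|exact: cvg_harmonic].
- exact: cvg_cst.
Qed.

(** The duplication formula written in terms of [stir]; the powers of m and of e cancel. *)
Lemma stir_double m : (0 < m)%N -> wallis m * stir m ^+ 2 = 2 * pi * stir (m.*2).
Proof.
move=> m0; have M0 : (m%:R : R) != 0 by rewrite pnatr_eq0 -lt0n.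
have f0 : (m`!%:R : R) != 0 by rewrite pnatr_eq0 -lt0n fact_gt0.
have p4 : (4 ^+ m : R) != 0 by rewrite expf_neq0.
have gE : hgamma m.*2 = Num.sqrt pi * (m.*2)`!%:R / (4 ^+ m * m`!%:R).
  by rewrite -hgamma_duplication -mulrA mulfK// mulf_neq0.
have sp : Num.sqrt pi ^+ 2 = pi :> R by rewrite sqr_sqrtr// pi_ge0.
have EE : expR (2 * (m.*2)%:R) = expR (2 * m%:R) ^+ 2 :> R.
  by rewrite -expRM_natl -muln2 natrM; congr expR; ring.
have XX : (m.*2%:R : R) ^+ (2 * m.*2) = (m%:R ^+ (2 * m)) ^+ 2 * (4 ^+ m) ^+ 2.
  rewrite -muln2 natrM exprMn -!exprM; congr (_ ^+ _ * _); first by lia.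
  by rewrite (_ : 4 = 2 ^+ 2); [rewrite -exprM; congr (_ ^+ _); lia|rewrite expr2 -natrM].
have MM : (m.*2%:R : R) = 2 * m%:R by rewrite -muln2 natrM mulrC.
rewrite /wallis /stir gE EE XX MM -[in RHS]sp.
have X0 : (m%:R ^+ (2 * m) : R) != 0 by rewrite expf_neq0.
move: (m%:R : R) (m%:R ^+ (2 * m)) (expR (2 * m%:R)) (4 ^+ m) (m`!%:R) ((m.*2)`!%:R) (Num.sqrt pi) X0 M0 f0 p4 => M X E P f F s X0 M0 f0 p4.
by field; rewrite X0 M0 f0 p4.
Qed.

(** In the limit [stir_double] reads l^2 = 2 pi l, and l is positive. *)
Lemma stir_cvg_pi : stir n @[n --> \oo] --> (2 * pi : R).
Proof.
have [l [l0 c]] := stir_cvg; suff -> : 2 * pi = l by [].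
have dbl : (fun n => n.*2) @ \oo --> \oo.
  by apply/cvgnyPge => A; near=> n; rewrite -addnn (leq_trans _ (leq_addr n n))//; near: n; exact: nbhs_infty_ge.
have c2 : stir n.*2 @[n --> \oo] --> l by exact: (cvg_comp _ _ dbl c).
have cl : wallis n * stir n ^+ 2 @[n --> \oo] --> 1 * l ^+ 2.
  apply: cvgM; first exact: wallis_cvg.
  by rewrite expr2; under eq_fun do rewrite expr2; exact: (cvgM c c).
have cr : 2 * pi * stir n.*2 @[n --> \oo] --> 2 * pi * l by apply: cvgM => //; exact: cvg_cst.
have E : wallis n * stir n ^+ 2 @[n --> \oo] --> 2 * pi * l.
  apply: cvg_trans cr; apply: near_eq_cvg; near=> n.
  by rewrite stir_double//; near: n; exact: nbhs_infty_gt.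
have lE : 2 * pi * l = 1 * l ^+ 2 by exact: (cvg_unique (@Rhausdorff R) E cl).
by apply: (@mulIf _ l); rewrite ?gt_eqF// lE mul1r expr2.
Unshelve. all: by end_near. Qed.

(** Gamma(m + s) compared with m! m^(s-1), for s = (k + 1)/2. *)
Definition gamma_ratio k m : R := hgamma (m.*2 + k) / (m`!%:R * m%:R `^ (k.+1%:R / 2 - 1)).

(** For k = 0 this is the square root of [wallis], for k = 1 the quotient is 1, and raising k by 2
    multiplies it by 1 + (k + 1)/(2m). *)
Lemma gamma_ratio_cvg k : gamma_ratio k m @[m --> \oo] --> (1 : R).
Proof.
suff [] : gamma_ratio k m @[m --> \oo] --> (1 : R) /\ gamma_ratio k.+1 m @[m --> \oo] --> (1 : R) by [].
elim: k => [|k [IH1 IH2]].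
  split.
    have := cvg_comp _ Num.sqrt wallis_cvg (@sqrt_continuous R 1); rewrite sqrtr1.
    apply: cvg_trans; apply: near_eq_cvg; near=> m.
    have m0 : (0 < m)%N by near: m; exact: nbhs_infty_gt.
    have M0 : 0 < (m%:R : R) by rewrite ltr0n.
    have f0 : 0 < (m`!%:R : R) by rewrite ltr0n fact_gt0.
    rewrite /gamma_ratio addn0 /= (_ : 1 / 2 - 1 = - 2^-1 :> R); last by field.
    have -> : wallis m = (hgamma m.*2 * Num.sqrt m%:R / m`!%:R) ^+ 2.
      by rewrite /wallis !exprMn sqr_sqrtr ?ltW// exprVn [X in X / _]mulrC.
    rewrite sqrtr_sqr ger0_norm; last first.
      by rewrite divr_ge0 ?mulr_ge0 ?sqrtr_ge0// ltW ?hgamma_gt0.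
    by rewrite powRN powR12_sqrt ?ltW// invfM invrK mulrAC mulrA.
  apply: cvg_near_cst; near=> m; rewrite /gamma_ratio addn1 hgamma_fact divff// subrr powRr0 mulr1.
  by rewrite divff// pnatr_eq0 -lt0n fact_gt0.
split=> //; have c : (1 + k.+1%:R / 2 * (m%:R)^-1) * gamma_ratio k m @[m --> \oo] --> ((1 + k.+1%:R / 2 * 0) * 1 : R).
  apply: cvgM => //; apply: cvgD; first exact: cvg_cst.
  apply: cvgM; first exact: cvg_cst.
  have z0 : \forall n \near \oo, 0 < (n%:R : R).
    by near=> n; rewrite ltr0n; near: n; exact: nbhs_infty_gt.
  exact: (proj2 (gtr0_cvgV0 z0) (@cvgr_idn R)).
move: c; rewrite mulr0 addr0 mul1r; apply: cvg_trans; apply: near_eq_cvg; near=> m.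
have m0 : (0 < m)%N by near: m; exact: nbhs_infty_gt.
have M0 : (m%:R : R) != 0 by rewrite pnatr_eq0 -lt0n.
rewrite /gamma_ratio !addnS hgammaSS.
have -> : k.+3%:R / 2 - 1 = (k.+1%:R / 2 - 1) + 1 :> R by rewrite -!natr1; field.
have nz : (k.+1%:R / 2 - 1 + 1 == 0 :> R) ==> (m%:R != 0 :> R) by rewrite M0 implybT.
rewrite (powRD nz) powRr1//.
have -> : (m.*2 + k).+1%:R = 2 * m%:R + k.+1%:R :> R by rewrite -addnS natrD -muln2 natrM mulrC.
have p0 : (m%:R `^ (k.+1%:R / 2 - 1) : R) != 0 by rewrite powR_eq0 negb_and M0.
have f0 : (m`!%:R : R) != 0 by rewrite pnatr_eq0 -lt0n fact_gt0.
move: (m%:R : R) (m%:R `^ (k.+1%:R / 2 - 1)) (m`!%:R) (hgamma _) p0 f0 M0 => M p f h p0 f0 M0.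
by field; rewrite p0 f0 M0.
Unshelve. all: by end_near. Qed.

End stirling.

(** * The two bounds in terms of Gamma values *)

Section gamma_bounds.
Context (R : realType) (k : nat).
Local Notation d := k.+1.
Local Notation hgamma := (@hgamma R).
Local Notation rho := (@rho R d).

Lemma Gamma_natD1 m : Gamma (m%:R + 1 : R) = m`!%:R.
Proof.
rewrite -hgamma_fact /hgamma; congr Gamma.
by rewrite -doubleS -muln2 natrM mulfK// natr1.
Qed.

Lemma Gamma_natDhalf m j : Gamma (m%:R + j.+1%:R / 2 : R) = hgamma (m.*2 + j).
Proof. by rewrite /hgamma; congr Gamma; rewrite -addnS natrD -muln2 natrM; field. Qed.

Lemma hgammaDS m j :
  hgamma (m.*2 + j.+2) = (m%:R + j.+1%:R / 2) * hgamma (m.*2 + j).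
Proof. by rewrite !addnS hgammaSS; congr (_ * _); rewrite -addnS natrD -muln2 natrM; field. Qed.

Lemma cst_lowerE m :
  cst_lower R d m = 2 ^+ (2 * m) * (m`!%:R * hgamma (m.*2 + k)) / hgamma k.
Proof.
have h0 : hgamma k != 0 by rewrite gt_eqF ?hgamma_gt0.
rewrite /cst_lower; elim: m => [|m IH].
  by rewrite big_ord0 add0n !mul1r divff.
rewrite big_ord_recr /= IH (_ : (m.+1.*2 + k = m.*2 + k.+2)%N); last by lia.
rewrite hgammaDS factS natrM mulnS !exprS /gam mulr0 add0r.
by move: (hgamma (m.*2 + k)) => h; field.
Qed.

Lemma pint_rhoX_ratio m :
  pint (rho ^+ m) / pint (rho ^+ (m + m)) =
  hgamma ((m + m).*2 + k.+2) * m`!%:R / ((m + m)`!%:R * hgamma (m.*2 + k.+2)).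
Proof.
(* The integral of rho^j is a constant times j!/Gamma(j + 1 + d/2). The constant cancels in the
   quotient, so it is enough that J is independent of j. *)
pose J j := pint (rho ^+ j) * hgamma (j.*2 + k.+2) / j`!%:R.
have I0 j : pint (rho ^+ j) != 0 by rewrite gt_eqF ?pint_rhoX_gt0.
have H0 j : hgamma j != 0 by rewrite gt_eqF ?hgamma_gt0.
have f0 j : (j`!%:R : R) != 0 by rewrite pnatr_eq0 -lt0n fact_gt0.
have JS j : J j.+1 = J j.
  have := @pint_rho_rec R d j; rewrite /J (_ : (j.+1.*2 + k.+2 = j.*2 + k.+4)%N); last by lia.
  rewrite hgammaDS factS natrM.
  have n0 : (j.+1%:R : R) != 0 by rewrite pnatr_eq0.
  move: (pint _) (pint _) (hgamma _) (j`!%:R) (f0 j) => a b h f fj E.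
  have D0 : 0 < (d%:R + 2 * j.+1%:R : R) by rewrite addr_gt0 ?mulr_gt0 ?ltr0n.
  have -> : b = 2 * j.+1%:R * a / (d%:R + 2 * j.+1%:R) by rewrite -E mulrC mulKf ?gt_eqF.
  rewrite -(natr1 k.+2) -(natr1 k.+1) -(natr1 k) -(natr1 j) in n0 D0 *; move: (j%:R) (k%:R) n0 D0 => j' k' n0 D0.
  by field; rewrite fj n0 gt_eqF.
have JE j : J j = J 0%N by elim: j => // j <-.
have : J m = J (m + m)%N by rewrite !JE.
rewrite /J => E; apply/eqP; rewrite eqr_div ?mulf_neq0//; apply/eqP.
move/eqP: E; rewrite eqr_div// => /eqP.
move: (pint _) (pint _) (hgamma _) (hgamma _) => a b h h' E.
by rewrite mulrCA [LHS]mulrC E; ring.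
Qed.

(** This quotient of the two bounds contains Gamma(2m + 1 + d/2)/(2m)! and the inverse of its
    analogue at m, of sizes (2m)^(d/2) and m^(-d/2): hence the factor 2^(d/2). *)
Lemma upper_factor m : (0 < m)%N ->
  hgamma ((m + m).*2 + k.+2) * m`!%:R / ((m + m)`!%:R * hgamma (m.*2 + k.+2)) =
  2 `^ (d%:R / 2) * gamma_ratio R k.+2 (m + m) / gamma_ratio R k.+2 m.
Proof.
move=> m0; rewrite /gamma_ratio.
have -> : k.+3%:R / 2 - 1 = d%:R / 2 :> R by rewrite -!natr1; field.
have H0 j : hgamma j != 0 by rewrite gt_eqF ?hgamma_gt0.
have f0 j : (j`!%:R : R) != 0 by rewrite pnatr_eq0 -lt0n fact_gt0.
have M0 : 0 < (m%:R : R) by rewrite ltr0n.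
have -> : (m + m)%:R = 2 * m%:R :> R by rewrite natrD mulr2n mulrDl mul1r.
rewrite powRM ?(ltW M0)//.
have p0 : (m%:R `^ (d%:R / 2) : R) != 0 by rewrite powR_eq0 negb_and gt_eqF.
have q0 : (2 `^ (d%:R / 2) : R) != 0 by rewrite powR_eq0 negb_and pnatr_eq0.
move: (m%:R `^ _) (2 `^ _) (f0 m) (f0 (m + m)%N) (H0 (m.*2 + k.+2)%N) p0 q0.
move: (hgamma _) (hgamma _) (m`!%:R) ((m + m)`!%:R) => h h' f f' p q f1 f2 h1 p0 q0.
by field; rewrite ?f1 ?f2 ?h1 ?p0 ?q0.
Qed.

Definition gamma_asym (m : nat) : R :=
  2 * pi / hgamma k * (2 * m%:R / expR 1) ^+ (2 * m) * m%:R `^ (d%:R / 2).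

Lemma lower_factor m : (0 < m)%N -> cst_lower R d m / gamma_asym m =
  gamma_ratio R k m * (stir R m / (2 * pi)).
Proof.
move=> m0; have M0 : 0 < (m%:R : R) by rewrite ltr0n.
have h0 : hgamma k != 0 by rewrite gt_eqF ?hgamma_gt0.
have f0 : (m`!%:R : R) != 0 by rewrite pnatr_eq0 -lt0n fact_gt0.
have pi0 : (pi : R) != 0 by rewrite gt_eqF ?pi_gt0.
have e0 : expR (2 * m%:R) != 0 :> R by rewrite gt_eqF ?expR_gt0.
have X0 : (m%:R ^+ (2 * m) : R) != 0 by rewrite expf_neq0 ?gt_eqF.
have two0 : (2 ^+ (2 * m) : R) != 0 by rewrite expf_neq0.
have p0 : (m%:R `^ (d%:R / 2 - 1) : R) != 0 by rewrite powR_eq0 negb_and gt_eqF.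
have pE : m%:R `^ (d%:R / 2) = m%:R `^ (d%:R / 2 - 1) * m%:R :> R.
  have nz : (d%:R / 2 - 1 + 1 == 0 :> R) ==> (m%:R != 0 :> R) by rewrite (gt_eqF M0) implybT.
  by rewrite -{3}(powRr1 (ltW M0)) -(powRD nz) subrK.
rewrite /gamma_asym cst_lowerE pE /gamma_ratio /stir expr_div_n exprMn -expRM_natl mulr1 natrM.
have := gt_eqF M0; move: (m%:R : R) (m%:R `^ _) (m%:R ^+ (2 * m)) (expR _) (2 ^+ (2 * m)) (m`!%:R) (hgamma _) (hgamma _) (pi : R) h0 f0 pi0 e0 X0 two0 p0.
move=> M p X E P f h h' pi' h0 f0 pi0 e0 X0 P0 p0 /negbT M0'.
by field; rewrite ?h0 ?f0 ?pi0 ?e0 ?X0 ?P0 ?p0 ?M0'.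
Qed.

Lemma cst_lower_asym : cst_lower R d m / gamma_asym m @[m --> \oo] --> (1 : R).
Proof.
have c : gamma_ratio R k m * (stir R m / (2 * pi)) @[m --> \oo] --> (1 * (2 * pi / (2 * pi)) : R).
  apply: cvgM; first exact: gamma_ratio_cvg.
  by apply: cvgM; [exact: stir_cvg_pi|exact: cvg_cst].
move: c; rewrite divff ?mulr1 ?mulf_neq0 ?gt_eqF ?pi_gt0//.
apply: cvg_trans; apply: near_eq_cvg; near=> m.
by rewrite -lower_factor//; near: m; exact: nbhs_infty_gt.
Unshelve. all: by end_near. Qed.

Definition cst_upper m : R :=
  cst_lower R d m * (hgamma ((m + m).*2 + k.+2) * m`!%:R / ((m + m)`!%:R * hgamma (m.*2 + k.+2))).

Lemma cst_upper_asym : cst_upper m / (2 `^ (d%:R / 2) * gamma_asym m) @[m --> \oo] --> (1 : R).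
Proof.
have g := @gamma_ratio_cvg R k.+2.
have dbl : (fun n => (n + n)%N) @ \oo --> \oo.
  by apply/cvgnyPge => A; near=> n; rewrite (leq_trans _ (leq_addr n n))//; near: n; exact: nbhs_infty_ge.
have c : cst_lower R d m / gamma_asym m * (gamma_ratio R k.+2 (m + m) / gamma_ratio R k.+2 m)
    @[m --> \oo] --> (1 * (1 / 1) : R).
  apply: cvgM; first exact: cst_lower_asym.
  by apply: cvgM; [exact: (cvg_comp _ _ dbl g)|exact: (cvgV (oner_neq0 _) g)].
move: c; rewrite divr1 mulr1; apply: cvg_trans; apply: near_eq_cvg; near=> m.
have m0 : (0 < m)%N by near: m; exact: nbhs_infty_gt.
have q0 : (2 `^ (d%:R / 2) : R) != 0 by rewrite powR_eq0 negb_and pnatr_eq0.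
rewrite /cst_upper upper_factor// [(2 `^ _ * _)^-1]invfM.
move: (gamma_asym m)^-1 (gamma_ratio _ _ m)^-1 (cst_lower _ _ _) (gamma_ratio _ _ _) (2 `^ _) q0 => a b c e q q0.
by field.
Unshelve. all: by end_near. Qed.

Lemma lowerE m : 2 ^+ (2 * m) * (Gamma (m%:R + 1) * Gamma (m%:R + d%:R / 2)) /
  Gamma (d%:R / 2) = cst_lower R d m.
Proof. by rewrite cst_lowerE Gamma_natD1 Gamma_natDhalf. Qed.

Lemma upperE m :
  2 ^+ (2 * m) * (Gamma (m%:R + 1) ^+ 2 * Gamma (2 * m%:R + d%:R / 2 + 1)) /
  ((m%:R + d%:R / 2) * Gamma (d%:R / 2) * Gamma (2 * m%:R + 1)) = cst_upper m.
Proof.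
have -> : 2 * m%:R = (m + m)%:R :> R by rewrite natrD mulr2n mulrDl mul1r.
have -> : (m + m)%:R + d%:R / 2 + 1 = (m + m)%:R + k.+3%:R / 2 :> R.
  by rewrite -(natr1 k.+2) -(natr1 k.+1); field.
rewrite !Gamma_natD1 Gamma_natDhalf /cst_upper cst_lowerE [hgamma (m.*2 + k.+2)]hgammaDS -/(hgamma k).
have h0 j : hgamma j != 0 by rewrite gt_eqF ?hgamma_gt0.
have f0 : ((m + m)`!%:R : R) != 0 by rewrite pnatr_eq0 -lt0n fact_gt0.
have D0 : (m%:R + d%:R / 2 : R) != 0 by rewrite gt_eqF// ltr_wpDl// divr_gt0.
move: (h0 k) (h0 (m.*2 + k)%N) f0 D0; move: (hgamma (_ + k.+2)) (hgamma (_ + k)) (hgamma k).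
move: ((m + m)`!%:R) (m`!%:R) (m%:R + d%:R / 2) => F f D h h1 h2 H2 H1 F0 D0.
by field; rewrite ?H2 ?H1 ?F0 ?D0.
Qed.

End gamma_bounds.

Theorem theorem2 (R : realType) (d : nat) (hd : (0 < d)%N) :
  let lower (m : nat) : R :=
    2 ^+ (2 * m) * (Gamma (m%:R + 1) * Gamma (m%:R + d%:R / 2)) /
    Gamma (d%:R / 2) in
  let upper (m : nat) : R :=
    2 ^+ (2 * m) * (Gamma (m%:R + 1) ^+ 2 * Gamma (2 * m%:R + d%:R / 2 + 1)) /
    ((m%:R + d%:R / 2) * Gamma (d%:R / 2) * Gamma (2 * m%:R + 1)) in
  let asym (m : nat) : R :=
    2 * pi / Gamma (d%:R / 2) * (2 * m%:R / expR 1) ^+ (2 * m) *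
    m%:R `^ (d%:R / 2) in
  [/\ forall m : nat,
        lower m <= first_eigenvalue (unit_ball R d) m <= upper m,
      lower m / asym m @[m --> \oo] --> (1 : R)
    & upper m / (2 `^ (d%:R / 2) * asym m) @[m --> \oo] --> (1 : R)].
Proof.
case: d hd => // k _ lower upper asym.
have lE m : lower m = cst_lower R k.+1 m by exact: lowerE.
have uE m : upper m = cst_upper R k m by exact: upperE.
have d0 : (0 < k.+1)%N by [].
split=> [m||].
- rewrite lE uE; apply/andP; split; first exact: first_eigenvalue_ge.
  by rewrite /cst_upper -pint_rhoX_ratio mulrA; exact: first_eigenvalue_le.
- by under eq_fun do rewrite lE; exact: cst_lower_asym.
- by under eq_fun do rewrite uE; exact: cst_upper_asym.
Qed.
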